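(* Let $U,V,W\subset\mathbb{C}$ be nonempty compact sets. **a)** Fix any $p_0\in[1,\infty]$ and consider bi-infinite and semi-infinite matrices as operators on $\ell^{p_0}(\mathbb{Z})$, $\ell^{p_0}(\mathbb{N})$, and finite matrices with the norm $\|\cdot\|_{p_0}$. The equivalent properties (a) the full finite section method (FSM) applies to one operator in $\Psi E(U,V,W)$; (b) the full FSM applies to one operator in $\Psi E_+(U,V,W)$; (c) all operators in $M_+(U,V,W)$ are invertible; (d) all operators in $M_+(U,V,W)$ are invertible, and the inverses are uniformly bounded; (e) one operator in $\Psi E_+(U,V,W)$ is invertible; (f) $0\notin\Sigma_+$; (g) one operator in $\Psi E_+(U,V,W)$ is Fredholm with index $0$; (h) all operators in $M_+(U,V,W)$ are Fredholm with index $0$; (i) $(U,V,W)$ is compatible and $\kappa(U,V,W)=0$; (j) the full FSM applies to all operators in $M(U,V,W)$; (k) the full FSM applies to all operators in $M_+(U,V,W)$ are equivalent to: (l) all $F\in M_{\rm fin}(U,V,W)$ are invertible and their inverses are uniformly bounded. If (a)–(l) are satisfied then $$\mathcal{N}_{{\rm fin},p}\ =\ \max\left(\mathcal{N}_{+,p},\ \mathcal{N}_{+,q}\right)$$ for every $p,q\in[1,\infty]$ with $p^{-1}+q^{-1}=1$. **b)** If (a)–(l) are satisfied and $p,q\in[1,\infty]$ with $p^{-1}+q^{-1}=1$ are both favourable for $(U,V,W)$, this simplifies to $$\mathcal{N}_{{\rm fin},p}=\mathcal{N}_{{\rm fin},q}=\mathcal{N}_{+,p}=\mathcal{N}_{+,q}=\mathcal{N}_p=\mathcal{N}_q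 .$$
   Context: $\mathbb{N}=\{1,2,\dots\}$, and $\infty^{-1}:=0$. $M(U,V,W)$ is the set of bi-infinite tridiagonal matrices $A=(a_{ij})_{i,j\in\mathbb{Z}}$ with $a_{i,i-1}\in U$, $a_{i,i}\in V$, $a_{i,i+1}\in W$ for all $i$, all other entries zero. $M_+(U,V,W)$ is the set of semi-infinite tridiagonal matrices $(a_{ij})_{i,j\in\mathbb{N}}$ with subdiagonal entries in $U$, diagonal entries in $V$, superdiagonal entries in $W$, all other entries zero. $M_n(U,V,W)$ is the set of $n\times n$ matrices of the same kind, and $M_{\rm fin}(U,V,W)=\bigcup_{n\in\mathbb{N}}M_n(U,V,W)$. They act as bounded operators on $\ell^p(\mathbb{Z})$, $\ell^p(\mathbb{N})$, $\mathbb{C}^n$ with the $p$-norm; $\|\cdot\|_p$ is the induced operator norm. Invertibility, spectra, Fredholmness and Fredholm index (dimension of null space minus codimension of image) of the infinite ones do not depend on $p$. $A\in M(U,V,W)$ is pseudoergodic, $A\in \Psi E(U,V,W)$, if for every $n\in\mathbb N$, every $B\in M_n(U,V,W)$ and every $\varepsilon>0$ there is a submatrix $C$ of $A$ composed of rows and columns $k+1,\dots,k+n$ of $A$, for some integer $k$, with $\|B-C\|<\varepsilon$; $\Psi E_+(U,V,W)\subset M_+(U,V,W)$ is defined in the same way. $(U,V,W)$ is compatible if all operators in $M(U,V,W)$ are invertible (equivalently, all operators in $M_+(U,V,W)$ are Fredholm). If $(U,V,W)$ is compatible, all $B_+\in M_+(U,V,W)$ are Fredholm with one and the same index, denoted $\kappa(U,V,W)\in\{-1,0,1\}$.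 $\Sigma_+:=\bigcup_{C_+\in M_+(U,V,W)}\operatorname{spec}C_+$, which equals $\operatorname{spec}B_+$ for every $B_+\in\Psi E_+(U,V,W)$. Norm quantities: $\mathcal{N}_p:=\max_{B\in M(U,V,W)}\|B^{-1}\|_p$ (which is attained, by every $B\in\Psi E(U,V,W)$, when $(U,V,W)$ is compatible); $\mathcal{N}_{+,p}:=\sup_{B_+\in M_+(U,V,W)}\|B_+^{-1}\|_p$; $\mathcal{N}_{{\rm fin},p}:=\sup_{F\in M_{\rm fin}(U,V,W)}\|F^{-1}\|_p$. Favourable: when $(U,V,W)$ is compatible with $\kappa(U,V,W)=0$, $p\in[1,\infty]$ is called favourable (for $(U,V,W)$) if $\|A_+^{-1}\|_p=\max_{C_+\in M_+(U,V,W)}\|C_+^{-1}\|_p=\mathcal{N}_{+,p}=\mathcal{N}_p$ for all $A_+\in\Psi E_+(U,V,W)$. FSM: for $A=(a_{ij})_{i,j\in\mathbb Z}$ and integer cut-off sequences $l_n\to-\infty$, $r_n\to+\infty$, the equation $Ax=b$ is replaced by $\sum_{l_n\le j\le r_n}a_{ij}x_n(j)=b(i)$, $l_n\le i\le r_n$. The FSM applies to $A$ (on $\ell^p$) if $A$ is invertible, the truncated systems are uniquely solvable for all sufficiently large $n$ and every $b$, and, for every $b$, the solutions $x_n$ (extended by zero) approximate the solution $x$ of $Ax=b$: $\|x_n-x\|\to0$ if $p<\infty$; $\|x_n\|=O(1)$ and $x_n(j)\to x(j)$ for every $j$ if $p=\infty$. For semi-infinite matrices the same definition is used with $l_n=1$.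 The full FSM is the choice $l_n=-n$, $r_n=n$ for bi-infinite matrices, and $l_n=1$, $r_n=n$ for semi-infinite matrices. *)

(* Defs.v *)
From HB Require Import structures.
From mathcomp Require Import all_boot all_order all_algebra.
From mathcomp Require Import complex.
From mathcomp Require Import all_classical all_reals all_analysis.

Set Implicit Arguments.
Unset Strict Implicit.
Unset Printing Implicit Defensive.

Import Order.TTheory GRing.Theory Num.Theory numFieldNormedType.Exports.

Local Open Scope classical_set_scope.
Local Open Scope ring_scope.

(* A vector is a function I -> R[i] and an infinite matrix a function
   I -> I -> R[i], where I is int (bi-infinite), nat (semi-infinite) or 'I_n.
   The semi-infinite index set {1, 2, ...} is shifted to {0, 1, ...}. *)

Section LpSpaces.
Context {R : realType} {I : choiceType}.
Implicit Types (p : \bar R) (x y : I -> R[i]).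

(* Used only for 1 <= p; Normc.normc is the R-valued modulus on R[i]. *)
Definition lpnorm p x : \bar R :=
  match p with
  | r%:E => ((\esum_(i in [set: I]) (ComplexField.Normc.normc (x i) `^ r)%:E)
               `^ r^-1)%E
  | _ => ereal_sup [set (ComplexField.Normc.normc (x i))%:E | i in [set: I]]
  end.

Definition lp p : set (I -> R[i]) := [set x | (lpnorm p x < +oo)%E].

Definition opnorm p (T : (I -> R[i]) -> I -> R[i]) : \bar R :=
  ereal_sup [set lpnorm p (T x) | x in [set x | (lpnorm p x <= 1)%E]].

Definition bounded_operator p (T : (I -> R[i]) -> I -> R[i]) : Prop :=
  [/\ forall x, lp p x -> lp p (T x),
      forall (a : R[i]) x y, lp p x -> lp p y ->
        T (fun i => a * x i + y i) = (fun i => a * T x i + T y i)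
    & (opnorm p T < +oo)%E].

(* \sum_(_ \in _) sums over the finite support; the rows of the matrices
   considered below have at most three nonzero entries. *)
Definition matop (A : I -> I -> R[i]) (x : I -> R[i]) : I -> R[i] :=
  fun i => \sum_(j \in [set: I]) A i j * x j.

Definition inverse_on p (A : I -> I -> R[i]) : set ((I -> R[i]) -> I -> R[i]) :=
  [set T | bounded_operator p T /\
           forall x, lp p x -> matop A (T x) = x /\ T (matop A x) = x].

Definition invertible_on p (A : I -> I -> R[i]) : Prop :=
  exists T, inverse_on p A T.

(* The inverse on l^p is unique, so this is its norm if it exists, and it is
   +oo (the infimum of the empty set) if A is not invertible on l^p. *)
Definition invnorm p (A : I -> I -> R[i]) : \bar R :=
  ereal_inf [set opnorm p T | T in inverse_on p A].

Definition spec p (A : I -> I -> R[i]) : set R[i] :=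
  [set lam | ~ invertible_on p (fun i j => A i j - lam *+ (i == j))].

(* For subspaces Y of X, this says dim (X / Y) = n. *)
Definition quotient_dim (X Y : set (I -> R[i])) (n : nat) : Prop :=
  exists e : 'I_n -> I -> R[i], (forall k, X (e k)) /\
    forall x, X x -> exists! c : 'I_n -> R[i],
      Y (fun i => x i - \sum_k c k * e k i).

Definition fredholm_with_index p (A : I -> I -> R[i]) (k : int) : Prop :=
  exists alpha beta : nat,
    [/\ quotient_dim (lp p `&` [set x | matop A x = (fun=> 0)]) [set (fun=> 0)]
          alpha,
        quotient_dim (lp p) (matop A @` lp p) beta
      & k = alpha%:Z - beta%:Z].

End LpSpaces.

Section FiniteSections.
Context {R : realType} {I : choiceType}.
Implicit Types (p : \bar R) (A : I -> I -> R[i]) (D : set I).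

Definition truncated_solution A D (b x : I -> R[i]) : Prop :=
  (forall i, ~ D i -> x i = 0) /\
  (forall i, D i -> \sum_(j \in D) A i j * x j = b i).

Definition approximates p (xs : nat -> I -> R[i]) (x : I -> R[i]) : Prop :=
  if p is +oo%E then
    (exists M : R, \forall n \near \oo, (lpnorm p (xs n) <= M%:E)%E) /\
    (forall j, ComplexField.Normc.normc (xs n j - x j) @[n --> \oo] --> (0 : R))
  else lpnorm p (fun j => xs n j - x j) @[n --> \oo] --> 0%E.

Definition fsm_applies p A (D : nat -> set I) : Prop :=
  [/\ invertible_on p A,
      \forall n \near \oo, forall b, lp p b ->
        exists! x, truncated_solution A (D n) b x
    & forall (b x : I -> R[i]) (xs : nat -> I -> R[i]),
        lp p b -> lp p x -> matop A x = b ->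
        (\forall n \near \oo, truncated_solution A (D n) b (xs n)) ->
        approximates p xs x].

End FiniteSections.

Definition full_fsm {R : realType} (p : \bar R) (A : int -> int -> R[i]) : Prop :=
  fsm_applies p A (fun n => [set i : int | - n%:Z <= i <= n%:Z]).

Definition full_fsm_plus {R : realType} (p : \bar R) (A : nat -> nat -> R[i])
  : Prop := fsm_applies p A (fun n => [set i : nat | (i < n)%N]).

Section Classes.
Context {R : realType}.
Implicit Types (p : \bar R) (U V W : set R[i]).

(* pos embeds the index set in the integers. *)
Definition tridiagonal {I : Type} (pos : I -> int) U V W (A : I -> I -> R[i]) :
  Prop := forall i j : I,
  [/\ pos i = pos j + 1 -> U (A i j),
      pos i = pos j -> V (A i j),
      pos j = pos i + 1 -> W (A i j)
    & 1 < `|pos i - pos j| -> A i j = 0].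

Definition Mbi U V W : set (int -> int -> R[i]) :=
  [set A | tridiagonal id U V W A].

Definition Mplus U V W : set (nat -> nat -> R[i]) :=
  [set A | tridiagonal Posz U V W A].

Definition Mn (n : nat) U V W : set 'M[R[i]]_n :=
  [set F : 'M[R[i]]_n | tridiagonal (fun i : 'I_n => Posz i) U V W F].

(* Closeness of finite matrices is measured in the p-operator norm; as all norms
   on 'M_n are equivalent, the resulting class does not depend on p. *)
Definition pseudoergodic {I : Type} (pos : I -> int) p U V W
    (A : I -> I -> R[i]) : Prop :=
  forall n (B : 'M[R[i]]_n) (eps : R), (0 < n)%N -> Mn U V W B -> 0 < eps ->
  exists (k : int) (f : 'I_n -> I),
    (forall i : 'I_n, pos (f i) = k + 1 + Posz i) /\
    (opnorm p (matop (fun i j => (B i j - A (f i) (f j))%R)) < eps%:E)%E.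

Definition PsiE p U V W : set (int -> int -> R[i]) :=
  Mbi U V W `&` [set A | pseudoergodic id p U V W A].

Definition PsiEplus p U V W : set (nat -> nat -> R[i]) :=
  Mplus U V W `&` [set A | pseudoergodic Posz p U V W A].

Definition compatible p U V W : Prop :=
  forall A, Mbi U V W A -> invertible_on p A.

(* If (U, V, W) is compatible, the set is a singleton; otherwise the value is
   meaningless, so kappa is only used together with compatibility. *)
Definition kappa p U V W : int :=
  xget 0 [set k | forall B, Mplus U V W B -> fredholm_with_index p B k].

Definition Sigma_plus p U V W : set R[i] :=
  \bigcup_(C in Mplus U V W) spec p C.

Definition invnorm_fin p (n : nat) (F : 'M[R[i]]_n) : \bar R :=
  if F \in unitmx then opnorm p (matop (invmx F)) else +oo%E.

(* If (U, V, W) is compatible, this supremum is attained (by every matrix in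
   PsiE p U V W), i.e. it is a maximum. *)
Definition Nbi p U V W : \bar R :=
  ereal_sup [set invnorm p B | B in Mbi U V W].

Definition Nplus p U V W : \bar R :=
  ereal_sup [set invnorm p B | B in Mplus U V W].

Definition Nfin p U V W : \bar R :=
  ereal_sup (\bigcup_(n in [set n | (0 < n)%N])
    [set invnorm_fin p F | F in @Mn n U V W]).

(* The first clause says that the supremum over Mplus U V W is a maximum,
   attained at A (an element of Mplus U V W). *)
Definition favourable p U V W : Prop :=
  [/\ compatible p U V W, kappa p U V W = 0 &
      forall A, PsiEplus p U V W A ->
        [/\ forall C, Mplus U V W C -> (invnorm p C <= invnorm p A)%E,
            invnorm p A = Nplus p U V W
          & Nplus p U V W = Nbi p U V W]].

Definition finite_uniformly_invertible p U V W : Prop :=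
  (forall n (F : 'M[R[i]]_n), (0 < n)%N -> Mn U V W F -> F \in unitmx) /\
  exists K : R, forall n (F : 'M[R[i]]_n), (0 < n)%N -> Mn U V W F ->
    (opnorm p (matop (invmx F)) <= K%:E)%E.

End Classes.

(* Main.v *)
Require Import Defs.
From HB Require Import structures.
From mathcomp Require Import all_boot all_order all_algebra.
From mathcomp Require Import complex.
From mathcomp Require Import all_classical all_reals all_analysis.
From mathcomp Require Import zify ring lra.

(* The basic tool is the lower bound |x| <= C |J x| in the sup norm. By Combes-Thomas
   it comes with exponential localization, so it does not depend on p; it passes to
   limits of translates, and for J^T it makes J onto.

   An invertible pseudoergodic operator, or one whose range has finite codimension,
   forces a uniform lower bound on the whole class of bi-infinite operators: the
   uniform boundedness principle bounds the transpose, and finitely many functionals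
   are annihilated by combining copies of a vector. By compactness, either the
   half-line operators are also uniformly bounded below or one of them has a kernel
   vector, and then, changing one row at a time, all of them do. Gluing two kernel
   vectors around a spare row shows that the class and the transposed class cannot
   both have kernels. So the index of all half-line operators is 0, 1 or -1, and in
   the last two cases kernel vectors, cut off at the far end of the window, make the
   finite sections unstable.

   In the first case a vector on a finite interval is extended to a half-line by a
   geometric sequence of copies separated by spare rows, to the right or to the left
   according to the sizes of its two end values. This bounds the inverses of the
   finite matrices, by N_{+,p} for chains to the right and, after transposition and
   reflection, by N_{+,q} for chains to the left. Conversely finite sections bound
   N_{+,p} by N_{fin,p}, and the same reflection exchanges p and q in N_{fin,p} and
   in N_p. *)

Set Implicit Arguments.
Unset Strict Implicit.
Unset Printing Implicit Defensive.

Import Order.TTheory GRing.Theory Num.Theory numFieldNormedType.Exports.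

Local Open Scope classical_set_scope.
Local Open Scope ring_scope.

(** * Moduli and ultrafilter limits *)

(** Everything takes place on the integers. A compression to a half-line or an interval is completed
    by identity rows, so that it is again a tridiagonal operator on the line, and bounds on the
    line, on half-lines and on intervals all have the form [lb]. Transposition and reflection both
    exchange [U] and [W], and their composition preserves the class; hence a bound for all
    transposes is as good as a bound for the class itself. The obstacle is that [p = 1] and
    [p = +oo] have to be treated along with the other exponents, although l^oo has no convenient
    dual. Dual norms are therefore only taken of finitely supported functionals ([dual_le]), and
    limits are taken coordinatewise, the norms being recovered by Fatou ([lple_fatou]). All of (a)
    to (l) are linked through [interval_lb], a statement in which no [p] occurs. The norm identities
    need exact constants, for which Combes-Thomas bounds are too lossy; there [norm_lb] is used, and
    the constant survives the passage to chains because the p-norm is multiplicative on tensor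
    products. *)

Notation nc := (@ComplexField.Normc.normc _).
#[global] Arguments ComplexField.Normc.normc : simpl never.

Ltac ilia :=
  repeat match goal with H : ?P |- _ => lazymatch type of P with Prop =>
    lazymatch P with
    | is_true (leq _ _) => fail
    | is_true (negb (leq _ _)) => fail
    | is_true (@Order.le _ _ ?a _) =>
        let t := type of a in tryif unify t int then fail else clear H
    | is_true (@Order.lt _ _ ?a _) =>
        let t := type of a in tryif unify t int then fail else clear H
    | is_true (negb (@Order.le _ _ ?a _)) =>
        let t := type of a in tryif unify t int then fail else clear H
    | is_true (negb (@eq_op _ ?a _)) =>
        let t := type of a in
        tryif (first [unify t int | unify t nat]) then fail else clear H
    | @eq _ ?a _ =>
        let t := type of a in
        tryif (first [unify t int | unify t nat]) then fail else clear H
    | not (@eq _ ?a _) =>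
        let t := type of a in
        tryif (first [unify t int | unify t nat]) then fail else clear H
    | or _ _ => fail
    | _ => clear H
    end end end; lia.

Section Modulus.
Context {R : realType}.
Implicit Types x y z : R[i].

Lemma nc_norm x : `|x| = (nc x)%:C%C. Proof. by []. Qed.

Lemma nc_ge0 x : 0 <= nc x.
Proof. by case: x => a b; rewrite /ComplexField.Normc.normc sqrtr_ge0. Qed.

Lemma nc0 : nc (0 : R[i]) = 0. Proof. exact: ComplexField.Normc.normc0. Qed.

Lemma nc1 : nc (1 : R[i]) = 1. Proof. exact: ComplexField.Normc.normc1. Qed.

Lemma ncM x y : nc (x * y) = nc x * nc y.
Proof. exact: ComplexField.Normc.normcM. Qed.

Lemma ncV x : nc x^-1 = (nc x)^-1.
Proof. exact: ComplexField.Normc.normcV. Qed.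

Lemma ncN x : nc (- x) = nc x. Proof. exact: normcN. Qed.

Lemma ncD x y : nc (x + y) <= nc x + nc y. Proof. exact: le_normcD. Qed.

Lemma ncB x y : nc (x - y) <= nc x + nc y.
Proof. by rewrite -(ncN y) ncD. Qed.

Lemma ncBC x y : nc (x - y) = nc (y - x).
Proof. by rewrite -ncN opprB. Qed.

Lemma nc_eq0 x : (nc x == 0) = (x == 0).
Proof.
by apply/eqP/eqP => [/ComplexField.Normc.eq0_normc|->] //; rewrite nc0.
Qed.

Lemma nc_gt0 x : (0 < nc x) = (x != 0).
Proof. by rewrite lt_def nc_ge0 nc_eq0 andbT. Qed.

Lemma nc_real (r : R) : nc (r%:C)%C = `|r|.
Proof.
by rewrite /ComplexField.Normc.normc /= expr0n /= addr0 sqrtr_sqr.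
Qed.

Lemma ncX x n : nc (x ^+ n) = nc x ^+ n.
Proof. by elim: n => [|n IH]; rewrite ?expr0 ?nc1// !exprS ncM IH. Qed.

Lemma nc_sum (I : Type) (r : seq I) (P : pred I) (F : I -> R[i]) :
  nc (\sum_(i <- r | P i) F i) <= \sum_(i <- r | P i) nc (F i).
Proof.
elim/big_ind2 : _ => [|x1 x2 y1 y2 h1 h2|//]; first by rewrite nc0.
exact: le_trans (ncD _ _) (lerD h1 h2).
Qed.

Lemma nc_distD x y : nc x <= nc y + nc (x - y).
Proof. by have := ncD y (x - y); rewrite addrC subrK. Qed.

Lemma nc_le0 x : nc x <= 0 -> x = 0.
Proof.
by move=> h; apply/eqP; rewrite -nc_eq0 eq_le h nc_ge0.
Qed.

End Modulus.

Section UltraLimits.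

Lemma ex_ultra : exists F : set_system nat, UltraFilter F /\ \oo `<=` F.
Proof. exact: ultraFilterLemma. Qed.

(** An ultrafilter finer than the filter of cofinite sets, fixed once and for all. Bounded sequences
    converge along it, so that no diagonal subsequences have to be extracted when infinitely many
    coordinates converge together. *)
Definition uF : set_system nat := projT1 (cid ex_ultra).

Lemma uF_ultra : UltraFilter uF.
Proof. by rewrite /uF; case: cid => F []. Qed.

Lemma uF_oo : \oo `<=` uF.
Proof. by rewrite /uF; case: cid => F []. Qed.

#[local] Existing Instance uF_ultra.

Lemma uF_ge N : uF [set n | (N <= n)%N].
Proof. by apply: uF_oo; exists N. Qed.

Lemma uF_ex (A : set nat) : uF A -> exists n, A n.
Proof. by move=> h; have [n An] := filter_ex h; exists n. Qed.

Context {R : realType}.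
Implicit Types (x y : nat -> R[i]) (l : R[i]).

Definition ucv x l := forall e : R, 0 < e -> uF [set n | nc (x n - l) < e].

Lemma ucv_cst l : ucv (fun=> l) l.
Proof.
by move=> e e0; apply: filterS (filterT) => n _ /=; rewrite subrr nc0.
Qed.

Lemma ucvD x y l m : ucv x l -> ucv y m -> ucv (fun n => x n + y n) (l + m).
Proof.
move=> hx hy e e0; have e2 : 0 < e / 2 by rewrite divr_gt0.
apply: filterS2 (hx _ e2) (hy _ e2) => n /= h1 h2.
rewrite (_ : x n + y n - (l + m) = (x n - l) + (y n - m)); last by ring.
by rewrite (le_lt_trans (ncD _ _))// [e]splitr ltrD.
Qed.

Lemma ucv_bound x l : ucv x l -> uF [set n | nc (x n) <= nc l + 1].
Proof.
move=> /(_ 1 ltr01); apply: filterS => n /= h.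
by apply: (le_trans (nc_distD (x n) l)); rewrite lerD2l ltW.
Qed.

Lemma ucvM x y l m : ucv x l -> ucv y m -> ucv (fun n => x n * y n) (l * m).
Proof.
move=> hx hy e e0.
pose K := nc l + nc m + 1.
have K0 : 0 < K by rewrite /K ltr_wpDl// addr_ge0 ?nc_ge0.
have e2 : 0 < e / (2 * K) by rewrite divr_gt0// mulr_gt0.
apply: filterS3 (hx _ e2) (hy _ e2) (ucv_bound hx) => n /= h1 h2 h3.
rewrite (_ : x n * y n - l * m = x n * (y n - m) + (x n - l) * m); last by ring.
rewrite (le_lt_trans (ncD _ _))// !ncM [e]splitr.
have eK : e / 2 = K * (e / (2 * K)) by field; rewrite lt0r_neq0.
rewrite eK ltr_leD//.
  apply: (@le_lt_trans _ _ (K * nc (y n - m))).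
    by rewrite ler_wpM2r ?nc_ge0// (le_trans h3)// /K; have := nc_ge0 m; lra.
  by rewrite ltr_pM2l.
rewrite mulrC ler_pM ?nc_ge0 ?ltW//.
by rewrite /K; have := nc_ge0 l; lra.
Qed.

Lemma ucv_le x l (c : R) : ucv x l -> uF [set n | nc (x n) <= c] -> nc l <= c.
Proof.
move=> hx hc; apply/ler_addgt0Pr => e e0.
have [n [/= h1 h2]] := filter_ex (filterI (hx _ e0) hc).
by apply: (le_trans (nc_distD l (x n))); rewrite lerD// ncBC ltW.
Qed.

Lemma ucv_ge x l (c : R) : ucv x l -> uF [set n | c <= nc (x n)] -> c <= nc l.
Proof.
move=> hx hc; apply/ler_addgt0Pr => e e0.
have [n [/= h1 h2]] := filter_ex (filterI (hx _ e0) hc).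
by apply: (le_trans h2); apply: (le_trans (nc_distD (x n) l)); rewrite lerD// ltW.
Qed.

Lemma ucv_unique x l m : ucv x l -> ucv x m -> l = m.
Proof.
move=> hl hm; apply/eqP; rewrite -subr_eq0; apply/eqP/nc_le0.
apply: (@ucv_le (fun=> l - m)); first exact: ucv_cst.
suff : forall e : R, 0 < e -> nc (l - m) <= e.
  move=> h; apply: filterS (filterT) => n _ /=.
  by apply/ler_addgt0Pr => e e0; rewrite add0r h.
move=> e e0; have e2 : 0 < e / 2 by rewrite divr_gt0.
have [n [/= h1 h2]] := filter_ex (filterI (hl _ e2) (hm _ e2)).
rewrite (_ : l - m = (x n - m) - (x n - l)); last by ring.
by rewrite (le_trans (ncB _ _))// [e]splitr lerD// ltW.
Qed.

Lemma ucv_near x y l : uF [set n | x n = y n] -> ucv x l -> ucv y l.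
Proof.
by move=> h hx e e0; apply: filterS2 h (hx _ e0) => n /= ->.
Qed.

(** Compactness gives a cluster point of the image filter; since [uF] is an ultrafilter, a cluster
    point is already a limit. *)
Lemma ucv_compact (A : set R[i]) x : compact (A : set (R[i])^o) ->
  (forall n, A (x n)) -> exists2 l, A l & ucv x l.
Proof.
move=> cA xA.
have pF : ProperFilter (fmap (x : nat -> (R[i])^o) uF) by apply: fmap_proper_filter.
have [l [Al hl]] : A `&` cluster (fmap (x : nat -> (R[i])^o) uF) !=set0.
  apply: (cA _ pF); rewrite /fmap /=.
  by apply: (filterS _ filterT) => n _ /=.
exists l => // e e0.
have [//|hC] := in_ultra_setVsetC [set n | nc (x n - l) < e] uF_ultra.
have : nbhs (l : (R[i])^o) (ball (l : (R[i])^o) (e%:C)%C).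
  by apply: nbhsx_ballx; rewrite ltcR.
move=> hb; have [z [hz1 hz2]] : ([set z : (R[i])^o | ~ (nc (z - l) < e)] `&`
   ball (l : (R[i])^o) (e%:C)%C) !=set0.
  by apply: hl hb; apply: filterS hC => n /=.
by exfalso; apply: hz1; rewrite -ltcR -nc_norm distrC.
Qed.

Lemma ucv_bounded x (M : R) : (forall n, nc (x n) <= M) -> exists l, ucv x l.
Proof.
move=> hM.
have rc (f : nat -> R) : (forall n, `|f n| <= M) ->
  exists l : R, forall e, 0 < e -> uF [set n | `|f n - l| < e].
  move=> fM; have pF : ProperFilter (fmap f uF) by apply: fmap_proper_filter.
  have [l [_ hl]] : `[- M, M]%classic `&` cluster (fmap f uF) !=set0.
    apply: (@segment_compact R (- M) M _ pF); rewrite /fmap /=.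
    apply: (filterS _ filterT) => n _ /=.
    by rewrite in_itv/=; have := fM n; rewrite ler_norml.
  exists l => // e e0.
  have [//|hC] := in_ultra_setVsetC [set n | `|f n - l| < e] uF_ultra.
  have hb : nbhs l (ball l e) by apply: nbhsx_ballx.
  have [z [hz1 hz2]] : ([set z : R | ~ (`|z - l| < e)] `&` ball l e) !=set0.
    by apply: hl hb; apply: filterS hC => n /=.
  by exfalso; apply: hz1; rewrite distrC.
have nRe (z : R[i]) : `|complex.Re z| <= nc z.
  case: z => a b /=; rewrite /ComplexField.Normc.normc -sqrtr_sqr ler_sqrt.
    by rewrite lerDl sqr_ge0.
  by rewrite addr_ge0 ?sqr_ge0.
have nIm (z : R[i]) : `|complex.Im z| <= nc z.
  case: z => a b /=; rewrite /ComplexField.Normc.normc -sqrtr_sqr ler_sqrt.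
    by rewrite lerDr sqr_ge0.
  by rewrite addr_ge0 ?sqr_ge0.
have [a ha] := rc (fun n => complex.Re (x n)) (fun n => le_trans (nRe _) (hM n)).
have [b hb] := rc (fun n => complex.Im (x n)) (fun n => le_trans (nIm _) (hM n)).
exists (a +i* b)%C => e e0; have e2 : 0 < e / 2 by rewrite divr_gt0.
apply: filterS2 (ha _ e2) (hb _ e2) => n /=.
case: (x n) => c d h1 h2.
have -> : Complex c d - Complex a b = ((c - a)%:C%C + 'i%C * (d - b)%:C%C : R[i]).
  by apply/eqP; rewrite eq_complex /= !(mul0r, mul1r, add0r, addr0, subr0, mulr0) !eqxx.
rewrite (le_lt_trans (ncD _ _))// ncM !nc_real [e]splitr.
have -> : nc ('i%C : R[i]) = 1.
  by rewrite /ComplexField.Normc.normc /= expr0n /= add0r expr1n sqrtr1.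
by rewrite mul1r ltrD.
Qed.

Lemma compact_bound (A : set R[i]) : compact (A : set (R[i])^o) ->
  exists k : R, forall z, A z -> nc z <= k.
Proof.
move=> cA; apply: contrapT => hk.
have /choice[x hx] : forall n : nat, exists z, A z /\ n%:R < nc z.
  move=> n; apply: contrapT => h; apply: hk; exists n%:R => z Az.
  by rewrite leNgt; apply/negP => hz; apply: h; exists z.
have [l _ xl] := ucv_compact cA (fun n => (hx n).1).
have [n [/= h1 h2]] := filter_ex (filterI (ucv_bound xl) (uF_ge (Num.truncn (nc l + 1)).+1)).
have : n%:R < nc l + 1 by apply: lt_le_trans (hx n).2 h1.
apply/negP; rewrite -leNgt ltW//; apply: lt_le_trans (Num.Theory.truncnS_gt _) _.
by rewrite ler_nat.
Qed.

End UltraLimits.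
#[global] Existing Instance uF_ultra.

(** * Tridiagonal operators and lower bounds *)

(** However bad the initial bound [Y0] is, iterating [Y -> c + Y / 2] leads to the fixed point
    [2 * c]. In this way a perturbation of half the size is absorbed. *)
Lemma halving {R : realType} (A : R -> Prop) (v c Y0 : R) : A Y0 ->
  (forall Y, A Y -> A (c + Y / 2)) -> (forall Y, A Y -> v <= Y) -> v <= 2 * c.
Proof.
move=> A0 hA hv.
have hk (k : nat) : A (2 * c + (Y0 - 2 * c) / 2 ^+ k).
  elim: k => [|k IH]; first by rewrite expr0 divr1 addrC subrK.
  have := hA _ IH; rewrite (_ : c + _ / 2 = 2 * c + (Y0 - 2 * c) / 2 ^+ k.+1)//.
  by rewrite exprS invfM; field.
rewrite leNgt; apply/negP => h.
pose e := v - 2 * c; have e0 : 0 < e by rewrite subr_gt0.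
have hY (k : nat) : e * 2 ^+ k <= Y0 - 2 * c.
  rewrite -ler_pdivlMr ?exprn_gt0// /e lerBlDl; exact: hv.
have h0 : 0 <= Y0 - 2 * c by have := hY 0%N; rewrite expr0 mulr1; lra.
pose n := (Num.truncn ((Y0 - 2 * c) / e)).+1.
have : (Y0 - 2 * c) / e < n%:R by exact: Num.Theory.truncnS_gt.
apply/negP; rewrite -leNgt ler_pdivlMr// (le_trans _ (hY n))// mulrC ler_pM2l//.
by rewrite -natrX ler_nat ltnW// ltn_expl.
Qed.

Section Jacobi.
Context {R : realType}.
Implicit Types (x y w : int -> R[i]) (i m k : int).

(* Row i of a tridiagonal matrix: its entries in columns i - 1, i and i + 1. *)
Definition jac := int -> R[i] * R[i] * R[i].
Implicit Types J : jac.
Definition lo J i := (J i).1.1.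
Definition di J i := (J i).1.2.
Definition up J i := (J i).2.

Definition op J x i := lo J i * x (i - 1) + di J i * x i + up J i * x (i + 1).
Definition bdd (K : R) J :=
  forall i, [/\ nc (lo J i) <= K, nc (di J i) <= K & nc (up J i) <= K].
Definition bnd x (X : R) := forall i, nc (x i) <= X.

(** The bound [X] does not enter the conclusion: it only restricts attention to bounded vectors,
    since the three-term recursion may also have unbounded solutions. *)
Definition lb J (C : R) := forall x X d,
  bnd x X -> bnd (op J x) d -> bnd x (C * d).
(* [|x m| <= C * sup_i |y i| / s ^ |i - m|] for all [m]. *)
Definition localized (C s : R) y x := forall m d,
  (forall i, nc (y i) <= d * s ^+ `|i - m|%N) -> nc (x m) <= C * d.

Definition tr J : jac := fun i => (up J (i - 1), di J i, lo J (i + 1)).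
Definition flip J : jac := fun i => (up J (- i), di J (- i), lo J (- i)).
Definition sh k J : jac := fun i => J (i + k).
Definition mask (D : pred int) x i := if D i then x i else 0.
(* The compression to D, completed by the identity outside D. *)
Definition cut (D : pred int) J : jac := fun i =>
  if D i then (if D (i - 1) then lo J i else 0, di J i,
               if D (i + 1) then up J i else 0) else (0, 1, 0).
Definition supp (D : pred int) x := forall i, ~~ D i -> x i = 0.

Lemma bdd_ge0 K J : bdd K J -> 0 <= K.
Proof. by move=> /(_ 0)[h _ _]; exact: le_trans (nc_ge0 _) h. Qed.

Lemma bnd_ge0 x X : bnd x X -> 0 <= X.
Proof. by move=> /(_ 0) h; exact: le_trans (nc_ge0 _) h. Qed.

Lemma op_lin J (a : R[i]) x y i :
  op J (fun j => a * x j + y j) i = a * op J x i + op J y i.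
Proof. by rewrite /op; ring. Qed.

Lemma opZ J (a : R[i]) x i : op J (fun j => a * x j) i = a * op J x i.
Proof. by rewrite /op; ring. Qed.

Lemma opB J x y i : op J (fun j => x j - y j) i = op J x i - op J y i.
Proof. by rewrite /op; ring. Qed.

Lemma op_bnd K J x X : bdd K J -> bnd x X -> bnd (op J x) (3 * K * X).
Proof.
move=> hJ hx i; have [h1 h2 h3] := hJ i.
rewrite (le_trans (ncD _ _))// (_ : 3 * K * X = (K * X + K * X) + K * X); last by ring.
by rewrite lerD// ?(le_trans (ncD _ _))// ?lerD// ncM ler_pM ?nc_ge0.
Qed.

Lemma op_mul J (w : int -> R) x i : op J (fun j => (w j)%:C%C * x j) i =
  (w i)%:C%C * op J x i + (lo J i * ((w (i - 1) - w i)%:C%C * x (i - 1)) +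
   up J i * ((w (i + 1) - w i)%:C%C * x (i + 1))).
Proof. by rewrite /op !rmorphB; ring. Qed.

Lemma op_mul_le K J (w : int -> R) x i (e : R) : bdd K J ->
  `|w (i - 1) - w i| * nc (x (i - 1)) <= e ->
  `|w (i + 1) - w i| * nc (x (i + 1)) <= e ->
  nc (op J (fun j => (w j)%:C%C * x j) i) <= `|w i| * nc (op J x i) + 2 * K * e.
Proof.
move=> hJ h1 h2; rewrite op_mul (le_trans (ncD _ _))// ncM nc_real lerD2l.
have [k1 _ k2] := hJ i.
rewrite (le_trans (ncD _ _))// (_ : 2 * K * e = K * e + K * e); last by ring.
by rewrite lerD// ncM ler_pM ?nc_ge0// ncM nc_real.
Qed.

Lemma trK J : tr (tr J) = J.
Proof.
apply/funext => i; rewrite /tr /lo /di /up /= subrK addrK.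
by case: (J i) => -[].
Qed.

Lemma flipK J : flip (flip J) = J.
Proof.
by apply/funext => i; rewrite /flip /lo /di /up /= opprK; case: (J i) => -[].
Qed.

Lemma op_flip J x i : op (flip J) (fun j => x (- j)) i = op J x (- i).
Proof.
rewrite /op /flip /lo /di /up /=.
rewrite (_ : - (i - 1) = - i + 1); last by ilia.
rewrite (_ : - (i + 1) = - i - 1); last by ilia.
by ring.
Qed.

Lemma op_sh k J x i : op (sh k J) (fun j => x (j + k)) i = op J x (i + k).
Proof.
rewrite /op /sh /lo /di /up /=.
by rewrite (addrAC i (-1) k) (addrAC i 1 k).
Qed.

Lemma tr_cut D J : tr (cut D J) = cut D (tr J).
Proof.
apply/funext => i; rewrite /tr /cut /lo /di /up /= subrK addrK.
by case: (D i); case: (D (i - 1)); case: (D (i + 1)).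
Qed.

Lemma flip_cut D J : flip (cut D J) = cut (fun i => D (- i)) (flip J).
Proof.
apply/funext => i; rewrite /flip /cut /lo /di /up /=.
rewrite (_ : - (i - 1) = - i + 1); last by ilia.
rewrite (_ : - (i + 1) = - i - 1); last by ilia.
by case: (D (- i)).
Qed.

Lemma sh_cut k D J : sh k (cut D J) = cut (fun i => D (i + k)) (sh k J).
Proof.
apply/funext => i; rewrite /sh /cut /lo /di /up /=.
by rewrite (addrAC i (-1) k) (addrAC i 1 k).
Qed.

Lemma tr_sh k J : tr (sh k J) = sh k (tr J).
Proof.
by apply/funext => i; rewrite /tr /sh /lo /di /up (addrAC i (-1)) (addrAC i 1).
Qed.

Lemma cut_bdd K D J : bdd K J -> bdd (K + 1) (cut D J).
Proof.
move=> hJ i; have [h1 h2 h3] := hJ i; have K0 := bdd_ge0 hJ.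
have hK : K <= K + 1 by rewrite lerDl.
rewrite /cut /lo /di /up; case: (D i) => /=; last first.
  by rewrite nc0 nc1 lerDr addr_ge0.
by split; [case: ifP => _|exact: le_trans hK|case: ifP => _];
  rewrite ?nc0 ?addr_ge0// (le_trans _ hK).
Qed.

Lemma tr_bdd K J : bdd K J -> bdd K (tr J).
Proof.
move=> h i; rewrite /tr /lo /di /up /=; split.
- by have [] := h (i - 1).
- by have [] := h i.
- by have [] := h (i + 1).
Qed.

Lemma op_cut D J x i :
  op (cut D J) x i = if D i then op J (mask D x) i else x i.
Proof.
rewrite /op /cut /lo /di /up /mask; case: (D i) => /=; last by ring.
by case: (D (i - 1)); case: (D (i + 1)) => /=; ring.
Qed.

Lemma mask_supp D x : supp D x -> mask D x = x.
Proof.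
by move=> h; apply/funext => i; rewrite /mask; case: ifPn => // /h.
Qed.

Lemma supp_mask D x : supp D (mask D x).
Proof. by move=> i /negbTE h; rewrite /mask h. Qed.

Lemma op_cut_supp D J x i : supp D x ->
  op (cut D J) x i = if D i then op J x i else 0.
Proof. by move=> h; rewrite op_cut mask_supp//; case: ifPn => // /h. Qed.

Lemma mask_bnd D x X : bnd x X -> bnd (mask D x) X.
Proof.
move=> h i; rewrite /mask; case: ifP => _ //; rewrite nc0; exact: bnd_ge0 h.
Qed.

Lemma lb_flip J C : lb J C -> lb (flip J) C.
Proof.
move=> h x X d hx hd i.
have := h (fun j => x (- j)) X d (fun j => hx (- j)).
move=> /(_ _ (- i)); rewrite opprK; apply => j.
have := op_flip (flip J) x j; rewrite flipK => ->; exact: hd.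
Qed.

Lemma lb_sh k J C : lb J C -> lb (sh k J) C.
Proof.
move=> h x X d hx hd i.
have := h (fun j => x (j - k)) X d (fun j => hx (j - k)).
move=> /(_ _ (i + k)); rewrite addrK; apply => j.
have := op_sh k J (fun j => x (j - k)) (j - k); rewrite subrK.
rewrite (_ : (fun j0 => x (j0 + k - k)) = x); last by apply/funext => a; rewrite addrK.
by move=> <-; exact: hd.
Qed.

Lemma lb_le J C C' : C <= C' -> lb J C -> lb J C'.
Proof.
move=> hC h x X d hx hd i; apply: le_trans (h _ _ _ hx hd i) _.
by rewrite ler_wpM2r// (bnd_ge0 hd).
Qed.

(* Combes-Thomas: conjugating J by the slowly varying weight s ^ |i - m| is a
   small perturbation, so a lower bound survives with weights. *)
Lemma lb_localized K J C s x X : bdd K J -> lb J C -> 0 <= C -> 1 <= s ->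
  4 * C * K * (s - 1) <= 1 -> bnd x X -> localized (2 * C) s (op J x) x.
Proof.
move=> hJ hC C0 s1 hs hx m d hd.
have K0 := bdd_ge0 hJ; have s0 : 0 < s by exact: lt_le_trans ltr01 s1.
pose w i : R := (s ^+ `|i - m|%N)^-1.
have w0 i : 0 < w i by rewrite invr_gt0 exprn_gt0.
have w1 i : w i <= 1 by rewrite invf_le1 ?exprn_gt0// exprn_ege1.
have d0 : 0 <= d.
  have := hd m; rewrite subrr expr0 mulr1; exact: le_trans (nc_ge0 _).
(* The weight changes by a factor of at most [s] between neighbours, so its commutator with a
   tridiagonal operator has relative size [s - 1]. *)
have ws i j : (`|i - j|%N <= 1)%N -> `|w i - w j| <= (s - 1) * w i.
  move=> hij; rewrite /w.
  have [e|[e|e]] : `|i - m|%N = `|j - m|%N \/ `|i - m|%N = `|j - m|.+1%N \/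
     `|i - m|.+1%N = `|j - m|%N by ilia.
  - by by rewrite e subrr normr0 mulr_ge0 ?subr_ge0 ?invr_ge0 ?exprn_ge0 ?(ltW s0).
  - rewrite e -[X in `|_ - X|](_ : (s ^+ `|j - m|.+1)^-1 * s = _); last first.
      by rewrite exprS invfM mulrC mulVKf// gt_eqF.
    rewrite -{1}[_^-1]mulr1 -mulrBr normrM ger0_norm; last first.
      by rewrite invr_ge0 exprn_ge0// ltW.
    by rewrite distrC ger0_norm ?subr_ge0// mulrC.
  - rewrite -e exprS invfM -{1}[X in `|X - _|]mul1r -mulrBl normrM.
    rewrite [`|(s ^+ _)^-1|]ger0_norm ?invr_ge0 ?exprn_ge0 ?(ltW s0)//.
    rewrite ler_pM2r ?invr_gt0 ?exprn_gt0// ger0_norm ?subr_ge0 ?invf_le1//.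
    rewrite -(ler_pM2r s0) mulrBl mul1r mulVf ?gt_eqF//.
    by rewrite -subr_ge0 (_ : _ - _ = (s - 1) ^+ 2) ?sqr_ge0//; ring.
pose y := fun j => (w j)%:C%C * x j.
have yE j : nc (y j) = w j * nc (x j) by rewrite /y ncM nc_real ger0_norm// ltW.
suff : nc (y m) <= 2 * (C * d).
  by rewrite yE /w subrr expr0 invr1 mul1r mulrA.
apply: (@halving _ (fun Y => bnd y Y) _ _ X).
- move=> i; rewrite yE; apply: le_trans (hx i).
  by rewrite ler_piMl ?nc_ge0.
- move=> Y hY; have Y0 := bnd_ge0 hY.
  have hop : bnd (op J y) (d + 2 * K * ((s - 1) * Y)).
    move=> i; rewrite /y; apply: le_trans (op_mul_le (e := (s - 1) * Y) hJ _ _) _; rewrite ?lerD2r.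
    + apply: le_trans (ler_wpM2r (nc_ge0 _) (ws _ _ _)) _; first by ilia.
      by rewrite -mulrA -yE ler_wpM2l ?subr_ge0.
    + apply: le_trans (ler_wpM2r (nc_ge0 _) (ws _ _ _)) _; first by ilia.
      by rewrite -mulrA -yE ler_wpM2l ?subr_ge0.
    + by rewrite ger0_norm ?(ltW (w0 _))// /w mulrC ler_pdivrMr ?exprn_gt0.
  move=> i; apply: le_trans (hC _ _ _ hY hop i) _.
  rewrite mulrDr lerD2l.
  (* The hypothesis on [s - 1] makes the commutator term at most [Y / 2], as [halving] requires. *)
  rewrite (_ : C * _ = (4 * C * K * (s - 1)) * (Y / 2)); last by field.
  by rewrite ler_piMl// divr_ge0.
- by move=> Y /(_ m).
Qed.

End Jacobi.
Arguments jac : clear implicits.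

(** * Limit operators and half-line kernels *)

Section Limits.
Context {R : realType}.
Implicit Types (x y : int -> R[i]) (i m k : int) (J : jac R) (U V W : set R[i]).

Definition close (e : R) J J' i := [/\ nc (lo J i - lo J' i) <= e,
  nc (di J i - di J' i) <= e & nc (up J i - up J' i) <= e].

Lemma close_eq e J J' i : 0 <= e -> J i = J' i -> close e J J' i.
Proof. by move=> e0 h; rewrite /close /lo /di /up h !subrr nc0. Qed.

Lemma op_close e J J' x X i : close e J J' i -> bnd x X ->
  nc (op J x i) <= nc (op J' x i) + 3 * e * X.
Proof.
move=> [h1 h2 h3] hx.
rewrite (le_trans (nc_distD _ (op J' x i)))// lerD2l.
rewrite (_ : op J x i - op J' x i = (lo J i - lo J' i) * x (i - 1) +
  (di J i - di J' i) * x i + (up J i - up J' i) * x (i + 1)); last first.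
  by rewrite /op; ring.
rewrite (le_trans (ncD _ _))// (_ : 3 * e * X = (e * X + e * X) + e * X); last by ring.
by rewrite lerD// ?(le_trans (ncD _ _))// ?lerD// ncM ler_pM ?nc_ge0.
Qed.

Definition fs (N : nat) x := forall i, (N < `|i|)%N -> x i = 0.
Definition lbf J (C : R) := forall N x d,
  fs N x -> bnd (op J x) d -> bnd x (C * d).

Lemma fs_bnd N x : fs N x -> exists X, bnd x X.
Proof.
elim: N x => [|N IH] x hx.
  exists (nc (x 0)) => i; have [->//|i0] := eqVneq i 0.
  by rewrite hx ?nc0 ?nc_ge0// absz_gt0.
pose y i := if (`|i| <= N)%N then x i else 0.
have [|X hX] := IH y; first by move=> i; rewrite /y ltnNge => /negbTE ->.
exists (X + nc (x N.+1%:Z) + nc (x (- N.+1%:Z))) => i.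
have X0 := bnd_ge0 hX.
have [h|h] := leqP `|i| N.
  by have := hX i; rewrite /y h => /le_trans; apply; rewrite -addrA lerDl addr_ge0 ?nc_ge0.
have [hi|hi] := ltnP N.+1 `|i|; first by rewrite hx ?nc0 ?addr_ge0 ?nc_ge0.
have [->|->] : i = N.+1%:Z \/ i = - N.+1%:Z by ilia.
  by rewrite addrAC lerDr addr_ge0 ?nc_ge0.
by rewrite lerDr addr_ge0 ?nc_ge0.
Qed.

Lemma lb_lbf J C : lb J C -> lbf J C.
Proof. by move=> h N x d /fs_bnd[X hX]; exact: h hX. Qed.

Definition tent (n : nat) (k : int) : R :=
  1 - (minn (absz k) n.+1)%:R / n.+1%:R.

Lemma tent_itv n k : 0 <= tent n k <= 1.
Proof.
rewrite /tent subr_ge0 ler_pdivrMr// mul1r ler_nat geq_minr /= gerBl.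
by rewrite divr_ge0.
Qed.

Lemma tent_diff n i j : (`|i - j| <= 1)%N -> `|tent n i - tent n j| <= n.+1%:R^-1.
Proof.
have h a b : (a <= b)%N -> (b <= a.+1)%N ->
    `|(1 - a%:R / n.+1%:R) - (1 - b%:R / n.+1%:R)| <= n.+1%:R^-1 :> R.
  move=> ab ba; rewrite (_ : _ - _ = (b - a)%N%:R / n.+1%:R); last first.
    by rewrite natrB//; field; rewrite gt_eqF.
  rewrite ger0_norm ?divr_ge0// ler_pdivrMr// mulVf ?gt_eqF// lern1.
  by ilia.
rewrite /tent => hij; have [le|/ltnW le] := leqP (minn `|i| n.+1) (minn `|j| n.+1).
  by apply: h => //; ilia.
by rewrite distrC; apply: h => //; ilia.
Qed.

Lemma tent0 n i : (n < `|i|)%N -> tent n i = 0.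
Proof.
by move=> h; rewrite /tent (minn_idPr _)// divff ?subrr// gt_eqF.
Qed.

(* Multiplying by a tent of width n localizes a vector at a cost O(1/n). *)
Lemma lb_local K J C : bdd K J -> 0 <= C ->
  (forall m (N : nat) (e : R), 0 < e -> exists2 J', lbf J' C &
     forall i, (`|i - m| <= N)%N -> close e J' J i) -> lb J C.
Proof.
move=> hJ C0 hl x X d hx hd m.
have K0 := bdd_ge0 hJ; have X0 := bnd_ge0 hx; have d0 := bnd_ge0 hd.
suff hN (n : nat) : nc (x m) <= C * (d + (2 * K + 3) * X / n.+1%:R).
  apply/ler_addgt0Pr => e e0.
  pose M := C * ((2 * K + 3) * X).
  have M0 : 0 <= M by rewrite !mulr_ge0// addr_ge0// mulr_ge0.
  apply: le_trans (hN (Num.truncn (M / e))) _.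
  rewrite mulrDr lerD2l mulrA -/M ler_pdivrMr// mulrC -ler_pdivrMr//.
  by rewrite ltW// Num.Theory.truncnS_gt.
(* The vector cut off by the tent lives within distance [n] of [m] and its residual within [n.+1];
   on that window [J'] is close to [J]. *)
have [J' lJ' cJ'] := hl m n.+1 n.+1%:R^-1 (ltac:(by rewrite invr_gt0)).
pose w i : R := tent n (i - m).
have n0 : 0 < n.+1%:R :> R by [].
have w0 i : 0 <= w i <= 1 by exact: tent_itv.
have w1 i j : (`|i - j| <= 1)%N -> `|w i - w j| <= n.+1%:R^-1.
  by move=> h; apply: tent_diff; ilia.
pose y := fun j => (w j)%:C%C * x j.
have yE j : nc (y j) = w j * nc (x j).
  by rewrite /y ncM nc_real ger0_norm//; have /andP[] := w0 j.
have hy : bnd y X.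
  by move=> j; rewrite yE (le_trans _ (hx j))// ler_piMl ?nc_ge0//;
    have /andP[] := w0 j.
have -> : nc (x m) = nc (y m) by rewrite yE /w subrr /tent /= min0n mul0r subr0 mul1r.
have fy : fs (absz m + n)%N y.
  move=> i hi; rewrite /y (_ : w i = 0) ?mul0r//; apply: tent0; ilia.
apply: (lJ' _ y _ fy) => i.
have [hi|hi] := leqP `|i - m| n.+1; last first.
  rewrite /op /y (_ : w i = 0); last by apply: tent0; ilia.
  rewrite (_ : w (i - 1) = 0); last by apply: tent0; ilia.
  rewrite (_ : w (i + 1) = 0); last by apply: tent0; ilia.
  by rewrite rmorph0 !mul0r !mulr0 !addr0 nc0 addr_ge0// divr_ge0// mulr_ge0// addr_ge0// mulr_ge0.
apply: le_trans (op_close (cJ' i hi) hy) _.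
rewrite (_ : d + _ = (d + 2 * K * (n.+1%:R^-1 * X)) + 3 * n.+1%:R^-1 * X); last by ring.
rewrite lerD2r /y; apply: le_trans (op_mul_le (e := n.+1%:R^-1 * X) hJ _ _) _.
- by rewrite ler_pM ?nc_ge0// w1//; ilia.
- by rewrite ler_pM ?nc_ge0// w1//; ilia.
- rewrite lerD2r; have /andP[a0 a1] := w0 i; rewrite ger0_norm//.
  by rewrite (le_trans _ (hd i))// ler_piMl ?nc_ge0.
Qed.

Definition vcv (xs : nat -> int -> R[i]) x := forall i, ucv (xs ^~ i) (x i).
Definition jcv (Js : nat -> jac R) J := forall i,
  [/\ ucv (fun n => lo (Js n) i) (lo J i), ucv (fun n => di (Js n) i) (di J i)
    & ucv (fun n => up (Js n) i) (up J i)].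

Lemma op_ucv Js J xs x i : jcv Js J -> vcv xs x ->
  ucv (fun n => op (Js n) (xs n) i) (op J x i).
Proof.
move=> /(_ i)[h1 h2 h3] hx.
by apply: ucvD; [apply: ucvD|]; apply: ucvM; [|exact: hx|..|exact: hx| |exact: hx].
Qed.

Lemma vec_lim xs X : (forall n, bnd (xs n) X) -> exists2 x, vcv xs x & bnd x X.
Proof.
move=> h.
have /choice[x hx] : forall i, exists l, ucv (xs ^~ i) l.
  by move=> i; apply: (@ucv_bounded _ _ X) => n; exact: h.
exists x => // i; apply: (ucv_le (hx i)).
by apply: (filterS _ filterT) => n _ /=; exact: h.
Qed.

Definition cls U V W J := forall i, [/\ U (lo J i), V (di J i) & W (up J i)].

Lemma cls_lim U V W (Js : nat -> jac R) : compact (U : set (R[i])^o) ->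
  compact (V : set (R[i])^o) -> compact (W : set (R[i])^o) ->
  (forall n, cls U V W (Js n)) -> exists2 J, cls U V W J & jcv Js J.
Proof.
move=> cU cV cW h.
have /choice[J hJ] : forall i, exists t : R[i] * R[i] * R[i],
   [/\ [/\ U t.1.1, V t.1.2 & W t.2], ucv (fun n => lo (Js n) i) t.1.1,
      ucv (fun n => di (Js n) i) t.1.2 & ucv (fun n => up (Js n) i) t.2].
  move=> i.
  have hU n : U (lo (Js n) i) by have [] := h n i.
  have hV n : V (di (Js n) i) by have [] := h n i.
  have hW n : W (up (Js n) i) by have [] := h n i.
  have [a Ua ha] := ucv_compact cU hU.
  have [b Vb hb] := ucv_compact cV hV.
  have [c Wc hc] := ucv_compact cW hW.
  by exists (a, b, c).
by exists J => i; have [] := hJ i.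
Qed.

Lemma cls_bound U V W : compact (U : set (R[i])^o) ->
  compact (V : set (R[i])^o) -> compact (W : set (R[i])^o) ->
  exists2 K : R, 0 <= K & forall J, cls U V W J -> bdd K J.
Proof.
move=> /compact_bound[a ha] /compact_bound[b hb] /compact_bound[c hc].
exists (`|a| + `|b| + `|c|); first by rewrite !addr_ge0.
have ? := ler_norm a; have ? := ler_norm b; have ? := ler_norm c.
have ? := normr_ge0 a; have ? := normr_ge0 b; have ? := normr_ge0 c.
move=> J hJ i; have [/ha h1 /hb h2 /hc h3] := hJ i; split; lra.
Qed.

Lemma cls_tr U V W J : cls U V W J -> cls W V U (tr J).
Proof.
move=> h i; rewrite /tr /lo /di /up /=.
by have [_ _ ?] := h (i - 1); have [_ ? _] := h i; have [? _ _] := h (i + 1).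
Qed.

Lemma cls_flip U V W J : cls U V W J -> cls W V U (flip J).
Proof. by move=> h i; have [] := h (- i). Qed.

Lemma cls_sh U V W k J : cls U V W J -> cls U V W (sh k J).
Proof. by move=> h i; have [] := h (i + k). Qed.

End Limits.

Definition NN : pred int := fun i => 0 <= i.

Section HalfLine.
Context {R : realType}.
Implicit Types (x y : int -> R[i]) (i m k : int) (J : jac R).

(* Uniform lower bounds on the class: for all operators on the whole line, on the
   half-line, and on finite intervals. *)
Definition line_lb (U V W : set R[i]) C := forall J, cls U V W J -> lb J C.
Definition halfline_lb (U V W : set R[i]) C := forall J, cls U V W J -> lb (cut NN J) C.
Definition interval_lb (U V W : set R[i]) C := forall J (n : nat), cls U V W J ->
  lb (cut (fun i => 0 <= i < n%:Z) J) C.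
(** Bounded kernel vectors are enough for every [p]: under [line_lb] they decay exponentially (see
    [kernel_decay]) and so lie in every l^p. *)
Definition has_kernel J := exists x X, [/\ bnd x X, supp NN x, exists i, x i != 0 &
  forall i, 0 <= i -> op J x i = 0].
Definition halfline_ker (U V W : set R[i]) := exists2 J, cls U V W J & has_kernel J.

Lemma line_lb_flip U V W C : line_lb U V W C -> line_lb W V U C.
Proof. by move=> h J /cls_flip/h/lb_flip; rewrite flipK. Qed.

Context (U V W : set R[i]) (K C : R).
Context (hK : forall J, cls U V W J -> bdd K J).
Context (cU : compact (U : set (R[i])^o)) (cV : compact (V : set (R[i])^o)).
Context (cW : compact (W : set (R[i])^o)) (C0 : 0 <= C) (hI : line_lb U V W C).

(* Extended by zero to the left, x has its only further residual at row -1. *)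
Lemma corner J x X d : cls U V W J -> bnd x X -> supp NN x -> 0 <= d ->
  (forall i, 0 <= i -> nc (op J x i) <= d) ->
  bnd x (C * Num.max d (K * nc (x 0))).
Proof.
move=> cJ hx sx d0 hd; apply: (hI cJ hx) => i.
have [hi|hi] := leP 0 i; first by rewrite le_max hd.
have [_ _ hu] := hK cJ i.
rewrite /op (sx i) ?(sx (i - 1)) /NN -?ltNge//; last by ilia.
rewrite !mulr0 !add0r le_max ncM.
have [->|hi1] := eqVneq (i + 1) 0; first by rewrite ler_wpM2r ?nc_ge0// orbT.
by rewrite (sx (i + 1)) ?nc0 ?mulr0 ?d0// /NN; ilia.
Qed.

(** With no residual on the half-line, the single residual at row -1 is governed by [x 0]. A kernel
    vector is thus determined by its first entry, and the kernel is at most one-dimensional. *)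
Lemma ker0 J x X : cls U V W J -> bnd x X -> supp NN x ->
  (forall i, 0 <= i -> op J x i = 0) -> bnd x (C * (K * nc (x 0))).
Proof.
move=> cJ hx sx hd; have K0 := bdd_ge0 (hK cJ).
have := corner cJ hx sx (lexx 0); rewrite max_r ?mulr_ge0 ?nc_ge0//; apply.
by move=> i /hd ->; rewrite nc0.
Qed.

Lemma ker0_neq0 J x X : cls U V W J -> bnd x X -> supp NN x ->
  (exists i, x i != 0) -> (forall i, 0 <= i -> op J x i = 0) -> x 0 != 0.
Proof.
move=> cJ hx sx [i xi] hd; apply/eqP => x0.
have := ker0 cJ hx sx hd i; rewrite x0 nc0 !mulr0 => /nc_le0 /eqP.
by rewrite (negbTE xi).
Qed.

(** The bounds on the [xs n] need not be uniform; [corner] replaces them by one that is, because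
    [xs n 0 = 1]. The same normalization keeps the limit from vanishing. *)
Lemma ker_lim Js J xs : (forall n, cls U V W (Js n)) -> jcv Js J ->
  (forall n, exists X, bnd (xs n) X) -> (forall n, supp NN (xs n)) ->
  (forall n, xs n 0 = 1) ->
  (forall (n : nat) i, 0 <= i -> nc (op (Js n) (xs n) i) <= n.+1%:R^-1) ->
  has_kernel J.
Proof.
move=> cJs hJ bx sx x0 hop.
have hb n : bnd (xs n) (C * Num.max 1 K).
  have [X hX] := bx n; have h1 : 0 <= n.+1%:R^-1 :> R by rewrite invr_ge0.
  move=> i; apply: le_trans (corner (cJs n) hX (sx n) h1 (hop n) i) _.
  rewrite x0 nc1 mulr1 ler_wpM2l// ge_max !le_max invf_le1// ler1n /=.
  by rewrite lexx orbT.
have [x hx bx'] := vec_lim hb.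
exists x, (C * Num.max 1 K); split => //.
- move=> i hi; apply: (ucv_unique (hx i)).
  by rewrite (_ : xs ^~ i = fun=> 0) ?ucv_cst//; [exact: ucv_cst|apply/funext => n; exact: sx].
- exists 0; rewrite (ucv_unique (hx 0) (_ : ucv _ 1)) ?oner_neq0//.
  by rewrite (_ : xs ^~ 0 = fun=> 1) ?ucv_cst//; [exact: ucv_cst|apply/funext => n].
- move=> i hi; apply/nc_le0/ler_addgt0Pr => e e0; rewrite add0r.
  apply: (ucv_le (op_ucv i hJ hx)).
  apply: filterS (uF_ge (Num.truncn e^-1)) => n /= hn.
  apply: le_trans (hop n i hi) _.
  rewrite -[e]invrK lef_pV2 ?posrE ?invr_gt0// ltW//.
  apply: lt_le_trans (Num.Theory.truncnS_gt _) _.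
  by rewrite ler_nat ltnS.
Qed.

(** If [e * nc (y 0)] is at most the residual [d], then [corner] already bounds [y] by a multiple of
    [d]. A vector violating the bound therefore has a residual small relative to [y 0], and dividing
    by [y 0] gives the almost kernel vector. *)
Lemma not_halfline_lb : ~ (exists C', halfline_lb U V W C') -> forall e : R, 0 < e ->
  exists J x, [/\ cls U V W J, exists X, bnd x X, supp NN x, x 0 = 1 &
    forall i, 0 <= i -> nc (op J x i) <= e].
Proof.
move=> hn e e0; apply: contrapT => hC.
have K0 : 0 <= `|K| by [].
pose M := Num.max (C + 1) (C * `|K| / e); apply: hn; exists M => J cJ x X d hx hd i.
have d0 := bnd_ge0 hd.
have M1 : 1 <= M by rewrite le_max ler_wpDl.
have [hi|hi] := leP 0 i; last first.
  have := hd i; rewrite op_cut /NN (negbTE (_ : ~~ (0 <= i))) -?ltNge// => h.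
  by rewrite (le_trans h)// ler_peMl.
pose y := mask NN x.
have -> : x i = y i by rewrite /y /mask /NN hi.
have hy : bnd y X by exact: mask_bnd.
have hyd j : 0 <= j -> nc (op J y j) <= d.
  by move=> hj; have := hd j; rewrite op_cut /NN hj.
have := corner cJ hy (supp_mask _) d0 hyd i => h.
have [le|lt] := leP (K * nc (y 0)) d.
  rewrite (le_trans h)// max_l// ler_wpM2r// le_max lerDl.
  by rewrite ler01.
apply: (le_trans h); rewrite max_r ?(ltW lt)//.
have y0 : 0 < nc (y 0).
  rewrite lt_def nc_ge0 andbT; apply: contraTneq lt => ->.
  by rewrite mulr0 -leNgt.
have [le|lt'] := leP (e * nc (y 0)) d.
  apply: (@le_trans _ _ (C * `|K| / e * (e * nc (y 0)))).
    rewrite [leRHS](_ : _ = C * (`|K| * nc (y 0))); last first.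
      by field; rewrite gt_eqF.
    by rewrite ler_wpM2l// ler_wpM2r ?nc_ge0// ler_norm.
  rewrite ler_pM ?mulr_ge0 ?nc_ge0 ?invr_ge0 ?(ltW e0)//.
  by rewrite le_max lexx orbT.
exfalso; apply: hC; exists J, (fun j => (y 0)^-1 * y j); split => //.
- exists (nc (y 0)^-1 * X) => j; rewrite ncM ler_wpM2l ?nc_ge0//; exact: hy.
- by move=> j hj; rewrite (_ : y j = 0) ?mulr0//; exact: supp_mask.
- by rewrite mulVf// -nc_gt0.
- move=> j hj; rewrite opZ ncM ncV ler_pdivrMl// (le_trans (hyd j hj))//.
  by rewrite mulrC ltW.
Qed.

Lemma halfline_lb_or_halfline_ker : (exists C', halfline_lb U V W C') \/ halfline_ker U V W.
Proof.
have [|/not_halfline_lb h] := pselect (exists C', halfline_lb U V W C'); [by left|right].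
have /choice[Jx hJx] : forall n : nat, exists p : jac R * (int -> R[i]),
   [/\ cls U V W p.1, exists X, bnd p.2 X, supp NN p.2, p.2 0 = 1 &
    forall i, 0 <= i -> nc (op p.1 p.2 i) <= n.+1%:R^-1].
  move=> n; have [|J [x hx]] := h n.+1%:R^-1; first by rewrite invr_gt0.
  by exists (J, x).
have hc n : cls U V W (Jx n).1 by have [] := hJx n.
have [J cJ hJ] := cls_lim cU cV cW hc.
exists J => //; apply: (@ker_lim (fun n => (Jx n).1) J (fun n => (Jx n).2)) => //.
all: by move=> n; have [] := hJx n.
Qed.

End HalfLine.

Section Coburn.
Context {R : realType}.
Implicit Types (x y : int -> R[i]) (i m k : int) (J : jac R).

(* Two half-line kernel vectors, one reflected, are glued on both sides of a
   spare row, which is solved by choosing the ratio of the two vectors. *)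
Lemma coburn (U V W : set R[i]) K C :
  (forall J, cls U V W J -> bdd K J) -> (forall J, cls W V U J -> bdd K J) ->
  line_lb U V W C -> 0 <= C -> halfline_ker U V W -> halfline_ker W V U -> False.
Proof.
move=> hK hK' hI C0 [J1 c1 [x1 [X1 [b1 s1 n1 k1]]]] [J2 c2 [x2 [X2 [b2 s2 n2 k2]]]].
have x10 := ker0_neq0 hK hI c1 b1 s1 n1 k1.
have x20 := ker0_neq0 hK' (line_lb_flip hI) c2 b2 s2 n2 k2.
pose u := lo J1 0; pose w := up J1 0.
have [a [b [hab hr]]] : exists a b : R[i],
    ((a != 0) || (b != 0)) /\ u * (a * x2 0) + w * (b * x1 0) = 0.
  have [h|h] := eqVneq (u * x2 0) 0.
    by exists 1, 0; rewrite oner_neq0 mul1r h !(mul0r, mulr0) addr0.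
  exists (w * x1 0), (- (u * x2 0)); rewrite oppr_eq0 h orbT; split => //.
  by ring.
(* Row 0 is the spare row. As [z] vanishes at 0, the residual there couples just the first entries
   of the two kernel vectors, which is the equation [hr]. *)
pose J : jac R := fun i => if 0 < i then J1 (i - 1) else
  if i < 0 then flip J2 (i + 1) else J1 0.
pose z i := if 0 < i then b * x1 (i - 1) else if i < 0 then a * x2 (- i - 1) else 0.
have cJ : cls U V W J.
  move=> i; rewrite /lo /di /up /J; case: ifP => _; first exact: c1.
  by case: ifP => _; [exact: (cls_flip c2)|exact: c1].
have hz : bnd z (nc b * X1 + nc a * X2).
  have A1 := bnd_ge0 b1; have A2 := bnd_ge0 b2.
  move=> i; rewrite /z; case: ifP => _.
    by rewrite ncM ler_wpDr ?mulr_ge0 ?nc_ge0// ler_wpM2l ?nc_ge0.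
  case: ifP => _; last by rewrite nc0 addr_ge0// mulr_ge0 ?nc_ge0.
  by rewrite ncM ler_wpDl ?mulr_ge0 ?nc_ge0// ler_wpM2l ?nc_ge0.
have hop : bnd (op J z) 0.
  move=> i; suff -> : op J z i = 0 by rewrite nc0.
  have [hi|hi|->] := ltrgtP i 0.
  - have hJ : J i = flip J2 (i + 1) by rewrite /J hi ltNge (ltW hi).
    rewrite -[RHS](mulr0 a) -(k2 (- (i + 1))); last by ilia.
    rewrite -(op_flip J2) -opZ /op /lo /di /up hJ /z !addrK.
    rewrite (_ : 0 < i = false); last by ilia.
    rewrite (_ : 0 < i - 1 = false); last by ilia.
    rewrite (_ : 0 < i + 1 = false); last by ilia.
    rewrite hi (_ : i - 1 < 0); last by ilia.
    rewrite (_ : - (i - 1) - 1 = - i); last by ilia.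
    rewrite (_ : - (i + 1) = - i - 1); last by ilia.
    rewrite (_ : - (i + 1 + 1) = - (i + 1) - 1); last by ilia.
    have [->|ne] := eqVneq i (-1).
      by rewrite (s2 (- (-1 + 1) - 1))// !mulr0.
    rewrite (_ : i + 1 < 0); last by ilia.
    by rewrite (_ : - i - 1 - 1 = - (i + 1) - 1)//; ilia.
  - have hJ : J i = J1 (i - 1) by rewrite /J hi.
    rewrite -[RHS](mulr0 b) -(k1 (i - 1)); last by ilia.
    rewrite -opZ /op /lo /di /up hJ /z subrK addrK hi.
    rewrite (_ : 0 < i + 1); last by ilia.
    have [->|ne] := eqVneq i 1; first by rewrite (s1 (1 - 1 - 1))// !mulr0.
    by rewrite (_ : 0 < i - 1); last by ilia.
  - by rewrite /op /lo /di /up /J /z /= mulr0 addr0.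
have z0 i : z i = 0.
  by have := hI J cJ z _ _ hz hop i; rewrite mulr0 => /nc_le0.
have := hab; rewrite -[a != 0]orbF; case/orP.
- rewrite orbF => a0; have := z0 (-1); rewrite /z /= => /eqP.
  by rewrite mulf_eq0 (negbTE a0) (negbTE x20).
- move=> b0; have := z0 1; rewrite /z /= => /eqP.
  by rewrite mulf_eq0 (negbTE b0) (negbTE x10).
Qed.

End Coburn.

(** * Right inverses *)

Section LeastNorm.
Context {R : realType}.

Lemma sqr_ncE (x : R[i]) : x * conjc x = ((nc x) ^+ 2)%:C%C.
Proof. by rewrite -sqr_normc nc_norm -rmorphXn. Qed.

Lemma ncJ (x : R[i]) : nc (conjc x) = nc x.
Proof. by case: x => a b; rewrite /conjc /ComplexField.Normc.normc sqrrN. Qed.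

(* The least-norm solution x = M^* (M M^* )^-1 y of M x = y. *)
Lemma least_norm m n (M : 'M[R[i]]_(m, n)) (c : R) : 0 < c ->
  (forall g : 'rV[R[i]]_m, \sum_i nc (g 0 i) ^+ 2 <= c * \sum_j nc ((g *m M) 0 j) ^+ 2) ->
  forall y : 'cV[R[i]]_m, exists2 x : 'cV[R[i]]_n, M *m x = y &
    \sum_j nc (x j 0) ^+ 2 <= c * \sum_i nc (y i 0) ^+ 2.
Proof.
move=> c0 hM y.
pose cj k l (A : 'M[R[i]]_(k, l)) := (map_mx conjc A)^T.
have cjM k l p (A : 'M[R[i]]_(k, l)) (B : 'M[R[i]]_(l, p)) : cj _ _ (A *m B) = cj _ _ B *m cj _ _ A.
  by rewrite /cj map_mxM trmx_mul.
have nn k (v : 'rV[R[i]]_k) :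
    (v *m cj _ _ v) 0 0 = (\sum_j nc (v 0 j) ^+ 2)%:C%C.
  rewrite mxE rmorph_sum; apply: eq_bigr => j _.
  by rewrite !mxE sqr_ncE.
have sum0 k (v : 'rV[R[i]]_k) : \sum_j nc (v 0 j) ^+ 2 <= 0 -> v = 0.
  move=> h; apply/rowP => j; rewrite mxE.
  have hj : nc (v 0 j) ^+ 2 <= 0.
    apply: le_trans h; rewrite (bigD1 j)//= lerDl sumr_ge0// => l _.
    by rewrite sqr_ge0.
  by apply/eqP; rewrite -nc_eq0 -sqrf_eq0 eq_le hj sqr_ge0.
pose P := M *m cj _ _ M.
(* From [g P = 0] follows |g M|^2 = g P g^* = 0, and the lower bound [hM] then forces [g = 0]. *)
have Pu : P \in unitmx.
  rewrite -row_free_unit; apply: inj_row_free => g gP.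
  apply: sum0; apply: le_trans (hM g) _.
  have : ((g *m M) *m cj _ _ (g *m M)) 0 0 = 0.
    by rewrite cjM mulmxA -(mulmxA g) -/P gP mul0mx mxE.
  by rewrite nn => /(congr1 (@complex.Re _)) /= ->; rewrite mulr0.
pose h := invmx P *m y; pose x := cj _ _ M *m h.
exists x; first by rewrite /x /h mulmxA mulKVmx.
have Mx : M *m x = y by rewrite /x /h mulmxA mulKVmx.
pose g := cj _ _ h.
have gM : g *m M = cj _ _ x.
  rewrite /x cjM /g; congr (_ *m _); apply/matrixP => i j.
  by rewrite !mxE conjcK.
have nx j : nc ((cj _ _ x) 0 j) = nc (x j 0).
  by rewrite !mxE ncJ.
have nh j : nc (g 0 j) = nc (h j 0).
  by rewrite !mxE ncJ.
set S := \sum_j _; set T := \sum_i _.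
have hS : \sum_i nc (h i 0) ^+ 2 <= c * S.
  have := hM g; rewrite gM (eq_bigr _ (fun j _ => congr1 (fun t => t ^+ 2) (nx j))).
  by rewrite (eq_bigr _ (fun j _ => congr1 (fun t => t ^+ 2) (nh j))).
have : S <= \sum_i nc (h i 0) * nc (y i 0).
  have -> : S = nc ((g *m y) 0 0).
    rewrite -Mx mulmxA gM.
    have ccx : cj _ _ (cj _ _ x) = x by apply/matrixP => i j; rewrite !mxE conjcK.
    have := nn _ (cj _ _ x); rewrite ccx => ->.
    rewrite nc_real ger0_norm ?sumr_ge0//; last by move=> j _; rewrite sqr_ge0.
    by apply: eq_bigr => j _; rewrite nx.
  rewrite mxE; apply: le_trans (nc_sum _ _ _) _.
  by apply: ler_sum => i _; rewrite ncM nh.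
(* Weighted so that by [hS] the first half sums to at most [S / 2] and can be absorbed into the
   left-hand side. *)
have amgm i : nc (h i 0) * nc (y i 0) <=
    (c^-1 * nc (h i 0) ^+ 2 + c * nc (y i 0) ^+ 2) / 2.
  rewrite -subr_ge0.
  rewrite (_ : _ - _ = (2 * c)^-1 * (nc (h i 0) - c * nc (y i 0)) ^+ 2); last first.
    by field; rewrite gt_eqF.
  by rewrite mulr_ge0 ?sqr_ge0// invr_ge0 mulr_ge0// ltW.
move=> hST; have : S <= (c^-1 * (\sum_i nc (h i 0) ^+ 2) + c * T) / 2.
  apply: le_trans hST _; apply: le_trans (ler_sum _ (fun i _ => amgm i)) _.
  by rewrite -mulr_suml big_split /= -!mulr_sumr.
move=> h2; have : c^-1 * (\sum_i nc (h i 0) ^+ 2) <= S.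
  by rewrite mulrC ler_pdivrMr// mulrC.
by lra.
Qed.

End LeastNorm.

Section GeometricSums.
Context {R : realType}.

Lemma geo_nat (q : R) n : 0 <= q < 1 -> \sum_(0 <= k < n) q ^+ k <= (1 - q)^-1.
Proof.
move=> /andP[q0 q1]; have h : 0 < 1 - q by rewrite subr_gt0.
rewrite -[leRHS]mul1r ler_pdivlMr// mulrC.
have -> : (1 - q) * \sum_(0 <= k < n) q ^+ k = 1 - q ^+ n.
  elim: n => [|n IH]; first by rewrite big_nil mulr0 expr0 subrr.
  by rewrite big_nat_recr//= mulrDr IH exprS; ring.
by rewrite gerBl exprn_ge0.
Qed.

Lemma sum_uniq_le (T : eqType) (s t : seq T) (f : T -> R) :
  uniq s -> {subset s <= t} -> (forall x, 0 <= f x) ->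
  \sum_(x <- s) f x <= \sum_(x <- t) f x.
Proof.
move=> us st f0; elim: t s us st => [|a t IH] s us st.
  case: s us st => [|b s] _ h; first by rewrite !big_nil.
  by have := h b (mem_head _ _).
have hr : \sum_(x <- rem a s) f x <= \sum_(x <- t) f x.
  apply: IH; first exact: rem_uniq.
  move=> x; rewrite mem_rem_uniq// => /andP[/= xa xs].
  by have := st _ xs; rewrite inE (negbTE xa).
rewrite big_cons; have [ha|ha] := boolP (a \in s).
  by rewrite (perm_big _ (perm_to_rem ha)) big_cons lerD2l.
by rewrite rem_id// in hr; rewrite (le_trans hr)// lerDr.
Qed.

Lemma geo_uniq (q : R) (s : seq nat) : 0 <= q < 1 -> uniq s ->
  \sum_(k <- s) q ^+ k <= (1 - q)^-1.
Proof.
move=> hq us; have [q0 _] := andP hq.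
apply: le_trans (geo_nat (\max_(k <- s) k).+1 hq).
apply: sum_uniq_le => // [x xs|x]; last by rewrite exprn_ge0.
by rewrite mem_index_iota /= ltnS (leq_bigmax_seq x).
Qed.

Lemma geo_int (q : R) (s : seq int) m : 0 <= q < 1 -> uniq s ->
  \sum_(i <- s) q ^+ `|i - m|%N <= 2 * (1 - q)^-1.
Proof.
move=> hq us; rewrite (bigID (fun i => m <= i))/= mulrDl !mul1r.
have h (P : pred int) :
    (forall i j, P i -> P j -> `|i - m|%N = `|j - m|%N -> i = j) ->
    \sum_(i <- s | P i) q ^+ `|i - m|%N <= (1 - q)^-1.
  move=> Pinj; rewrite -big_filter -(big_map (fun i => `|i - m|%N) predT (fun k => q ^+ k)).
  apply: geo_uniq => //; rewrite map_inj_in_uniq ?filter_uniq//.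
  by move=> i j; rewrite !mem_filter => /andP[Pi _] /andP[Pj _]; apply: Pinj.
by rewrite lerD// h// => i j /= h1 h2 h3; lia.
Qed.

End GeometricSums.

Section Solve.
Context {R : realType}.
Implicit Types (x y z : int -> R[i]) (i j m k : int) (J : jac R).

Lemma op_trE J x i : op (tr J) x i =
  up J (i - 1) * x (i - 1) + di J i * x i + lo J (i + 1) * x (i + 1).
Proof. by []. Qed.

(** For [n = 2 * N + 1] this enumerates the window of radius [N] around 0. *)
Definition pos (N : nat) n (a : 'I_n) : int := a%:Z - N%:Z.

Lemma pos_inj N n : injective (@pos N n).
Proof. by move=> a b h; apply/val_inj; move: h; rewrite /pos /=; lia. Qed.

Lemma pos_le N (a : 'I_(2 * N).+1) : (`|pos N a| <= N)%N.
Proof. by have := ltn_ord a; rewrite /pos; lia. Qed.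

Lemma ex_pos N i : (`|i| <= N)%N -> exists a : 'I_(2 * N).+1, pos N a = i.
Proof.
move=> hi; have h : (absz (i + N%:Z)%R < (2 * N).+1)%N by lia.
by exists (Ordinal h); rewrite /pos /=; lia.
Qed.

Lemma distSm i : (absz (i - (i - 1))%R <= 1)%N. Proof. by lia. Qed.

Lemma distSp i : (absz (i - (i + 1))%R <= 1)%N. Proof. by lia. Qed.

Lemma dist_tri i j k : (`|i - k| <= `|j - k| + `|i - j|)%N.
Proof. by lia. Qed.

Lemma near_gt i j N : (N.+1 < `|i|)%N -> (`|i - j| <= 1)%N -> (N < `|j|)%N.
Proof. by lia. Qed.

Lemma eq_pred1 i j : (j == i - 1) = (i == j + 1).
Proof. by apply/eqP/eqP; lia. Qed.

Lemma eq_succ1 i j : (j == i + 1) = (i == j - 1).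
Proof. by apply/eqP/eqP; lia. Qed.

Lemma sum_delta n N k (f : int -> R[i]) :
  \sum_(a < n) (pos N a == k)%:R * f (pos N a) =
  if (- N%:Z <= k) && (k < n%:Z - N%:Z) then f k else 0.
Proof.
case: ifPn => [/andP[h1 h2]|h].
  have hk : (absz (k + N%:Z)%R < n)%N by lia.
  have e : pos N (Ordinal hk) = k by rewrite /pos /=; lia.
  rewrite (bigD1 (Ordinal hk))//= e eqxx mul1r big1 ?addr0// => a ha.
  case: eqP => [e'|]; last by rewrite mul0r.
  case/negP: ha; apply/eqP/val_inj => /=; move: e'; rewrite /pos; lia.
rewrite big1// => a _; case: eqP => [e|]; last by rewrite mul0r.
by case/negP: h; have := ltn_ord a; move: e; rewrite /pos; lia.
Qed.

Lemma geo_pos (q : R) n N k : 0 <= q < 1 ->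
  \sum_(a < n) q ^+ `|pos N a - k|%N <= 2 * (1 - q)^-1.
Proof.
move=> hq; rewrite -(big_map (@pos N n) predT (fun i => q ^+ `|i - k|%N)).
apply: geo_int => //; rewrite map_inj_uniq ?index_enum_uniq//.
by move=> a b h; apply/val_inj; move: h; rewrite /pos /=; lia.
Qed.

(* Off-diagonal decay of an approximate right inverse: solve on a window after
   conjugating by the weight s ^ |i - r|. *)
Lemma solve_window K C J s (r : int) (N : nat) : 0 < C -> bdd K J -> lb (tr J) C ->
  1 < s -> 4 * C * K * (s ^+ 2 - 1) <= 1 ->
  let c := (2 * C) ^+ 2 * (2 * (1 - (s ^+ 2)^-1)^-1) in
  exists2 z, (forall j, nc (z j) <= (c + 1) * (s ^+ `|j - r|)^-1) &
    forall i, (`|i| <= N)%N -> op J z i = (i == r)%:R.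
Proof.
move=> C0 hJ hC s1 hs c.
have s0 : 0 < s by exact: lt_trans ltr01 s1.
have ss1 : 1 < s ^+ 2 by rewrite exprn_egt1.
have ss0 : 0 < s ^+ 2 by exact: lt_trans ltr01 ss1.
have hq : 0 <= (s ^+ 2)^-1 < 1 by rewrite invr_ge0 (ltW ss0) invf_lt1.
have c0 : 0 < c.
  by rewrite /c !mulr_gt0 ?exprn_gt0 ?mulr_gt0// invr_gt0 subr_gt0; case/andP: hq.
pose w i : R := s ^+ `|i - r|%N.
have w0 i : 0 < w i by rewrite exprn_gt0.
have wN i : (w i)%:C%C != 0 :> R[i].
  by rewrite (_ : 0 = 0%:C%C)// eq_complex /= eqxx andbT gt_eqF.
pose m := (2 * N).+1; pose n := (2 * N.+1).+1.
pose e i j : R[i] := lo J i * (j == i - 1)%:R + di J i * (j == i)%:R +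
   up J i * (j == i + 1)%:R.
(* The columns reach one step further than the rows on either side, so that the rows in the window
   are complete rows of [J]. *)
pose M : 'M[R[i]]_(m, n) := \matrix_(a, b)
  ((w (pos N a))%:C%C * e (pos N a) (pos N.+1 b) / (w (pos N.+1 b))%:C%C).
(* Up to weights, [g *m M] is the transposed operator applied to the weighted [g] extended by zero;
   this brings the bound for [tr J] into play. *)
have gE (g : 'rV[R[i]]_m) : let G i := \sum_a (pos N a == i)%:R * ((w (pos N a))%:C%C * g 0 a) in
    forall b, op (tr J) G (pos N.+1 b) = (w (pos N.+1 b))%:C%C * (g *m M) 0 b.
  move=> G b; set j := pos _ b; rewrite mxE mulr_sumr.
  rewrite op_trE /G !mulr_sumr -!big_split /=.
  apply: eq_bigr => a _; rewrite mxE -/j; set i := pos N a.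
  rewrite [RHS](_ : _ = g 0 a * (w i)%:C%C * e i j); last by field; exact: wN.
  rewrite /e.
  rewrite (eq_pred1 i j) (eq_succ1 i j).
  have -> : (j == i) = (i == j) by rewrite eq_sym.
  have D (f : int -> R[i]) k : f i * (i == k)%:R = f k * (i == k)%:R.
    by case: eqP => [->|_]; rewrite ?mulr0.
  by rewrite (D (lo J)) (D (di J)) (D (up J)); ring.
have hM (g : 'rV[R[i]]_m) :
    \sum_a nc (g 0 a) ^+ 2 <= c * \sum_b nc ((g *m M) 0 b) ^+ 2.
  pose G i := \sum_a (pos N a == i)%:R * ((w (pos N a))%:C%C * g 0 a).
  have GE a : G (pos N a) = (w (pos N a))%:C%C * g 0 a.
    rewrite /G (bigD1 a)//= eqxx mul1r big1 ?addr0// => b ba.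
    case: eqP => [h|]; last by rewrite mul0r.
    by case/negP: ba; apply/eqP/(@pos_inj N).
  have G0 i : (N < `|i|)%N -> G i = 0.
    move=> hi; rewrite /G big1// => a _; case: eqP => [h|]; last by rewrite mul0r.
    by move: hi; rewrite -h ltnNge pos_le.
  have hG : bnd G (\sum_a nc ((w (pos N a))%:C%C * g 0 a)).
    move=> i; apply: le_trans (nc_sum _ _ _) _; apply: ler_sum => a _.
    by rewrite ncM; case: (_ == _); rewrite ?nc1 ?nc0 ?mul1r ?mul0r ?nc_ge0.
  pose h b := nc ((g *m M) 0 b).
  (* Localization at the rate [s ^+ 2] beats the weight [w], which grows at the rate [s]. After
     squaring, a summable factor [(s ^+ 2)^-1] per step is left over. *)
  have hg a : nc (g 0 a) ^+ 2 <= (2 * C) ^+ 2 *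
      \sum_b (s ^+ 2)^-1 ^+ `|pos N.+1 b - pos N a|%N * h b ^+ 2.
    set q := pos N a.
    (* An l^2 norm dominating each of its terms: it serves as the sup bound in [localized] and turns
       the result into an l^2 estimate. *)
    pose D := Num.sqrt (\sum_b (w (pos N.+1 b) * h b / (s ^+ 2) ^+ `|pos N.+1 b - q|%N) ^+ 2).
    have hD b : w (pos N.+1 b) * h b <= D * (s ^+ 2) ^+ `|pos N.+1 b - q|%N.
      rewrite -ler_pdivrMr ?exprn_gt0//; apply: le_trans (ler_norm _) _.
      rewrite -sqrtr_sqr ler_sqrt ?sumr_ge0//; last by move=> *; rewrite sqr_ge0.
      by rewrite [leRHS](bigD1 b)//= lerDl sumr_ge0// => *; rewrite sqr_ge0.
    have hGq : nc (G q) <= 2 * C * D.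
      apply: (lb_localized (tr_bdd hJ) hC (ltW C0) (ltW ss1) hs hG) => i.
      have [hi|hi] := leqP `|i| N.+1; last first.
        rewrite op_trE !G0 ?(near_gt hi) ?distSm ?distSp ?subrr ?mulr0 ?addr0 ?nc0//.
        by rewrite mulr_ge0 ?sqrtr_ge0 ?exprn_ge0 ?(ltW s0).
      have [b <-] := ex_pos hi.
      by rewrite gE ncM nc_real ger0_norm ?(ltW (w0 _)).
    have : (w q * nc (g 0 a)) ^+ 2 <= (2 * C * D) ^+ 2.
      rewrite ler_sqr ?nnegrE ?mulr_ge0 ?nc_ge0 ?sqrtr_ge0 ?(ltW (w0 _)) ?(ltW C0)//.
      by move: hGq; rewrite GE ncM nc_real ger0_norm ?(ltW (w0 _)).
    rewrite exprMn -ler_pdivlMl ?exprn_gt0// => /le_trans; apply.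
    rewrite exprMn sqr_sqrtr ?sumr_ge0//; last by move=> *; rewrite sqr_ge0.
    rewrite mulrCA ler_wpM2l ?sqr_ge0// mulr_sumr ler_sum// => b _.
    set j := pos N.+1 b; rewrite expr_div_n exprMn.
    set E := (s ^+ 2) ^+ `|j - q|%N.
    have E0 : 0 < E by rewrite exprn_gt0.
    have wq0 : 0 < w q ^+ 2 by rewrite exprn_gt0.
    have hw : w j ^+ 2 <= w q ^+ 2 * E.
      rewrite /E -exprM mulnC exprM -exprMn ler_sqr ?nnegrE ?mulr_ge0 ?exprn_ge0 ?(ltW s0)//.
      by rewrite /w -exprD ler_weXn2l ?(ltW s1)// dist_tri.
    rewrite exprVn (_ : _ * _ = (w j ^+ 2 / (w q ^+ 2 * E)) * (E^-1 * h b ^+ 2)); last first.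
      by field; rewrite !gt_eqF.
    apply: ler_piMl; first by rewrite mulr_ge0 ?invr_ge0 ?sqr_ge0 ?(ltW E0).
    by rewrite ler_pdivrMr ?mulr_gt0// mul1r.
  apply: le_trans (ler_sum _ (fun a _ => hg a)) _.
  rewrite -mulr_sumr exchange_big /= /c -mulrA ler_wpM2l ?sqr_ge0// mulr_sumr.
  apply: ler_sum => b _; rewrite -mulr_suml ler_wpM2r ?sqr_ge0//.
  under eq_bigr do rewrite distnC.
  exact: geo_pos.
(* If [r] lies outside the window, the right-hand side vanishes on the window and [z = 0] will
   do. *)
have [hr|hr] := leqP `|r| N; last first.
  exists (fun=> 0) => [j|i hi].
    by rewrite nc0 mulr_ge0 ?addr_ge0 ?invr_ge0 ?exprn_ge0 ?(ltW s0) ?(ltW c0).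
  rewrite /op !mulr0 !addr0; case: eqP => // e'.
  by move: hr; rewrite -e' ltnNge hi.
have [a0 er] := ex_pos hr.
have [x Mx hx] := least_norm c0 hM (delta_mx a0 0).
have hx1 b : nc (x b 0) <= c + 1.
  have : nc (x b 0) ^+ 2 <= c.
    apply: (le_trans _ (le_trans hx _)).
      by rewrite (bigD1 b)//= lerDl sumr_ge0// => *; rewrite sqr_ge0.
    rewrite (bigD1 a0)//= big1 => [|a ne].
      by rewrite mxE !eqxx nc1 expr1n addr0 mulr1.
    by rewrite mxE (negbTE ne) nc0 expr0n.
  have [//|h1 h2] := leP (nc (x b 0)) (c + 1).
  have : (c + 1) ^+ 2 <= c.
    by apply: le_trans h2; rewrite ler_sqr ?nnegrE ?nc_ge0 ?addr_ge0 ?(ltW c0)// ltW.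
  by nra.
pose z j := \sum_b (pos N.+1 b == j)%:R * (x b 0 / (w (pos N.+1 b))%:C%C).
exists z => [j|i hi].
  have [hj|hj] := leqP `|j| N.+1; last first.
    rewrite /z big1 => [|b _].
      by rewrite nc0 mulr_ge0 ?addr_ge0 ?invr_ge0 ?exprn_ge0 ?(ltW s0) ?(ltW c0).
    case: eqP => [h|_]; last by rewrite mul0r.
    by move: hj; rewrite -h ltnNge pos_le.
  have [b0 ej] := ex_pos hj.
  rewrite /z (bigD1 b0)//= ej eqxx mul1r big1 ?addr0 => [|b ne].
    rewrite ncM ncV nc_real ger0_norm ?(ltW (w0 _))// ler_wpM2r ?invr_ge0 ?(ltW (w0 _))//.
  case: eqP => [h|_]; last by rewrite mul0r.
  by case/negP: ne; apply/eqP/(@pos_inj N.+1); rewrite h ej.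
have [b1 ei] := ex_pos hi.
have : (M *m x) b1 0 = (w i)%:C%C * op J z i.
  rewrite mxE /op /z !mulr_sumr -!big_split /= mulr_sumr; apply: eq_bigr => b _.
  by rewrite mxE ei /e; ring.
rewrite Mx mxE eqxx andbT => /esym h.
apply: (mulfI (wN i)); rewrite h.
have -> : (b1 == a0) = (i == r) by rewrite -ei -er (inj_eq (@pos_inj _ _)).
by case: eqP => [->|]; rewrite ?mulr0// /w subrr expr0 mulr1.
Qed.

End Solve.

Section RightInverse.
Context {R : realType}.
Implicit Types (x y z : int -> R[i]) (i j m k : int) (J : jac R).

Lemma ex_rate (A : R) : 0 <= A -> exists2 s : R, 1 < s & A * (s ^+ 2 - 1) <= 1.
Proof.
move=> A0; have h : 0 < 3 * A + 1 by rewrite ltr_wpDl// mulr_ge0.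
(* For 0 <= t <= 1 one has (1 + t)^2 - 1 <= 3 t, and 3 A t <= 1 for this t. *)
exists (1 + (3 * A + 1)^-1); first by rewrite ltrDl invr_gt0.
set t := (3 * A + 1)^-1.
have t0 : 0 < t by rewrite invr_gt0.
have t1 : t <= 1 by rewrite invf_le1// lerDr mulr_ge0.
have : t * (3 * A + 1) = 1 by rewrite mulVf// gt_eqF.
by nra.
Qed.

Lemma jcv_cst J : jcv (fun=> J) J.
Proof. by move=> i; split; exact: ucv_cst. Qed.

Lemma vec_lim_le (xs : nat -> int -> R[i]) (X : int -> R) (B : R) :
  (forall i, X i <= B) -> (forall n i, nc (xs n i) <= X i) ->
  exists2 x, vcv xs x & forall i, nc (x i) <= X i.
Proof.
move=> hB h; have [x hx _] := @vec_lim _ xs B (fun n i => le_trans (h n i) (hB i)).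
exists x => // i; apply: (ucv_le (hx i)).
by apply: (filterS _ filterT) => n _ /=; exact: h.
Qed.

Lemma solve_column K C J s : 0 < C -> bdd K J -> lb (tr J) C -> 1 < s ->
  4 * C * K * (s ^+ 2 - 1) <= 1 -> exists2 B : R, 0 <= B & forall r,
  exists2 z, (forall j, nc (z j) <= B * (s ^+ `|j - r|)^-1) &
    forall i, op J z i = (i == r)%:R.
Proof.
move=> C0 hJ hC s1 hs.
have s0 : 0 < s by exact: lt_trans ltr01 s1.
pose c := (2 * C) ^+ 2 * (2 * (1 - (s ^+ 2)^-1)^-1).
have c0 : 0 <= c.
  rewrite /c !mulr_ge0 ?exprn_ge0 ?mulr_ge0 ?(ltW C0)// invr_ge0 subr_ge0.
  by rewrite invf_le1 ?exprn_gt0// exprn_ege1// ltW.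
exists (c + 1) => [|r]; first by rewrite addr_ge0.
have /choice[zs hzs] : forall N : nat, exists z,
    (forall j, nc (z j) <= (c + 1) * (s ^+ `|j - r|%N)^-1) /\
    forall i, (`|i| <= N)%N -> op J z i = (i == r)%:R.
  by move=> N; have [z h1 h2] := solve_window r N C0 hJ hC s1 hs; exists z.
have [z hz bz] := @vec_lim_le zs (fun j => (c + 1) * (s ^+ `|j - r|%N)^-1) (c + 1)
  (fun j => ltac:(by rewrite ler_piMr ?addr_ge0// invf_le1 ?exprn_gt0// exprn_ege1// ltW))
  (fun n => (hzs n).1).
exists z => // i.
apply: (ucv_unique (op_ucv i (jcv_cst J) hz)).
apply: ucv_near (ucv_cst _).
by apply: filterS (uF_ge `|i|%N) => n /= hn; rewrite (hzs n).2.
Qed.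

Lemma op_sum J n (f : 'I_n -> R[i]) (z : 'I_n -> int -> R[i]) i :
  op J (fun j => \sum_a f a * z a j) i = \sum_a f a * op J (z a) i.
Proof.
rewrite /op !mulr_sumr -!big_split /=; apply: eq_bigr => a _; by ring.
Qed.

(* x is a limit of least-norm solutions on growing windows. *)
Lemma solve K C J : 0 < C -> bdd K J -> lb (tr J) C ->
  exists C' t : R, [/\ 0 <= C', 1 < t & forall y Y, bnd y Y ->
    exists x, [/\ exists X, bnd x X, forall i, op J x i = y i & localized C' t y x]].
Proof.
move=> C0 hJ hC; have K0 := bdd_ge0 hJ.
have [s s1 hs] : exists2 s : R, 1 < s & 4 * C * K * (s ^+ 2 - 1) <= 1.
  by apply: ex_rate; rewrite !mulr_ge0// ltW.
have [B B0 hB] := solve_column C0 hJ hC s1 hs.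
have /choice[z hz] : forall r, exists z, (forall j, nc (z j) <= B * (s ^+ `|j - r|%N)^-1) /\
    forall i, op J z i = (i == r)%:R.
  by move=> r; have [z h1 h2] := hB r; exists z.
have s0 : 0 < s by exact: lt_trans ltr01 s1.
(* The columns decay at the rate [s], while in [localized] the right-hand side may grow at the rate
   [t]; strictly between 1 and [s], the quotient [q = t / s] is summable. *)
pose t := (1 + s) / 2.
have t1 : 1 < t by rewrite /t; lra.
have ts : t < s by rewrite /t; lra.
have t0 : 0 < t by exact: lt_trans ltr01 t1.
pose q := t / s; have hq : 0 <= q < 1.
  by rewrite /q divr_ge0 ?(ltW t0) ?(ltW s0)//= ltr_pdivrMr// mul1r.
have hs1 : 0 <= s^-1 < 1 by rewrite invr_ge0 (ltW s0) invf_lt1.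
exists (B * (2 * (1 - q)^-1)), t; split => //.
  by rewrite !mulr_ge0// invr_ge0 subr_ge0 ltW//; case/andP: hq.
move=> y Y hy; have Y0 := bnd_ge0 hy.
pose xs N i := \sum_(a < (2 * N).+1) y (pos N a) * z (pos N a) i.
have hxs N : bnd (xs N) (Y * B * (2 * (1 - s^-1)^-1)).
  move=> i; apply: le_trans (nc_sum _ _ _) _.
  apply: le_trans (_ : \sum_(a < (2 * N).+1) Y * B * s^-1 ^+ `|pos N a - i|%N <= _).
    apply: ler_sum => a _; rewrite ncM -mulrA ler_pM ?nc_ge0//.
    by rewrite exprVn distnC; exact: (hz _).1.
  by rewrite -mulr_sumr ler_wpM2l ?mulr_ge0// geo_pos.
have [x hx bx] := vec_lim hxs.
exists x; split.
- by exists (Y * B * (2 * (1 - s^-1)^-1)).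
- move=> i; apply: (ucv_unique (op_ucv i (jcv_cst J) hx)).
  apply: ucv_near (ucv_cst _).
  apply: filterS (uF_ge `|i|%N) => N /= hN.
  rewrite /xs op_sum.
  under eq_bigr do rewrite (hz _).2 eq_sym mulrC.
  by rewrite sum_delta ifT//; apply/andP; split; ilia.
- move=> m d hd; apply: (ucv_le (hx m)).
  apply: (filterS _ filterT) => N _ /=.
  apply: le_trans (nc_sum _ _ _) _.
  apply: le_trans (_ : \sum_(a < (2 * N).+1) d * B * q ^+ `|pos N a - m|%N <= _).
    apply: ler_sum => a _; rewrite ncM.
    apply: le_trans (ler_pM (nc_ge0 _) (nc_ge0 _) (hd _) ((hz _).1 m)) _.
    rewrite (distnC m) /q (expr_div_n t s).
    set u := t ^+ _; set v := s ^+ _.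
    by rewrite (_ : d * u * (B / v) = d * B * (u / v))//; ring.
  rewrite -mulr_sumr [_ * d]mulrC mulrA ler_wpM2l//; last exact: geo_pos.
  rewrite mulr_ge0//; have := hd m; rewrite subrr expr0 mulr1.
  exact: le_trans (nc_ge0 _).
Qed.

End RightInverse.

Section KernelPropagation.
Context {R : realType}.
Implicit Types (x y z : int -> R[i]) (i j m k : int) (J : jac R).

Lemma has_kernel_ext J J' : (forall i, 0 <= i -> J i = J' i) -> has_kernel J -> has_kernel J'.
Proof.
move=> e [x [X [bx sx nx kx]]]; exists x, X; split => // i hi.
by rewrite -(kx i hi) /op /lo /di /up e.
Qed.

(** Without row [r] there are two independent solutions: the kernel vector [v], and a solution [z]
    with residual 1 at row [r], which exists because the transposed bound makes the half-line
    operator onto. The new row [r] is one linear condition on their combinations. The combination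
    chosen is not zero, because the old row [r] maps it to [a]. *)
Lemma ker_step K C J J' r : 0 < C -> bdd K J -> lb (tr (cut NN J)) C -> 0 <= r ->
  (forall i, i != r -> J i = J' i) -> has_kernel J -> has_kernel J'.
Proof.
move=> C0 hJ hC r0 e [v [X [bv sv nv kv]]].
have [B' [t [B0 t1]]] := solve C0 (cut_bdd NN hJ) hC.
pose d i : R[i] := (i == r)%:R.
have bd : bnd d 1.
  by move=> i; rewrite /d; case: (_ == _); rewrite ?nc1 ?nc0.
move=> /(_ d 1 bd)[z [[Z bz] hz _]].
have sz : supp NN z.
  move=> i hi; have := hz i; rewrite op_cut (negbTE hi) => ->.
  by rewrite /d; case: eqP hi => // ->; rewrite /NN r0.
have hz' i : 0 <= i -> op J z i = d i.
  by move=> hi; rewrite -hz op_cut_supp// /NN hi.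
have op_eq y i : i != r -> op J' y i = op J y i.
  by move=> hi; rewrite /op /lo /di /up e.
have [hB|hB] := eqVneq (op J' v r) 0.
  exists v, X; split => // i hi.
  by have [->|ir] := eqVneq i r; rewrite ?hB// op_eq// kv.
pose a := op J' v r; pose b := op J' z r.
pose y := fun i => a * z i + (- b) * v i.
have Jy J0 i : op J0 y i = a * op J0 z i + (- b) * op J0 v i.
  by rewrite /y op_lin opZ.
exists y, (nc a * Z + nc b * X); split.
- move=> i; rewrite /y (le_trans (ncD _ _))// !ncM ncN lerD// ler_wpM2l ?nc_ge0//.
- by move=> i hi; rewrite /y (sz i hi) (sv i hi) !mulr0 addr0.
- apply: contrapT => hy.
  have y0 i : y i = 0 by apply/eqP/negPn/negP => h; apply: hy; exists i.
  have : op J y r = 0 by rewrite /op !y0 !mulr0 !addr0.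
  by rewrite Jy kv// hz'// /d eqxx mulr1 mulr0 addr0 => /eqP; rewrite (negbTE hB).
- move=> i hi; rewrite Jy; have [->|ir] := eqVneq i r.
    by rewrite -/a -/b; ring.
  by rewrite !op_eq// hz'// kv// /d (negbTE ir) !mulr0 addr0.
Qed.

Context (U V W : set R[i]) (K C : R).
Context (hK : forall J, cls U V W J -> bdd K J).
Context (hK' : forall J, cls W V U J -> bdd K J).
Context (cU : compact (U : set (R[i])^o)) (cV : compact (V : set (R[i])^o)).
Context (cW : compact (W : set (R[i])^o)) (C0 : 0 <= C) (hI : line_lb U V W C).

(* If one half-line operator has a kernel then by Coburn no transpose has, so all
   are onto; a kernel then survives changing one row at a time. *)
Lemma ker_all : halfline_ker U V W -> forall J, cls U V W J -> has_kernel J.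
Proof.
move=> P J cJ.
have [[C' hC']|P'] := halfline_lb_or_halfline_ker hK' cW cV cU C0 (line_lb_flip hI); last first.
  by have := coburn hK hK' hI C0 P P'.
have hT J' : cls U V W J' -> lb (tr (cut NN J')) (`|C'| + 1).
  move=> c; rewrite tr_cut; apply: lb_le (hC' _ (cls_tr c)).
  by rewrite (le_trans (ler_norm _))// lerDl.
have C'0 : 0 < `|C'| + 1 by rewrite ltr_wpDl.
have [J1 c1 k1] := P.
pose E (N : nat) : jac R := fun i => if (0 <= i) && (i < N%:Z) then J i else J1 i.
have cE N : cls U V W (E N).
  by move=> i; rewrite /lo /di /up /E; case: ifP => _; [exact: cJ|exact: c1].
have kE N : has_kernel (E N).
  elim: N => [|N IH].
    by apply: has_kernel_ext k1 => i hi; rewrite /E ifF//; apply/negbTE; ilia.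
  apply: (ker_step C'0 (hK (cE N)) (hT _ (cE N)) (r := N%:Z)) IH => // i hi.
  by rewrite /E; congr (if _ then _ else _); ilia.
have /choice[x hx] : forall N, exists x,
    [/\ exists X, bnd x X, supp NN x, x 0 = 1 &
        forall i, 0 <= i -> op (E N) x i = 0].
  move=> N; have [x [X [bx sx nx kx]]] := kE N.
  have x0 := ker0_neq0 hK hI (cE N) bx sx nx kx.
  exists (fun i => (x 0)^-1 * x i); split.
  - by exists (nc (x 0)^-1 * X) => i; rewrite ncM ler_wpM2l ?nc_ge0//; exact: bx.
  - by move=> i hi; rewrite (sx i hi) mulr0.
  - by rewrite mulVf.
  - by move=> i hi; rewrite opZ kx// mulr0.
(* Finitely many steps change finitely many rows; all of them are reached in the limit [N -> oo],
   through [ker_lim]. *)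
pose E1 : jac R := fun i => if 0 <= i then J i else J1 i.
apply: (@has_kernel_ext E1); first by move=> i hi; rewrite /E1 hi.
have jE : jcv E E1.
  move=> i; have hE : uF [set n | E1 i = E n i].
    apply: filterS (uF_ge `|i|.+1%N) => n /= hn.
    by rewrite /E /E1; congr (if _ then _ else _); ilia.
  rewrite /lo /di /up; by split; apply: ucv_near (ucv_cst _); apply: filterS hE => n /= ->.
apply: (ker_lim hK C0 hI cE jE (xs := x)).
- by move=> n; have [] := hx n.
- by move=> n; have [] := hx n.
- by move=> n; have [] := hx n.
- by move=> n i hi; have [_ _ _ h] := hx n; rewrite h// nc0 invr_ge0.
Qed.

End KernelPropagation.

(** * Periodization of finite blocks *)

Section Periodization.
Context {R : realType}.
Implicit Types (x y z : int -> R[i]) (i j m k : int) (J : jac R).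

(** Rows [0] to [n - 1] of [J] are repeated with period [n.+1]; residue [n] is the spare row. The
    negative rows are filled with [t] so that the result stays in the class. *)
Definition perj J n t : jac R := fun i =>
  if i < 0 then t else
  if (absz i %% n.+1 == n)%N then t else J (absz i %% n.+1)%N%:Z.
Definition chain n (c : R[i]) x i : R[i] :=
  if i < 0 then 0 else c ^+ (absz i %/ n.+1)%N * x (absz i %% n.+1)%N%:Z.

Definition FD (n : nat) : pred int := fun i => 0 <= i < n%:Z.

Lemma ex_divn n i : 0 <= i -> exists q s, (s < n.+1)%N /\ i = (q * n.+1 + s)%N%:Z.
Proof.
move=> hi; exists (absz i %/ n.+1)%N, (absz i %% n.+1)%N; split.
  by rewrite ltn_mod.
by rewrite -divn_eq; ilia.
Qed.

Lemma chainE n c x q s : (s < n.+1)%N ->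
  chain n c x (q * n.+1 + s)%N%:Z = c ^+ q * x s%:Z.
Proof.
by move=> hs; rewrite /chain /= divnMDl// modnMDl divn_small// modn_small// addn0.
Qed.

Lemma chain_neg n c x i : i < 0 -> chain n c x i = 0.
Proof. by rewrite /chain => ->. Qed.

Lemma perjE J n t q s : (s < n.+1)%N ->
  perj J n t (q * n.+1 + s)%N%:Z = if s == n then t else J s%:Z.
Proof. by move=> hs; rewrite /perj /= modnMDl modn_small. Qed.

Lemma cls_perj (U V W : set R[i]) J n t : cls U V W J ->
  [/\ U t.1.1, V t.1.2 & W t.2] -> cls U V W (perj J n t).
Proof.
move=> hJ ht i; rewrite /lo /di /up /perj; case: ifP => // _.
by case: ifP => // _; exact: hJ.
Qed.

(* The blocks c^q x are separated by spare rows t, at which the chain vanishes;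
   only the residual at a spare row couples consecutive blocks. *)
Lemma op_chain J n t c x q s : (0 < n)%N -> supp (FD n) x -> (s < n.+1)%N ->
  op (perj J n t) (chain n c x) (q * n.+1 + s)%N%:Z =
  if s == n then c ^+ q * (t.1.1 * x (n%:Z - 1) + c * (t.2 * x 0))
  else c ^+ q * op J x s%:Z.
Proof.
move=> n0 sx hs.
have xn : x n%:Z = 0 by apply: sx; rewrite /FD; ilia.
have xm : x (-1) = 0 by apply: sx; rewrite /FD.
(* The predecessor of the first entry of a block is the spare index of the previous block or -1, and
   the chain vanishes at both, just as [x] does at -1. *)
have Yprev : chain n c x ((q * n.+1 + s)%N%:Z - 1) = c ^+ q * x (s%:Z - 1).
  case: s hs => [_|s hs].
    case: q => [|q]; first by rewrite chain_neg// expr0 mul1r sub0r xm.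
    rewrite (_ : _ - 1 = (q * n.+1 + n)%N%:Z); last by ilia.
    by rewrite chainE// xn mulr0 sub0r xm mulr0.
  rewrite (_ : _ - 1 = (q * n.+1 + s)%N%:Z); last by ilia.
  by rewrite chainE ?(ltnW hs)// (_ : s.+1%:Z - 1 = s%:Z)//; ilia.
rewrite /op /lo /di /up perjE// chainE// Yprev.
have [->|sn] := eqVneq s n.
  rewrite (_ : (q * n.+1 + n)%N%:Z + 1 = (q.+1 * n.+1 + 0)%N%:Z); last by ilia.
  by rewrite chainE// xn exprS; ring.
have hs' : (s < n)%N by rewrite ltn_neqAle sn -ltnS.
rewrite (_ : (q * n.+1 + s)%N%:Z + 1 = (q * n.+1 + s.+1)%N%:Z); last by ilia.
by rewrite chainE// (_ : s.+1%:Z = s%:Z + 1); [ring|ilia].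
Qed.

Definition rev n x i : R[i] := x (n%:Z - 1 - i).
Definition revj n J : jac R := sh (1 - n%:Z) (flip J).

Lemma cls_revj (U V W : set R[i]) n J : cls U V W J -> cls W V U (revj n J).
Proof. by move=> /cls_flip; exact: cls_sh. Qed.

Lemma op_rev n J x i : op (revj n J) (rev n x) i = op J x (n%:Z - 1 - i).
Proof.
have -> : rev n x = (fun j => (fun j' => x (- j')) (j + (1 - n%:Z))).
  by apply/funext => j; rewrite /rev; congr (x _); ilia.
by rewrite /revj (op_sh _ _ (fun j' => x (- j'))) op_flip; congr (op J x _); ilia.
Qed.

Lemma supp_rev n x : supp (FD n) x -> supp (FD n) (rev n x).
Proof. by move=> h i hi; apply: h; move: hi; rewrite /FD; ilia. Qed.

(** Near any given place the compression to the half-line coincides with the compression to a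
    sufficiently long interval, so [lb_local] applies with error 0. *)
Lemma interval_lb_halfline_lb (U V W : set R[i]) K C : (forall J, cls U V W J -> bdd K J) ->
  0 <= C -> interval_lb U V W C -> halfline_lb U V W C.
Proof.
move=> hK C0 hF J cJ; apply: (lb_local (cut_bdd NN (hK J cJ)) C0) => m N e e0.
exists (cut (FD (absz m + N.+2)%N) J); first exact/lb_lbf/hF.
move=> i hi; apply: close_eq (ltW e0) _.
rewrite /cut /NN /FD.
have -> : (i < (absz m + N.+2)%N%:Z) = true by ilia.
have -> : (i - 1 < (absz m + N.+2)%N%:Z) = true by ilia.
have -> : (i + 1 < (absz m + N.+2)%N%:Z) = true by ilia.
by rewrite !andbT.
Qed.

Lemma interval_lb_line_lb (U V W : set R[i]) K C : (forall J, cls U V W J -> bdd K J) ->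
  0 <= C -> interval_lb U V W C -> line_lb U V W C.
Proof.
move=> hK C0 hF J cJ; apply: (lb_local (hK J cJ) C0) => m N e e0.
pose M := (absz m + N.+2)%N.
exists (sh M%:Z (cut (FD (2 * M).+1) (sh (- M%:Z) J))).
  by apply/lb_lbf/lb_sh/hF; exact: cls_sh.
move=> i hi; apply: close_eq (ltW e0) _.
rewrite /sh /cut /FD /lo /di /up addrK.
rewrite ifT; last by rewrite /M; ilia.
rewrite ifT; last by rewrite /M; ilia.
rewrite ifT; last by rewrite /M; ilia.
by case: (J i) => -[].
Qed.

(** An interval reflected in its centre is the same interval, so the reversed class inherits the
    bound. The transposes belong to the reversed class, hence they are covered as well. *)
Lemma interval_lb_flip (U V W : set R[i]) C : interval_lb U V W C -> interval_lb W V U C.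
Proof.
move=> h J n cJ.
have -> : cut (fun i => 0 <= i < n%:Z) J =
    flip (sh (n%:Z - 1) (cut (FD n) (revj n J))).
  rewrite sh_cut flip_cut /revj.
  have -> : flip (sh (n%:Z - 1) (sh (1 - n%:Z) (flip J))) = J.
    apply/funext => i; rewrite /flip /sh /lo /di /up /=.
    rewrite (_ : - (- i + (n%:Z - 1) + (1 - n%:Z)) = i); last by ilia.
    by case: (J i) => -[].
  congr cut; apply/funext => i; rewrite /FD; ilia.
apply: lb_flip; apply: lb_sh; apply: h; exact: cls_revj.
Qed.

Lemma interval_lb_tr (U V W : set R[i]) C J n : interval_lb U V W C -> cls U V W J ->
  lb (tr (cut (FD n) J)) C.
Proof.
by move=> h cJ; rewrite tr_cut; apply: (interval_lb_flip h); exact: cls_tr.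
Qed.

End Periodization.

(** * Norms and duality *)

Section LpBounds.
Context {R : realType}.

Section Generic.
Context {I : choiceType}.
Implicit Types (p : \bar R) (x y : I -> R[i]) (M : R).

(** For [0 <= M] this is [lpnorm p x <= M] (see [lpnorm_leP]), tested on finite partial sums so that
    all estimates stay among the real numbers. *)
Definition lple p x M : Prop :=
  match p with
  | r%:E => forall s : seq I, uniq s -> \sum_(i <- s) nc (x i) `^ r <= M `^ r
  | _ => forall i, nc (x i) <= M
  end.

Lemma ge1_cases p : (1 <= p)%E -> p = +oo%E \/ exists2 r : R, p = r%:E & 1 <= r.
Proof.
case: p => [r| |]//; last by left.
by rewrite lee_fin => r1; right; exists r.
Qed.

(** The alternative is due to [p = +oo] over an empty index set, where the supremum is -oo. *)
Lemma lpnorm_ge0 p x : (1 <= p)%E -> (0 <= lpnorm p x)%E \/ (forall i : I, False).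
Proof.
move=> /ge1_cases[->|[r -> _]]; last by left; exact: poweR_ge0.
have [[i _] | h] := pselect (exists i : I, True); last by right => i; apply: h; exists i.
left; apply: le_trans (_ : ((nc (x i))%:E <= _)%E); first by rewrite lee_fin nc_ge0.
by apply: ereal_sup_ubound; exists i.
Qed.

Lemma lpnorm_leP p x M : (1 <= p)%E -> 0 <= M -> (lpnorm p x <= M%:E)%E <-> lple p x M.
Proof.
move=> /ge1_cases[->|[r -> r1]] M0 /=.
  split=> [h i|h]; first rewrite -lee_fin.
    by apply: le_trans h; apply: ereal_sup_ubound; exists i.
  by apply: ge_ereal_sup => _ [i _ <-]; rewrite lee_fin.
have r0 : 0 < r by apply: lt_le_trans r1.
have rV : r^-1 != 0 by rewrite invr_eq0 gt_eqF.
set E := (\esum_(i in _) _)%E.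
have E0 : (0 <= E)%E by apply: esum_ge0 => i _; rewrite lee_fin powR_ge0.
split=> [h s us|h].
  have EM : (E <= (M `^ r)%:E)%E.
    have -> : E = ((E `^ r^-1) `^ r)%E by rewrite -poweRrM mulVf ?gt_eqF// poweRe1.
    rewrite -poweR_EFin; apply: gt0_ler_poweR => //; first exact: ltW.
      by rewrite in_itv /= poweR_ge0 leey.
    by rewrite in_itv /= lee_fin M0 leey.
  rewrite -lee_fin; apply: le_trans EM; apply: esum_ge.
  exists [set` s]; first by split => //; exact: finite_seq.
  by rewrite -fsbig_seq// sumEFin.
have EM : (E <= (M `^ r)%:E)%E.
  apply: ge_ereal_sup => _ [A [finA _] <-].
  by rewrite fsbig_finite//= sumEFin lee_fin; apply: h; exact: finmap.fset_uniq.
have -> : M%:E = (((M `^ r)%:E) `^ r^-1)%E.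
  by rewrite poweR_EFin -powRrM mulfV ?gt_eqF// powRr1.
apply: gt0_ler_poweR => //; first by rewrite invr_ge0 ltW.
  by rewrite in_itv /= E0 leey.
by rewrite in_itv /= lee_fin powR_ge0 leey.
Qed.

Lemma lpnorm_fin p x : (1 <= p)%E -> lp p x -> exists2 M, 0 <= M & lple p x M.
Proof.
move=> p1; rewrite /lp /= => h.
have [M M0 hM] : exists2 M : R, 0 <= M & (lpnorm p x <= M%:E)%E.
  move: h; case: (lpnorm p x) => [M| |]// _.
    by exists `|M|; rewrite ?normr_ge0// lee_fin ler_norm.
  by exists 0; rewrite ?leNye.
by exists M => //; apply/lpnorm_leP.
Qed.

Lemma lple_lp p x M : (1 <= p)%E -> 0 <= M -> lple p x M -> lp p x.
Proof.
move=> p1 M0 /(lpnorm_leP _ p1 M0) h; rewrite /lp /=.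
by apply: le_lt_trans h _; rewrite ltry.
Qed.

Lemma lple_coord p x M i : (1 <= p)%E -> 0 <= M -> lple p x M -> nc (x i) <= M.
Proof.
move=> /ge1_cases[->|[r -> r1]] M0 //= /(_ [:: i] isT); rewrite big_seq1 => h.
have r0 : 0 < r by apply: lt_le_trans r1.
rewrite leNgt; apply/negP => /(gt0_ltr_powR r0).
by rewrite !nnegrE nc_ge0 M0 => /(_ isT isT); rewrite ltNge h.
Qed.

Lemma lple_mono p x y M : (1 <= p)%E -> (forall i, nc (y i) <= nc (x i)) ->
  lple p x M -> lple p y M.
Proof.
move=> /ge1_cases[->|[r -> r1]] hxy h /=; first by move=> i; exact: le_trans (h i).
have r0 : 0 <= r by apply: le_trans r1.
move=> s us; apply: le_trans (h s us).
by apply: ler_sum => i _; rewrite ge0_ler_powR// nnegrE nc_ge0.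
Qed.

Lemma lple_le p x M M' : (1 <= p)%E -> 0 <= M -> M <= M' -> lple p x M -> lple p x M'.
Proof.
move=> /ge1_cases[->|[r -> r1]] M0 hM h /=; first by move=> i; exact: le_trans (h i) _.
have r0 : 0 <= r by apply: le_trans r1.
move=> s us; apply: le_trans (h s us) _.
by rewrite ge0_ler_powR// nnegrE// (le_trans M0).
Qed.

Lemma lpleZ p x y M (c : R) : (1 <= p)%E -> 0 <= M -> 0 <= c ->
  (forall i, nc (y i) <= c * nc (x i)) -> lple p x M -> lple p y (c * M).
Proof.
move=> /ge1_cases[->|[r -> r1]] M0 c0 hy h /=.
  by move=> i; apply: le_trans (hy i) _; rewrite ler_wpM2l.
have r0 : 0 <= r by apply: le_trans r1.
move=> s us; rewrite powRM//.
apply: le_trans (ler_wpM2l (powR_ge0 c r) (h s us)).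
rewrite mulr_sumr; apply: ler_sum => i _; rewrite -powRM ?nc_ge0//.
by rewrite ge0_ler_powR// nnegrE ?nc_ge0// mulr_ge0 ?nc_ge0.
Qed.

Lemma powRD_le (r a b l : R) : 1 <= r -> 0 <= a -> 0 <= b -> 0 < l < 1 ->
  (a + b) `^ r <= l * (a / l) `^ r + (1 - l) * (b / (1 - l)) `^ r.
Proof.
move=> r1 a0 b0 /andP[l0 l1]; have l2 : 0 < 1 - l by rewrite subr_gt0.
have := convex_powR r1 (Itv01 (ltW l0) (ltW l1)) (x := a / l) (y := b / (1 - l)).
rewrite !convRE /= /unstable.onem !inE /= !in_itv /= !andbT => /(_ _ _) h.
rewrite (_ : a + b = l * (a / l) + (1 - l) * (b / (1 - l))); last first.
  by field; rewrite !gt_eqF.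
by apply: h; rewrite divr_ge0// ltW.
Qed.

Lemma minkowski p x y A B : (1 <= p)%E -> 0 <= A -> 0 <= B -> lple p x A -> lple p y B ->
  lple p (fun i => x i + y i) (A + B).
Proof.
move=> p1 A0 B0 hx hy.
have [Ae|An] := eqVneq A 0.
  rewrite (_ : (fun i => _) = y) ?Ae ?add0r//; apply/funext => i.
  by rewrite (_ : x i = 0) ?add0r//; apply/nc_le0; rewrite -Ae; exact: lple_coord hx.
have [Be|Bn] := eqVneq B 0.
  rewrite (_ : (fun i => _) = x) ?Be ?addr0//; apply/funext => i.
  by rewrite (_ : y i = 0) ?addr0//; apply/nc_le0; rewrite -Be; exact: lple_coord hy.
have Ap : 0 < A by rewrite lt_def An.
have Bp : 0 < B by rewrite lt_def Bn.
have AB : 0 < A + B by rewrite addr_gt0.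
case: (ge1_cases p1) hx hy => [->|[r -> r1]] hx hy /=.
  by move=> i; rewrite (le_trans (ncD _ _))// lerD ?hx ?hy.
have r0 : 0 <= r by apply: le_trans r1.
(* With this weight both rescaled bounds [A / l] and [B / (1 - l)] equal [A + B], so the convexity
   estimate closes up. *)
move=> s us; pose l := A / (A + B).
have l0 : 0 < l by rewrite divr_gt0.
have l1 : l < 1 by rewrite ltr_pdivrMr// mul1r ltrDl.
have l2 : 1 - l = B / (A + B) by rewrite /l; field; rewrite gt_eqF.
have Al : A / l = A + B by rewrite /l; field; rewrite !gt_eqF.
have Bl : B / (1 - l) = A + B by rewrite l2; field; rewrite !gt_eqF.
have l20 : 0 < 1 - l by rewrite subr_gt0.
apply: (@le_trans _ _ (\sum_(i <- s) (l * (nc (x i) / l) `^ r + (1 - l) * (nc (y i) / (1 - l)) `^ r))).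
  apply: ler_sum => i _; apply: le_trans (powRD_le r1 (nc_ge0 _) (nc_ge0 _) _); last by rewrite l0.
  by rewrite ge0_ler_powR ?ncD// nnegrE ?addr_ge0 ?nc_ge0.
rewrite big_split /= -!mulr_sumr.
have -> : (A + B) `^ r = l * (A + B) `^ r + (1 - l) * (A + B) `^ r by ring.
have step (c M : R) (z : I -> R[i]) : 0 < c -> 0 <= M -> lple r%:E z M ->
    c * \sum_(i <- s) (nc (z i) / c) `^ r <= c * (M / c) `^ r.
  move=> c0 M0 hz; rewrite ler_wpM2l ?(ltW c0)//.
  under eq_bigr do rewrite powRM ?nc_ge0 ?invr_ge0 ?(ltW c0)//.
  by rewrite -mulr_suml powRM ?invr_ge0 ?(ltW c0)// ler_wpM2r ?powR_ge0// hz.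
have h1 := step _ _ _ l0 A0 hx; have h2 := step _ _ _ l20 B0 hy.
by rewrite Al in h1; rewrite Bl in h2; exact: lerD.
Qed.

Lemma lple_closed p x M : (1 <= p)%E -> 0 <= M ->
  (forall e, 0 < e -> lple p x (M + e)) -> lple p x M.
Proof.
move=> p1 M0 h; apply/lpnorm_leP => //; apply/lee_addgt0Pr => e e0.
by rewrite -EFinD; apply/lpnorm_leP => //; [rewrite addr_ge0// ltW|exact: h].
Qed.

Lemma lple_fatou p (xs : nat -> I -> R[i]) x M : (1 <= p)%E -> 0 <= M ->
  (forall n, lple p (xs n) M) -> (forall i, ucv (xs ^~ i) (x i)) -> lple p x M.
Proof.
move=> /ge1_cases[->|[r -> r1]] M0 hM hx /=.
  move=> i; apply: (ucv_le (hx i)); apply: (filterS _ filterT) => n _.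
  exact: hM.
have r0 : 0 < r by apply: lt_le_trans r1.
move=> s us.
(* Instead of continuity of the power function: on the finite set [s], eventually each |x i| is at
   most (1 + 1/(k+1)) |xs n i|, and [k] tends to infinity at the end. *)
suff hk (k : nat) : \sum_(i <- s) nc (x i) `^ r <= ((1 + k.+1%:R^-1) * M) `^ r.
  have [Me|Mp] := eqVneq M 0.
    by have := hk 0%N; rewrite Me mulr0.
  have {}Mp : 0 < M by rewrite lt_def Mp M0.
  have S0 : 0 <= \sum_(i <- s) nc (x i) `^ r by rewrite sumr_ge0// => i _; rewrite powR_ge0.
  set S := \sum_(i <- s) _ in hk S0 *.
  have hS : S = (S `^ r^-1) `^ r by rewrite -powRrM mulVf ?gt_eqF// powRr1.
  rewrite hS ge0_ler_powR ?(ltW r0)// ?nnegrE ?powR_ge0//.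
  apply/ler_addgt0Pr => e e0.
  have hk' k : S `^ r^-1 <= (1 + k.+1%:R^-1) * M.
    rewrite leNgt; apply/negP => /(gt0_ltr_powR r0).
    rewrite !nnegrE powR_ge0 mulr_ge0 ?addr_ge0 ?invr_ge0// => /(_ isT isT).
    by rewrite -hS ltNge hk.
  apply: le_trans (hk' (Num.truncn (M / e))) _.
  rewrite mulrDl mul1r lerD2l mulrC ler_pdivrMr// mulrC -ler_pdivrMr//.
  by rewrite ltW// Num.Theory.truncnS_gt.
have d0 : 0 < 1 + k.+1%:R^-1 :> R by rewrite ltr_wpDr// invr_ge0.
have hn : uF [set n | forall i, i \in s -> nc (x i) <= (1 + k.+1%:R^-1) * nc (xs n i)].
  elim: {us} s => [|a s IH]; first by apply: (filterS _ filterT).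
  have ha : uF [set n | nc (x a) <= (1 + k.+1%:R^-1) * nc (xs n a)].
    have [->|xa] := eqVneq (x a) 0.
      apply: (filterS _ filterT) => n _ /=.
      by rewrite nc0 mulr_ge0 ?nc_ge0// ltW.
    have e0 : 0 < nc (x a) * (1 - (1 + k.+1%:R^-1)^-1).
      by rewrite mulr_gt0 ?nc_gt0// subr_gt0 invf_lt1// ltrDl invr_gt0.
    apply: filterS (hx a _ e0) => n /= h.
    rewrite -ler_pdivrMl// mulrC.
    have := nc_distD (x a) (xs n a); rewrite ncBC => h2.
    have := le_lt_trans h2 (ler_ltD (lexx _) h); rewrite mulrBr mulr1; lra.
  apply: filterS2 ha IH => n /= h1 h2 i; rewrite inE => /predU1P[->//|]; exact: h2.
have [n /= hn'] := uF_ex hn.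
rewrite powRM ?(ltW d0)//.
apply: le_trans (ler_wpM2l (powR_ge0 _ r) (hM n s us)).
rewrite mulr_sumr big_seq [leRHS]big_seq; apply: ler_sum => i si.
rewrite -powRM ?nc_ge0 ?(ltW d0)// ge0_ler_powR ?(ltW r0)// ?nnegrE ?nc_ge0//.
  by rewrite mulr_ge0 ?nc_ge0// ltW.
exact: hn'.
Qed.

End Generic.

(** Norms can be transported along an injection whose image contains the support. This serves for
    extensions by zero, shifts, reflections and the enumeration of the blocks of a chain. *)
Lemma lpnorm_inj {I J : choiceType} p (f : I -> J) (y : J -> R[i]) : (1 <= p)%E ->
  injective f -> (forall j, y j != 0 -> exists i, j = f i) ->
  forall M, 0 <= M -> lple p (y \o f) M <-> lple p y M.
Proof.
move=> /ge1_cases[->|[r -> r1]] fi hf M M0 /=.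
  split=> [h j|h i]; last exact: h.
  have [->|/hf[i ->]] := eqVneq (y j) 0; first by rewrite nc0.
  exact: h.
have r0 : 0 < r by apply: lt_le_trans r1.
split=> [h s us|h s us]; last first.
  by rewrite -(big_map f predT (fun j => nc (y j) `^ r)) h// map_inj_uniq.
rewrite (bigID (fun j => y j != 0)) /= [X in _ + X]big1 ?addr0; last first.
  by move=> j /negPn/eqP ->; rewrite nc0 powR0// gt_eqF.
rewrite -big_filter.
have [t e] : exists t, [seq j <- s | y j != 0] = map f t.
  elim: {us} s => [|j s [t IH]] /=; first by exists [::].
  case: ifPn => [/hf[i ->]|_]; last by exists t.
  by exists (i :: t); rewrite /= IH.
rewrite e big_map; apply: h.
have : uniq (map f t) by rewrite -e filter_uniq.
exact: map_uniq.
Qed.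

(* Each x m is dominated by a single weighted coordinate of y, so the p-norm
   bound follows by summing a geometric series. *)
Lemma localized_lple p (C s : R) (x y : int -> R[i]) M : (1 <= p)%E -> 0 < C -> 1 < s ->
  0 <= M -> localized C s y x -> lple p y M -> lple p x (2 * C * (2 * (1 - s^-1)^-1) * M).
Proof.
move=> p1 C0 s1 M0 hc hy.
have s0 : 0 < s by exact: lt_trans ltr01 s1.
have hq : 0 <= s^-1 < 1 by rewrite invr_ge0 (ltW s0) invf_lt1.
have [q0 /ltW q1] := andP hq.
set G := 2 * (1 - s^-1)^-1.
have G1 : 1 <= G.
  have : 1 <= (1 - s^-1)^-1 by rewrite invf_ge1 ?gerBl// subr_gt0; case/andP: hq.
  by rewrite /G; move: ((1 - s^-1)^-1) => v; lra.
(* If no [i] worked, [localized] could be applied with d = |x m| / (2 C) and would give |x m| <= |x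
   m| / 2, so x m = 0, for which any [i] works. *)
have hm m : exists i, nc (x m) <= 2 * C * (s^-1 ^+ `|i - m|%N * nc (y i)).
  apply: contrapT => h.
  have hi i : nc (y i) <= nc (x m) / (2 * C) * s ^+ `|i - m|%N.
    rewrite leNgt; apply/negP => hlt; apply: h; exists i.
    have sk : 0 < s ^+ `|i - m|%N by rewrite exprn_gt0.
    set k := s ^+ _ in hlt sk; rewrite exprVn -/k.
    rewrite [leLHS](_ : _ = 2 * C * (k^-1 * (nc (x m) / (2 * C) * k))); last first.
      by field; rewrite !gt_eqF.
    by rewrite ler_wpM2l ?mulr_ge0 ?(ltW C0)// ler_wpM2l ?invr_ge0 ?(ltW sk)// ltW.
  have := hc m _ hi; rewrite (_ : C * _ = nc (x m) / 2); last by field; rewrite gt_eqF.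
  have := nc_ge0 (x m) => h1 h2.
  have x0 : nc (x m) <= 0 by lra.
  apply: h; exists m; apply: le_trans x0 _.
  by rewrite !mulr_ge0 ?nc_ge0 ?exprn_ge0 ?invr_ge0 ?(ltW s0) ?(ltW C0).
have /choice[f hf] := hm.
have C2 : 0 <= 2 * C by rewrite mulr_ge0// ltW.
have [e|[r e r1]] := ge1_cases p1; move: hy; rewrite e /= => hy; [move=> m|move=> t ut].
  apply: le_trans (hf m) _; rewrite -[leRHS]mulrA ler_wpM2l//.
  rewrite ler_pM ?nc_ge0 ?exprn_ge0//.
  by rewrite (le_trans _ G1)// exprn_ile1.
have r0 : 0 <= r by apply: le_trans r1.
pose u := undup (map f t).
have h1 m : m \in t -> nc (x m) `^ r <= (2 * C) `^ r *
    \sum_(i <- u) s^-1 ^+ `|i - m|%N * nc (y i) `^ r.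
  move=> mt; have pe : 0 <= s^-1 ^+ `|f m - m|%N by rewrite exprn_ge0.
  apply: (@le_trans _ _ ((2 * C * (s^-1 ^+ `|f m - m|%N * nc (y (f m)))) `^ r)).
    by rewrite ge0_ler_powR// ?nnegrE ?nc_ge0// !mulr_ge0 ?nc_ge0// ltW.
  rewrite powRM// ?mulr_ge0 ?nc_ge0// ler_wpM2l ?powR_ge0//.
  rewrite powRM ?nc_ge0//.
  (* The weight is at most 1 and [r >= 1], so the r-th power of the weight is replaced by the weight
     itself; this keeps the final constant independent of [p]. *)
  apply: (@le_trans _ _ (s^-1 ^+ `|f m - m|%N * nc (y (f m)) `^ r)).
    rewrite ler_wpM2r ?powR_ge0// ge1r_powR// exprn_gt0 ?invr_gt0//=.
    by rewrite exprn_ile1.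
  rewrite (big_rem (f m)) /=; last by rewrite mem_undup map_f.
  by rewrite lerDl sumr_ge0// => i _; rewrite mulr_ge0 ?powR_ge0// exprn_ge0.
rewrite big_seq; apply: le_trans (ler_sum _ h1) _.
rewrite -big_seq -mulr_sumr exchange_big /= -(mulrA (2 * C) G M).
have G0 : 0 <= G by exact: le_trans G1.
rewrite (powRM _ C2 (mulr_ge0 G0 M0)) ler_wpM2l ?powR_ge0// powRM//.
apply: (@le_trans _ _ (\sum_(i <- u) G * nc (y i) `^ r)).
  apply: ler_sum => i _; rewrite -mulr_suml ler_wpM2r ?powR_ge0//.
  by under eq_bigr do rewrite distnC; exact: geo_int.
rewrite -mulr_sumr ler_pM ?sumr_ge0//.
- by move=> i _; rewrite powR_ge0.
- by rewrite le1r_powR.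
- by apply: hy; rewrite undup_uniq.
Qed.

End LpBounds.

(** * Pairing with finitely supported vectors and dual norms *)

Section Pairing.
Context {R : realType}.
Implicit Types (x y z g h : int -> R[i]) (i j m k : int) (J : jac R).

Definition isum (f : int -> R[i]) : R[i] := \sum_(i \in [set: int]) f i.
(** Bilinear, without complex conjugation, so that the adjoint of [op J] is [op (tr J)]. *)
Definition pr g y : R[i] := isum (fun i => g i * y i).

Lemma isumE N f : fs N f -> isum f = \sum_(a < (2 * N).+1) f (pos N a).
Proof.
move=> hf; rewrite /isum -(big_map (@pos N (2 * N).+1) predT f) fsbig_supp.
rewrite (fsbig_fwiden (map (@pos N (2 * N).+1) (index_enum _))) //.
- move=> i /= [_ /eqP hi]; apply/mapP.
  have [|hN] := leqP `|i| N; first by move=> /ex_pos[a <-]; exists a; rewrite ?mem_index_enum.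
  by rewrite hf// eqxx in hi.
- by rewrite map_inj_uniq ?index_enum_uniq//; exact: pos_inj.
- by move=> i [_ /= h]; apply: contrapT => hi; apply: h; split.
Qed.

Lemma isum_shift f k : isum (fun i => f (i + k)) = isum f.
Proof.
rewrite /isum [RHS](reindex_fsbigT (fun i : int => i + k))//.
by exists (fun i => i - k) => i /=; rewrite ?addrK ?subrK.
Qed.

Lemma isumD N f g : fs N f -> fs N g -> isum (fun i => f i + g i) = isum f + isum g.
Proof.
move=> hf hg; rewrite (isumE hf) (isumE hg) (@isumE N) ?big_split//.
by move=> i hi; rewrite hf// hg// addr0.
Qed.

Lemma fs_le N M g : (N <= M)%N -> fs N g -> fs M g.
Proof. by move=> h hg i hi; apply: hg; exact: leq_ltn_trans hi. Qed.

Lemma fsM N g y : fs N g -> fs N (fun i => g i * y i).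
Proof. by move=> h i hi; rewrite h// mul0r. Qed.

Lemma prE N g y : fs N g -> pr g y = \sum_(a < (2 * N).+1) g (pos N a) * y (pos N a).
Proof. by move=> h; rewrite /pr (isumE (fsM y h)). Qed.

Lemma prDr N g y z (c : R[i]) : fs N g ->
  pr g (fun i => c * y i + z i) = c * pr g y + pr g z.
Proof.
move=> h; rewrite !(prE _ h) mulr_sumr -big_split /=; apply: eq_bigr => a _; by ring.
Qed.

Lemma prDl N g h y (c : R[i]) : fs N g -> fs N h ->
  pr (fun i => c * g i + h i) y = c * pr g y + pr h y.
Proof.
move=> hg hh; rewrite (prE _ hg) (prE _ hh) (@prE N); last first.
  by move=> i hi; rewrite hg// hh// mulr0 addr0.
by rewrite mulr_sumr -big_split /=; apply: eq_bigr => a _; ring.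
Qed.

Lemma fs_op N J g : fs N g -> fs N.+1 (op J g).
Proof.
by move=> hg i hi; rewrite /op !hg ?mulr0 ?addr0//; ilia.
Qed.

Lemma pr_adj N J g x : fs N g -> pr g (op J x) = pr (op (tr J) g) x.
Proof.
move=> hg.
pose f1 i := g i * (lo J i * x (i - 1)).
pose f2 i := g i * (di J i * x i).
pose f3 i := g i * (up J i * x (i + 1)).
have hg' := fs_le (leqnSn N) hg.
have h1 : fs N.+1 (fun i => f1 (i + 1)).
  by move=> i hi; rewrite /f1 hg ?mul0r//; ilia.
have h3 : fs N.+1 (fun i => f3 (i + (-1))).
  by move=> i hi; rewrite /f3 hg ?mul0r//; ilia.
transitivity (isum f1 + isum f2 + isum f3).
  rewrite -(@isumD N.+1); [|exact: fsM|exact: fsM].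
  rewrite -(@isumD N.+1); [|move=> i hi|exact: fsM].
    by congr isum; apply/funext => i; rewrite /f1 /f2 /f3 /op; ring.
  by rewrite /f1 /f2 hg' ?mul0r ?addr0.
rewrite -(isum_shift f1 1) -(isum_shift f3 (-1)).
rewrite -(@isumD N.+1)//; last exact: fsM.
rewrite -(@isumD N.+1)//; last first.
  by move=> i hi; rewrite h1// /f2 hg' ?mul0r ?addr0.
congr isum; apply/funext => i.
rewrite /f1 /f2 /f3 op_trE addrK subrK; ring.
Qed.

(* The norm of the functional pr g on l^p is at most M. *)
Definition dual_le p g (M : R) := forall y, lple p y 1 -> nc (pr g y) <= M.

Definition e_ k : int -> R[i] := fun i => (i == k)%:R.

Lemma nc_e k i : nc (e_ k i) = (i == k)%:R.
Proof. by rewrite /e_; case: eqP => _; rewrite ?nc1 ?nc0. Qed.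

Lemma lple_e p k : (1 <= p)%E -> lple p (e_ k) 1.
Proof.
move=> /ge1_cases[->|[r -> r1]] /=.
  by move=> i; rewrite nc_e; case: eqP.
have r0 : r != 0 by rewrite gt_eqF// (lt_le_trans ltr01).
move=> s us; rewrite powR1.
rewrite (bigID (pred1 k)) /= [X in _ + X]big1 ?addr0; last first.
  by move=> i /negbTE h; rewrite nc_e h powR0.
rewrite (eq_bigr (fun=> 1)); last by move=> i /eqP ->; rewrite nc_e eqxx powR1.
by rewrite big_const_seq iter_addr_0 (count_uniq_mem _ us) lern1 leq_b1.
Qed.

Lemma pr_e N g k : fs N g -> pr g (e_ k) = g k.
Proof.
move=> hg; rewrite (prE _ hg).
have [hk|hk] := leqP `|k| N; last first.
  rewrite hg// big1// => a _; rewrite /e_; case: eqP => [h|]; rewrite ?mulr0//.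
  by move: hk; rewrite -h ltnNge pos_le.
have [a0 ha] := ex_pos hk.
rewrite (bigD1 a0)//= ha /e_ eqxx mulr1 big1 ?addr0// => a ne.
by rewrite -ha (inj_eq (@pos_inj _ _)) (negbTE ne) mulr0.
Qed.

Lemma dual_le_coord p N g M k : (1 <= p)%E -> fs N g -> dual_le p g M -> nc (g k) <= M.
Proof. by move=> p1 hg /(_ _ (lple_e k p1)); rewrite (pr_e _ hg). Qed.

Lemma dual_le_ge0 p g M : (1 <= p)%E -> dual_le p g M -> 0 <= M.
Proof. by move=> p1 /(_ _ (lple_e 0 p1)); exact: le_trans (nc_ge0 _). Qed.

Lemma dual_le_sum p N g : (1 <= p)%E -> fs N g ->
  dual_le p g (\sum_(a < (2 * N).+1) nc (g (pos N a))).
Proof.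
move=> p1 hg y hy; rewrite (prE _ hg); apply: le_trans (nc_sum _ _ _) _.
apply: ler_sum => a _; rewrite ncM ler_piMr ?nc_ge0//.
exact: lple_coord hy.
Qed.

Lemma dleD p N g h M M' : fs N g -> fs N h -> dual_le p g M -> dual_le p h M' ->
  dual_le p (fun i => g i + h i) (M + M').
Proof.
move=> fg fh hg hh y hy.
have := @prDl N g h y 1 fg fh; rewrite mul1r => e.
rewrite (_ : (fun i => g i + h i) = (fun i => 1 * g i + h i)); last first.
  by apply/funext => i; rewrite mul1r.
by rewrite e (le_trans (ncD _ _))// lerD ?hg ?hh.
Qed.

(** The quotient [h / (c g)] has modulus at most 1 and can be moved to the test vector without
    increasing its norm: dual norms depend monotonically on the moduli of the entries. *)
Lemma dleZ p N g h M (c : R) : fs N g -> 0 <= c -> (forall i, nc (h i) <= c * nc (g i)) ->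
  (1 <= p)%E -> dual_le p g M -> dual_le p h (c * M).
Proof.
move=> fg c0 hc p1 hg y hy.
have fh : fs N h by move=> i /fg e; apply/nc_le0; rewrite (le_trans (hc i))// e nc0 mulr0.
have [c00|cN] := eqVneq c 0.
  rewrite (_ : pr h y = 0) ?nc0 ?mulr_ge0 ?(dual_le_ge0 p1 hg)//.
  rewrite (prE _ fh) big1// => a _; suff -> : h (pos N a) = 0 by rewrite mul0r.
  by apply/nc_le0; rewrite (le_trans (hc _))// c00 mul0r.
have c1 : 0 < c by rewrite lt_def cN.
pose y' i := (h i / (c%:C%C * g i)) * y i.
have hy' : lple p y' 1.
  apply: (lple_mono p1 _ hy) => i; rewrite /y' ncM ler_piMl ?nc_ge0//.
  rewrite ncM ncV ncM nc_real ger0_norm//.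
  have [g0|g0] := eqVneq (g i) 0; first by rewrite g0 nc0 mulr0 invr0 mulr0.
  by rewrite ler_pdivrMr ?mul1r// mulr_gt0// nc_gt0.
have -> : pr h y = c%:C%C * pr g y'.
  rewrite (prE _ fg) (prE _ fh) mulr_sumr; apply: eq_bigr => a _.
  rewrite /y'; have [g0|g0] := eqVneq (g (pos N a)) 0.
    rewrite (_ : h (pos N a) = 0) ?g0 ?mul0r ?mulr0//.
    by apply/nc_le0; rewrite (le_trans (hc _))// g0 nc0 mulr0.
  have cC : c%:C%C != 0 :> R[i] by rewrite -nc_gt0 nc_real gtr0_norm.
  by field; rewrite g0 cC.
by rewrite ncM nc_real ger0_norm// ler_wpM2l// hg.
Qed.

Lemma lple_shift p y k M : (1 <= p)%E -> 0 <= M -> lple p y M ->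
  lple p (fun i => y (i + k)) M.
Proof.
move=> p1 M0; rewrite -(@lpnorm_inj _ _ _ p (fun i => i + k) y)//; first exact: addIr.
by move=> j _; exists (j - k); rewrite subrK.
Qed.

Lemma dual_le_shift p g k M : (1 <= p)%E -> dual_le p g M -> dual_le p (fun i => g (i + k)) M.
Proof.
move=> p1 h y hy.
have := h _ (lple_shift (- k) p1 ler01 hy).
rewrite /pr -(isum_shift _ k); congr (nc (isum _) <= _).
by apply/funext => i; rewrite addrK.
Qed.

Lemma dual_le_scale p N g y M Y : (1 <= p)%E -> fs N g -> dual_le p g M -> 0 <= Y -> lple p y Y ->
  nc (pr g y) <= M * Y.
Proof.
move=> p1 fg hg Y0 hy; have M0 := dual_le_ge0 p1 hg.
have [Ye|YN] := eqVneq Y 0.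
  rewrite (prE _ fg) big1 ?nc0 ?Ye ?mulr0// => a _.
  rewrite (_ : y _ = 0) ?mulr0//; apply/nc_le0.
  by rewrite -Ye; exact: lple_coord hy.
have Yp : 0 < Y by rewrite lt_def YN.
pose z i := (Y^-1)%:C%C * y i.
have hz : lple p z 1.
  rewrite -(mulVf YN); apply: lpleZ hy => //; first by rewrite invr_ge0.
  by move=> i; rewrite /z ncM nc_real ger0_norm ?invr_ge0.
have := hg z hz.
rewrite (_ : pr g z = (Y^-1)%:C%C * pr g y); last first.
  by rewrite !(prE _ fg) mulr_sumr; apply: eq_bigr => a _; rewrite /z; ring.
by rewrite ncM nc_real ger0_norm ?invr_ge0// ler_pdivrMl// mulrC.
Qed.

End Pairing.

Section StarLowerBound.
Context {R : realType}.
Implicit Types (x y z g h : int -> R[i]) (i j m k : int) (J : jac R).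

(** On finitely supported vectors [dual_le p] is the norm with the conjugate exponent (see [holder]
    and [dual_le_lple]). An inverse on l^p gives precisely such a bound for the transpose, for every
    [p] alike. *)
Definition dual_lb p (D : pred int) J (C : R) := forall N g M, fs N g -> supp D g -> 0 <= M ->
  dual_le p (mask D (op J g)) M -> dual_le p g (C * M).

Lemma lbf_lb K J C : bdd K J -> 0 <= C -> lbf J C -> lb J C.
Proof.
move=> hJ C0 h; apply: (lb_local hJ C0) => m N e e0.
by exists J => // i _; exact: close_eq (ltW e0) _.
Qed.

Lemma fs_mask N D g : fs N g -> fs N (mask D g).
Proof. by move=> h i hi; rewrite /mask h// if_same. Qed.

(* The weight s ^ - |i - m| turns a lower bound in the dual norm into one for the
   single coordinate m in terms of the sup norm of the residual. *)
Lemma dual_lb_coord p D J K C s N x d : (1 <= p)%E -> bdd K J -> 0 <= C -> 1 < s ->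
  4 * C * K * (s - 1) <= 1 -> dual_lb p D J C -> fs N x -> supp D x -> 0 <= d ->
  (forall i, D i -> nc (op J x i) <= d) ->
  bnd x (2 * (C * (d * (2 * (1 - s^-1)^-1)))).
Proof.
move=> p1 hJ C0 s1 hs hD fx sx d0 hd m.
have K0 := bdd_ge0 hJ; have s0 : 0 < s by exact: lt_trans ltr01 s1.
have hq : 0 <= s^-1 < 1 by rewrite invr_ge0 (ltW s0) invf_lt1.
pose w i : R := s^-1 ^+ `|i - m|%N.
have w0 i : 0 < w i by rewrite exprn_gt0 ?invr_gt0.
have ws i j : (`|i - j|%N <= 1)%N -> `|w i - w j| <= (s - 1) * w i.
  move=> hij; rewrite /w.
  have [e|[e|e]] : `|i - m|%N = `|j - m|%N \/ `|i - m|%N = `|j - m|.+1%N \/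
     `|i - m|.+1%N = `|j - m|%N by ilia.
  - by rewrite e subrr normr0 mulr_ge0 ?subr_ge0 ?(ltW s1)// exprn_ge0// invr_ge0 ltW.
  - rewrite e exprS; set v := s^-1 ^+ _; have v0 : 0 <= v by rewrite exprn_ge0// invr_ge0 ltW.
    rewrite (_ : s^-1 * v - v = - ((s - 1) * (s^-1 * v))); last by field; rewrite gt_eqF.
    by rewrite normrN ger0_norm// mulr_ge0 ?subr_ge0 ?(ltW s1)// mulr_ge0// invr_ge0 ltW.
  - rewrite -e exprS; set v := s^-1 ^+ _; have v0 : 0 <= v by rewrite exprn_ge0// invr_ge0 ltW.
    rewrite (_ : v - s^-1 * v = (s - 1) * v / s); last by field; rewrite gt_eqF.
    have sv : 0 <= (s - 1) * v by rewrite mulr_ge0 ?subr_ge0 ?(ltW s1).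
    rewrite ger0_norm ?divr_ge0// ?(ltW s0)// ler_pdivrMr// ler_peMr//.
    exact: ltW.
pose y := fun j => (w j)%:C%C * x j.
have yE j : nc (y j) = w j * nc (x j) by rewrite /y ncM nc_real ger0_norm// ltW.
have fy : fs N y by move=> i hi; rewrite /y fx// mulr0.
have sy : supp D y by move=> i hi; rewrite /y sx// mulr0.
have -> : nc (x m) = nc (y m) by rewrite yE /w subrr expr0 mul1r.
set G := 2 * (1 - s^-1)^-1.
have G0 : 0 <= G by rewrite mulr_ge0// invr_ge0 subr_ge0 ltW//; case/andP: hq.
apply: (@halving _ (fun Y => 0 <= Y /\ dual_le p y Y) _ _
   (\sum_(a < (2 * N).+1) nc (y (pos N a)))).
- by split; [rewrite sumr_ge0// => a _; exact: nc_ge0|exact: dual_le_sum].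
- move=> Y [Y0 hY]; split.
    by apply: addr_ge0; [apply: mulr_ge0 => //; apply: mulr_ge0|apply: divr_ge0].
  (* The residual of the weighted vector is dominated by three terms: the weighted residual of [x],
     with a summable majorant, and two commutator terms majorized by shifts of [y] itself, whose
     dual norm is at most [Y]. *)
  pose h1 i : R[i] := if (`|i| <= N.+1)%N then (d * w i)%:C%C else 0.
  pose hm i : R[i] := (K * (s - 1) * nc (y (i - 1)))%:C%C.
  pose hp i : R[i] := (K * (s - 1) * nc (y (i + 1)))%:C%C.
  have Ks : 0 <= K * (s - 1) by rewrite mulr_ge0// subr_ge0 ltW.
  have dwp i : 0 <= d * w i by rewrite mulr_ge0// ltW.
  have nhm i : nc (hm i) = K * (s - 1) * nc (y (i - 1)).
    by rewrite nc_real ger0_norm// mulr_ge0// nc_ge0.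
  have nhp i : nc (hp i) = K * (s - 1) * nc (y (i + 1)).
    by rewrite nc_real ger0_norm// mulr_ge0// nc_ge0.
  have f1 : fs N.+1 h1 by move=> i hi; rewrite /h1 leqNgt hi.
  have fyS i k : (N.+1 < `|i|)%N -> (`|k| <= 1)%N -> y (i + k) = 0.
    by move=> h1' h2'; apply: fy; ilia.
  have fm : fs N.+1 hm.
    by move=> i hi; apply/nc_le0; rewrite nhm fyS// nc0 mulr0.
  have fp : fs N.+1 hp.
    by move=> i hi; apply/nc_le0; rewrite nhp fyS// nc0 mulr0.
  have d1 : dual_le p h1 (d * G).
    have := dual_le_sum p1 f1; move=> h z hz; apply: le_trans (h z hz) _.
    rewrite (eq_bigr (fun a => d * w (pos N.+1 a))); last first.
      by move=> a _; rewrite /h1 pos_le nc_real ger0_norm.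
    by rewrite -mulr_sumr ler_wpM2l// geo_pos.
  have dm : dual_le p hm (K * (s - 1) * Y).
    have fy1 : fs N.+1 (fun i => y (i + (-1))) by move=> i hi; exact: fyS.
    apply: (dleZ fy1 Ks _ p1 (dual_le_shift (-1) p1 hY)) => i.
    by rewrite nhm.
  have dp : dual_le p hp (K * (s - 1) * Y).
    have fy1 : fs N.+1 (fun i => y (i + 1)) by move=> i hi; exact: fyS.
    apply: (dleZ fy1 Ks _ p1 (dual_le_shift 1 p1 hY)) => i.
    by rewrite nhp.
  have fmp : fs N.+1 (fun i => hm i + hp i).
    by move=> i hi; rewrite fm// fp// addr0.
  have := dleD f1 fmp d1 (dleD fm fp dm dp).
  set h := (fun i => h1 i + _) => dh.
  have fh : fs N.+1 h by move=> i hi; rewrite /h f1// fm// fp// !addr0.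
  have hle i : nc (mask D (op J y) i) <= 1 * nc (h i).
    rewrite mul1r /mask; case: ifPn => [Di|_]; last by rewrite nc0 nc_ge0.
    have [hi|hi] := leqP `|i| N.+1; last first.
      by rewrite (fs_op J fy) ?nc0 ?nc_ge0.
    have -> : nc (h i) = d * w i + (K * (s - 1) * nc (y (i - 1)) + K * (s - 1) * nc (y (i + 1))).
      rewrite /h /h1 /hm /hp hi -!rmorphD nc_real ger0_norm//.
      by rewrite !addr_ge0 ?mulr_ge0 ?nc_ge0 ?subr_ge0 ?(ltW s1) ?(ltW (w0 _)).
    rewrite /y op_mul (le_trans (ncD _ _))// lerD//.
      by rewrite ncM nc_real (ger0_norm (ltW (w0 _))) mulrC ler_wpM2r ?hd// ltW.
    have [k1 _ k2] := hJ i.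
    have step j : (`|j - i|%N <= 1)%N ->
        `|w j - w i| * nc (x j) <= (s - 1) * nc (y j).
      by move=> hj; rewrite yE mulrA ler_wpM2r ?nc_ge0// ws.
    rewrite (le_trans (ncD _ _))// -!mulrA lerD// ncM ler_pM ?nc_ge0//.
      by rewrite ncM nc_real step// distnC distSm.
    by rewrite ncM nc_real step// distnC distSp.
  have := dleZ fh ler01 hle p1 dh; rewrite mul1r => dh'.
  have M0 := dual_le_ge0 p1 dh'.
  have := hD _ _ _ fy sy M0 dh' => hfin z hz; apply: le_trans (hfin z hz) _.
  rewrite mulrDr lerD2l.
  rewrite (_ : C * _ = (4 * C * K * (s - 1)) * (Y / 2)); last by field.
  by rewrite ler_piMl// divr_ge0.
- by move=> Y [Y0 hY]; exact: dual_le_coord fy hY.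
Qed.

(** This is where [p] disappears: the sup norm bound has a constant depending on [C] and [K] alone,
    uniformly in the domain and in the operator. *)
Lemma dual_lb_lb p (K C : R) : (1 <= p)%E -> 0 <= C -> 0 <= K ->
  exists2 C' : R, 0 <= C' & forall D J, bdd K J -> dual_lb p D J C -> lb (cut D J) C'.
Proof.
move=> p1 C0 K0.
have [s s1 hs] := ex_rate (mulr_ge0 (mulr_ge0 (ler0n R 4) C0) K0).
have hs' : 4 * C * K * (s - 1) <= 1.
  apply: le_trans hs; rewrite ler_wpM2l ?mulr_ge0// lerD2r.
  by rewrite expr2 ler_peMl// ltW// (lt_trans _ s1).
set G := 2 * (1 - s^-1)^-1.
have s0 : 0 < s by exact: lt_trans ltr01 s1.
have G0 : 0 <= G by rewrite mulr_ge0// invr_ge0 subr_ge0 invf_le1// ltW.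
(* The 1 takes care of the identity rows outside [D]. *)
exists (Num.max 1 (2 * (C * G))) => [|D J hJ hD]; first by rewrite le_max ler01.
apply: (lbf_lb (cut_bdd D hJ)); first by rewrite le_max ler01.
move=> N x d fx hd i; have d0 := bnd_ge0 hd.
have [Di|Di] := boolP (D i); last first.
  have := hd i; rewrite op_cut (negbTE Di) => h.
  by rewrite (le_trans h)// ler_peMl// le_max lexx.
have -> : x i = mask D x i by rewrite /mask Di.
have := dual_lb_coord p1 hJ C0 s1 hs' hD (fs_mask D fx) (@supp_mask _ D x) d0.
move=> /(_ _ i) h; apply: le_trans (h _) _.
  by move=> j Dj; have := hd j; rewrite op_cut Dj.
rewrite -/G [leLHS](_ : _ = 2 * (C * G) * d); last by ring.
by rewrite ler_wpM2r// le_max lexx orbT.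
Qed.

End StarLowerBound.

(** * Uniform boundedness of finitely supported functionals *)

Section UniformBoundedness.
Context {R : realType}.
Implicit Types (x y z g h : int -> R[i]) (i j : int).

Lemma dual_le_near_sup p g N : (1 <= p)%E -> fs N g -> exists2 S : R, dual_le p g S &
  0 < S -> exists2 y, lple p y 1 & (2 / 3) * S <= nc (pr g y).
Proof.
move=> p1 fg; pose A := [set r : R | exists2 y, lple p y 1 & r = nc (pr g y)].
have ub : has_ubound A.
  exists (\sum_(a < (2 * N).+1) nc (g (pos N a))) => _ [y hy ->].
  exact: dual_le_sum hy.
have hA : has_sup A.
  by split => //; exists (nc (pr g (e_ 0))), (e_ 0) => //; exact: lple_e.
exists (sup A) => [y hy|S0]; first by apply: ub_le_sup => //; exists y.
have e0 : 0 < sup A / 3 by rewrite divr_gt0.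
have [_ [y hy ->] h] := sup_adherent e0 hA.
by exists y => //; apply: ltW; apply: le_lt_trans h; lra.
Qed.

(** The difference of [a + b] and [a - b] is [2 * b], so one of the two is at least as large as
    [b]. *)
Lemma nc_sign (a b : R[i]) : exists2 e : R[i], nc e = 1 & nc b <= nc (a + e * b).
Proof.
have [h|h] := leP (nc b) (nc (a + b)); first by exists 1; rewrite ?nc1 ?mul1r.
exists (-1); first by rewrite ncN nc1.
rewrite mulN1r; have := ncB (a + b) (a - b).
rewrite (_ : a + b - (a - b) = 2 * b); last by ring.
rewrite ncM (_ : nc 2 = 2); last first.
  by rewrite (_ : (2 : R[i]) = (2 : R)%:C%C) ?nc_real ?ger0_norm// rmorph_nat.
by lra.
Qed.

Lemma ucv_sum (I : Type) (r : seq I) (f : I -> nat -> R[i]) (l : I -> R[i]) :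
  (forall a, ucv (f a) (l a)) -> ucv (fun m => \sum_(a <- r) f a m) (\sum_(a <- r) l a).
Proof.
move=> h; elim: r => [|a r IH].
  by rewrite big_nil (_ : (fun m => _) = fun=> 0); [exact: ucv_cst|apply/funext => m; rewrite big_nil].
rewrite big_cons (_ : (fun m => _) = fun m => f a m + \sum_(a <- r) f a m).
  exact: ucvD.
by apply/funext => m; rewrite big_cons.
Qed.

Lemma pr_ucv N g (xs : nat -> int -> R[i]) x : fs N g -> vcv xs x ->
  ucv (fun m => pr g (xs m)) (pr g x).
Proof.
move=> fg hx; rewrite (prE _ fg).
rewrite (_ : (fun m => _) = fun m => \sum_(a < (2 * N).+1) g (pos N a) * xs m (pos N a)).
  by apply: ucv_sum => a; apply: ucvM (hx _); exact: ucv_cst.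
by apply/funext => m; rewrite (prE _ fg).
Qed.

(* Sokal's gliding hump: a divergent sum of humps with suitable signs. *)
Lemma uniform_boundedness p (F : set (int -> R[i])) : (1 <= p)%E ->
  (forall g, F g -> exists N, fs N g) ->
  (forall y, lp p y -> exists M, forall g, F g -> nc (pr g y) <= M) ->
  exists2 M, 0 <= M & forall g, F g -> dual_le p g M.
Proof.
move=> p1 hF hp; apply: contrapT => hn.
(* With the ratio 1/9, all humps after the n-th contribute at most 1/8 of [t ^+ n * S n], against
   2/3 of it from the n-th. What remains is more than half of [t ^+ n * S n], which is at least
   [2 * n.+1]. *)
pose t : R := 9^-1; have t0 : 0 < t by rewrite invr_gt0.
have /choice[u hu] : forall n : nat, exists u : (int -> R[i]) * (int -> R[i]) * R,
    [/\ F u.1.1, lple p u.1.2 1, dual_le p u.1.1 u.2, n.+1%:R * 9 ^+ n * 2 <= u.2 &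
        (2 / 3) * u.2 <= nc (pr u.1.1 u.1.2)].
  move=> n; pose M : R := n.+1%:R * 9 ^+ n * 2.
  have M0 : 0 <= M by rewrite /M !mulr_ge0// exprn_ge0.
  have [g Fg hg] : exists2 g, F g & ~ dual_le p g M.
    apply: contrapT => h; apply: hn; exists M => // g Fg.
    by apply: contrapT => h'; apply: h; exists g.
  have [N fg] := hF _ Fg.
  have [S hS hy] := dual_le_near_sup p1 fg.
  have MS : M <= S.
    rewrite leNgt; apply/negP => SM; apply: hg => y hy'.
    by rewrite (le_trans (hS y hy'))// ltW.
  have M1 : 0 < M by rewrite /M !mulr_gt0// exprn_gt0.
  have [y hy1 hy2] := hy (lt_le_trans M1 MS).
  by exists (g, y, S).
pose g n := (u n).1.1; pose y n := (u n).1.2; pose S n := (u n).2.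
have /choice[sg hsg] : forall q : nat * R[i], exists e : R[i], nc e = 1 /\
   nc (pr (g q.1) (fun i => (t ^+ q.1)%:C%C * y q.1 i)) <=
   nc (q.2 + e * pr (g q.1) (fun i => (t ^+ q.1)%:C%C * y q.1 i)).
  move=> q; have [e e1 he] := nc_sign q.2 (pr (g q.1) (fun i => (t ^+ q.1)%:C%C * y q.1 i)).
  by exists e.
pose b n i := (t ^+ n)%:C%C * y n i.
pose xs := fix xs n := if n is n'.+1 then
   fun i => sg (n', pr (g n') (xs n')) * b n' i + xs n' i else fun=> 0.
pose e n := sg (n, pr (g n) (xs n)).
have e1 n : nc (e n) = 1 by have [] := hsg (n, pr (g n) (xs n)).
have xsS n : xs n.+1 = (fun i => e n * b n i + xs n i) by [].
have hb n : lple p (b n) (t ^+ n).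
  rewrite -[t ^+ n]mulr1; have [_ h _ _ _] := hu n; apply: lpleZ h => //.
    by rewrite exprn_ge0// ltW.
  by move=> i; rewrite /b ncM nc_real ger0_norm// exprn_ge0// ltW.
(* The sum of [k] humps, beginning with the n-th. *)
pose T := fix T k n := if k is k'.+1 then
   fun i => e n * b n i + T k' n.+1 i else (fun=> 0) : int -> R[i].
have hT k n : lple p (T k n) (4 * t ^+ n).
  elim: k n => [|k IH] n /=.
    apply: (lple_mono p1 (x := b n)); first by move=> i; rewrite nc0 nc_ge0.
    apply: (lple_le p1 _ _ (hb n)); first by rewrite exprn_ge0// ltW.
    by rewrite ler_peMl ?exprn_ge0 ?(ltW t0)// ler1n.
  have tn m : 0 <= t ^+ m by rewrite exprn_ge0// ltW.
  have he : lple p (fun i => e n * b n i) (t ^+ n).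
    by apply: (lple_mono p1 _ (hb n)) => i; rewrite ncM e1 mul1r.
  have h4 : 0 <= 4 * t ^+ n.+1 by rewrite mulr_ge0.
  apply: lple_le (minkowski p1 (tn n) h4 he (IH n.+1)) => //; first by rewrite addr_ge0.
  by have := tn n; rewrite exprS /t; lra.
have xsT k n i : xs (n + k)%N i = xs n i + T k n i.
  elim: k n => [|k IH] n; first by rewrite addn0 addr0.
  by rewrite addnS -addSn IH xsS /=; ring.
have hxs n : lple p (xs n) 4.
  have -> : xs n = T n 0%N by apply/funext => i; have := xsT n 0%N i; rewrite add0n add0r.
  by have := hT n 0%N; rewrite expr0 mulr1.
(* Coordinatewise convergence is enough: the functionals have finite support, and the limit lies in
   l^p by Fatou. *)
have [|x hx _] := @vec_lim _ xs 4; first by move=> n i; exact: lple_coord (hxs n).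
have [|M hM] := hp x.
  by apply: (@lple_lp _ _ p x 4) => //; exact: lple_fatou hx.
have hn1 n : n.+1%:R <= M.
  have [Fg _ dg Sg yg] := hu n; rewrite -/(g n) -/(S n) -/(y n) in Fg dg Sg yg.
  have [N fg] := hF _ Fg.
  apply: le_trans (hM _ Fg).
  apply: (ucv_ge (pr_ucv fg hx)).
  have S0 := dual_le_ge0 p1 dg.
  have tn m : 0 < t ^+ m by rewrite exprn_gt0.
  have hprb m : nc (pr (g n) (b m)) <= S n * t ^+ m.
    by apply: (dual_le_scale p1 fg dg) => //; exact: ltW.
  have hT' k m : nc (pr (g n) (T k m)) <= S n * (9 / 8 * t ^+ m).
    elim: k m => [|k IH] m /=.
      rewrite (prE _ fg) big1 ?nc0 => [|a _]; last by rewrite mulr0.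
      by rewrite !mulr_ge0// ltW.
    rewrite (prDr _ _ _ fg) (le_trans (ncD _ _))// ncM e1 mul1r.
    apply: le_trans (lerD (hprb m) (IH m.+1)) _.
    by rewrite -mulrDr ler_wpM2l// exprS; have := tn m; rewrite /t; lra.
  apply: filterS (uF_ge n.+1) => m /= hm.
  rewrite -(subnKC hm); set k := (m - n.+1)%N.
  have -> : xs (n.+1 + k)%N = (fun i => 1 * xs n.+1 i + T k n.+1 i).
    by apply/funext => i; rewrite xsT mul1r.
  rewrite (prDr _ _ _ fg) mul1r.
  have h1 : nc (pr (g n) (b n)) <= nc (pr (g n) (xs n.+1)).
    have [_] := hsg (n, pr (g n) (xs n)); rewrite xsS (prDr _ _ _ fg) /= addrC.
    by rewrite -/(b n).
  have h2 : t ^+ n * (2 / 3 * S n) <= nc (pr (g n) (b n)).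
    rewrite (_ : pr (g n) (b n) = (t ^+ n)%:C%C * pr (g n) (y n)); last first.
      by rewrite !(prE _ fg) mulr_sumr; apply: eq_bigr => a _; rewrite /b; ring.
    by rewrite ncM nc_real ger0_norm ?(ltW (tn n))// ler_wpM2l// ltW.
  have h3 := hT' k n.+1.
  have h4 := nc_distD (pr (g n) (xs n.+1)) (pr (g n) (xs n.+1) + pr (g n) (T k n.+1)).
  rewrite (_ : _ - _ = - pr (g n) (T k n.+1)) ?ncN in h4; last by ring.
  have h5 : n.+1%:R * 2 <= t ^+ n * S n.
    rewrite -ler_pdivrMl// mulrC /t exprVn invrK -mulrA [2 * _]mulrC mulrA.
    exact: Sg.
  have h6 : S n * (9 / 8 * t ^+ n.+1) = t ^+ n * S n / 8.
    by rewrite exprS /t; field.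
  rewrite h6 in h3; rewrite mulrCA in h2; have n0 : 0 <= n.+1%:R :> R by [].
  move: (t ^+ n * S n) (n.+1%:R) h2 h3 h5 n0 => v w; lra.
pose n := Num.truncn M; have := hn1 n; apply/negP; rewrite -ltNge.
exact: Num.Theory.truncnS_gt.
Qed.

End UniformBoundedness.

(** * Matrices and their inverses *)

Section Operators.
Context {R : realType} {I : choiceType}.
Implicit Types (p : \bar R) (x y : I -> R[i]) (T : (I -> R[i]) -> I -> R[i]).

Lemma lp_lin p (a : R[i]) x y : (1 <= p)%E -> lp p x -> lp p y ->
  lp p (fun i => a * x i + y i).
Proof.
move=> p1 /(lpnorm_fin p1)[M M0 hM] /(lpnorm_fin p1)[N N0 hN].
have aM : 0 <= nc a * M by rewrite mulr_ge0 ?nc_ge0.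
apply: (lple_lp p1 (addr_ge0 aM N0)); apply: minkowski => //.
by apply: (lpleZ p1 M0 (nc_ge0 a) _ hM) => i; rewrite ncM.
Qed.

Lemma lp0 p : (1 <= p)%E -> lp p (fun _ : I => 0 : R[i]).
Proof.
move=> p1; apply: (@lple_lp _ _ p _ 0) => //.
case: (ge1_cases p1) => [->|[r -> r1]] /= => [i|s _]; first by rewrite nc0.
by rewrite big1 ?powR_ge0// => i _; rewrite nc0 powR0// gt_eqF// (lt_le_trans ltr01).
Qed.

Lemma boundedZ p T (a : R[i]) x : (1 <= p)%E -> bounded_operator p T -> lp p x ->
  T (fun i => a * x i) = (fun i => a * T x i).
Proof.
move=> p1 [_ hl _] hx.
have T0 : T (fun=> 0) = fun=> 0.
  have := hl 1 _ _ (lp0 p1) (lp0 p1).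
  rewrite (_ : (fun i => 1 * 0 + 0) = (fun _ : I => 0 : R[i])); last first.
    by apply/funext => i; rewrite mulr0 addr0.
  move=> e; apply/funext => i; have := congr1 (fun f => f i) e.
  by rewrite mul1r => /eqP; rewrite -subr_eq0 opprD addNKr oppr_eq0 => /eqP.
have := hl a x _ hx (lp0 p1); rewrite T0.
rewrite (_ : (fun i => a * x i + 0) = (fun i => a * x i)); last first.
  by apply/funext => i; rewrite addr0.
by move=> ->; apply/funext => i; rewrite addr0.
Qed.

Lemma opnorm_lple p T (N : R) x M : (1 <= p)%E -> bounded_operator p T ->
  (opnorm p T <= N%:E)%E -> 0 <= N -> 0 <= M -> lple p x M -> lple p (T x) (N * M).
Proof.
move=> p1 bT hN N0 M0 hx.
have h1 y : lple p y 1 -> lple p (T y) N.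
  move=> hy; apply/lpnorm_leP => //; apply: le_trans hN.
  by apply: ereal_sup_ubound; exists y => //=; apply/lpnorm_leP.
have lx : lp p x by exact: lple_lp hx.
have [M00|MN] := eqVneq M 0.
  have x0 : x = (fun i => 0 * x i).
    apply/funext => i; rewrite mul0r; apply/nc_le0.
    by rewrite -M00; exact: lple_coord hx.
  rewrite {1}x0 (boundedZ _ p1 bT lx) M00 mulr0.
  rewrite -[X in lple _ _ X](mul0r M); apply: (lpleZ p1 M0 (lexx _) _ hx).
  by move=> i; rewrite mul0r nc0 mul0r.
have Mp : 0 < M by rewrite lt_def MN.
pose y i := (M^-1)%:C%C * x i.
have hy : lple p y 1.
  rewrite -(mulVf MN); apply: lpleZ hx => //; first by rewrite invr_ge0.
  by move=> i; rewrite /y ncM nc_real ger0_norm// invr_ge0.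
have := h1 _ hy; rewrite /y (boundedZ _ p1 bT lx) mulrC => h2.
apply: lpleZ h2 => // i.
by rewrite ncM nc_real ger0_norm ?invr_ge0// mulrA mulfV ?mul1r.
Qed.

Lemma opnorm_leP p T (N : R) : (1 <= p)%E -> 0 <= N ->
  (forall x, lple p x 1 -> lple p (T x) N) -> (opnorm p T <= N%:E)%E.
Proof.
move=> p1 N0 h; apply: ge_ereal_sup => _ [x hx <-].
by apply/lpnorm_leP => //; apply: h; apply/lpnorm_leP.
Qed.

End Operators.

(** * Index sets embedded in the integers *)

Section Embedding.
Context {R : realType} {I : choiceType} (emb : I -> int) (inv : int -> option I).
Context (embK : forall i, inv (emb i) = Some i).
Context (invK : forall k i, inv k = Some i -> emb i = k).
Implicit Types (p : \bar R) (x y : I -> R[i]) (z : int -> R[i]) (J : jac R).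
Implicit Types (A : I -> I -> R[i]) (U V W : set R[i]).

Definition ext x k : R[i] := if inv k is Some i then x i else 0.
Definition res z i := z (emb i).
Definition dom : pred int := fun k => inv k.

Lemma emb_inj : injective emb.
Proof. by move=> i j h; have := embK i; rewrite h embK => -[]. Qed.

Lemma dom_emb i : dom (emb i). Proof. by rewrite /dom embK. Qed.

Lemma domP k : dom k -> exists i, emb i = k.
Proof. by rewrite /dom; case e : (inv k) => [i|]// _; exists i; exact: invK. Qed.

Lemma ext_emb x i : ext x (emb i) = x i. Proof. by rewrite /ext embK. Qed.

Lemma ext_supp x : supp dom (ext x).
Proof. by move=> k; rewrite /dom /ext; case: (inv k). Qed.

Lemma res_ext z : supp dom z -> ext (res z) = z.
Proof.
move=> h; apply/funext => k; have [/domP[i <-]|nk] := boolP (dom k).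
  by rewrite ext_emb.
by rewrite h// ext_supp.
Qed.

Lemma ext_res x : res (ext x) = x.
Proof. by apply/funext => i; rewrite /res ext_emb. Qed.

Lemma lple_ext p x M : (1 <= p)%E -> 0 <= M -> lple p (ext x) M <-> lple p x M.
Proof.
move=> p1 M0; rewrite -(@lpnorm_inj _ _ _ p emb (ext x))//; last first.
- move=> k hk; have [/domP[i <-]|nk] := boolP (dom k); first by exists i.
  by rewrite ext_supp ?eqxx in hk.
- exact: emb_inj.
by rewrite (_ : ext x \o emb = x)//; apply/funext => i /=; rewrite ext_emb.
Qed.

Lemma lp_bnd p x : (1 <= p)%E -> lp p x -> exists X, bnd (ext x) X.
Proof.
move=> p1 /(lpnorm_fin p1)[M M0 hM]; exists M => k.
by apply: (@lple_coord _ _ p _ M) => //; apply/lple_ext.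
Qed.

Lemma isum3 (f : int -> R[i]) (c : int) :
  (forall k, (1 < absz (k - c))%N -> f k = 0) -> isum f = f (c - 1) + f c + f (c + 1).
Proof.
move=> h; rewrite -(isum_shift _ c) (@isumE _ 1); last first.
  by move=> k hk; apply: h; rewrite addrK.
rewrite !big_ord_recl big_ord0 /pos /= addr0 addrA.
by congr (_ + _ + _); congr f; rewrite ?lift0 /= /bump ?leq0n; ilia.
Qed.

Lemma sum_ext (f : I -> R[i]) : \sum_(j \in [set: I]) f j = isum (ext f).
Proof.
rewrite /isum -(@fsbig_widen _ _ _ _ (emb @` [set: I])) //; last first.
  move=> k [_ nk] /=; apply: ext_supp; apply/negP => /domP[i hi].
  by apply: nk; exists i.
rewrite fsbig_image; last by move=> i j _ _; exact: emb_inj.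
by apply: eq_fsbigr => i _; rewrite ext_emb.
Qed.

(** Rows of [J] outside the image of [emb], and entries pointing out of it, are left free; [cut]
    removes them in [ext_matop]. *)
Definition repr J A := forall i j,
  [/\ emb i = emb j + 1 -> A i j = lo J (emb i), emb i = emb j -> A i j = di J (emb i),
      emb j = emb i + 1 -> A i j = up J (emb i) & 1 < `|emb i - emb j| -> A i j = 0].

Lemma matop_op J A x i : repr J A -> matop A x i = op J (ext x) (emb i).
Proof.
move=> hA; rewrite /matop sum_ext (@isum3 _ (emb i)); last first.
  move=> k hk; have [/domP[j e]|nk] := boolP (dom k); last exact: ext_supp.
  rewrite -e ext_emb; have [_ _ _ ->] := hA i j; first by rewrite mul0r.
  by rewrite distrC e; ilia.
have term k b : (forall j, emb j = k -> A i j = b) ->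
    ext (fun j => A i j * x j) k = b * ext x k.
  move=> h; have [/domP[j e]|nk] := boolP (dom k); last by rewrite !ext_supp ?mulr0.
  by rewrite -e !ext_emb h.
rewrite /op (term _ (lo J (emb i))) => [|j e]; last first.
  by have [h _ _ _] := hA i j; apply: h; rewrite e subrK.
rewrite (term _ (di J (emb i))) => [|j e]; last first.
  by have [_ h _ _] := hA i j; apply: h.
rewrite (term _ (up J (emb i))) => // j e.
by have [_ _ h _] := hA i j; apply: h.
Qed.

(** The free entries of [J] are filled with fixed elements of [U], [V] and [W], which keeps [J] in
    the class; this is where nonemptiness enters. *)
Lemma ex_repr U V W A : U !=set0 -> V !=set0 -> W !=set0 ->
  tridiagonal emb U V W A -> exists2 J, cls U V W J & repr J A.
Proof.
move=> [u Uu] [v Vv] [w Ww] hA.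
pose ent i k d := if inv k is Some j then A i j else d.
pose J : jac R := fun k => if inv k is Some i then
  (ent i (k - 1) u, ent i k v, ent i (k + 1) w) else (u, v, w).
have entE i k d j : emb j = k -> ent i k d = A i j by move=> <-; rewrite /ent embK.
exists J => [k|i j].
  rewrite /lo /di /up /J; case e : (inv k) => [i|]//=; have ei := invK e.
  rewrite /ent; split.
  - by case e' : (inv _) => [j|]//; have ej := invK e'; have [h _ _ _] := hA i j;
      apply: h; rewrite ei ej subrK.
  - by rewrite e; have [_ h _ _] := hA i i; apply: h.
  - by case e' : (inv _) => [j|]//; have ej := invK e'; have [_ _ h _] := hA i j;
      apply: h; rewrite ei ej.
rewrite /lo /di /up /J embK /=; split => h.
- by rewrite (entE _ _ _ j)// h addrK.
- by rewrite (entE _ _ _ j).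
- by rewrite (entE _ _ _ j).
- by have [_ _ _] := hA i j; exact.
Qed.

Lemma ex_mat U V W J : cls U V W J -> exists2 A, tridiagonal emb U V W A & repr J A.
Proof.
move=> hJ; pose A i j := if emb i == emb j + 1 then lo J (emb i) else
  if emb i == emb j then di J (emb i) else if emb j == emb i + 1 then up J (emb i) else 0.
have h : repr J A.
  move=> i j; rewrite /A; split => e.
  - by rewrite e eqxx.
  - have -> : (emb i == emb j + 1) = false by apply/negbTE; ilia.
    by rewrite e eqxx.
  - have -> : (emb i == emb j + 1) = false by apply/negbTE; ilia.
    have -> : (emb i == emb j) = false by apply/negbTE; ilia.
    by rewrite e eqxx.
  - have -> : (emb i == emb j + 1) = false by apply/negbTE; ilia.
    have -> : (emb i == emb j) = false by apply/negbTE; ilia.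
    by have -> : (emb j == emb i + 1) = false by apply/negbTE; ilia.
exists A => // i j; have [h1 h2 h3 h4] := h i j; have [u v w] := hJ (emb i).
by split => e; [rewrite h1|rewrite h2|rewrite h3|exact: h4].
Qed.

End Embedding.

Section Invertibility.
Context {R : realType}.
Implicit Types (y z : int -> R[i]) (J : jac R).

Lemma lb_uniq J C z z' X X' : lb J C -> bnd z X -> bnd z' X' ->
  (forall i, op J z i = op J z' i) -> z = z'.
Proof.
move=> hl hz hz' h; apply/funext => i; apply/eqP; rewrite -subr_eq0; apply/eqP.
apply: nc_le0; rewrite -(mulr0 C).
apply: (hl (fun i => z i - z' i) (X + X') 0) => j.
  by rewrite (le_trans (ncB _ _))// lerD.
by rewrite opB h subrr nc0.
Qed.

Lemma ex_solver K C J : 0 < C -> bdd K J -> lb (tr J) C ->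
  exists S : (int -> R[i]) -> int -> R[i], forall y Y, bnd y Y ->
    (exists X, bnd (S y) X) /\ forall i, op J (S y) i = y i.
Proof.
move=> C0 hJ hC; have [C' [t [_ _ h]]] := solve C0 hJ hC.
have /choice[S hS] : forall y, exists z, forall Y, bnd y Y ->
    (exists X, bnd z X) /\ forall i, op J z i = y i.
  move=> y; have [[Y hY]|hn] := pselect (exists Y, bnd y Y); last first.
    by exists y => Y hY; case: hn; exists Y.
  by have [z [h1 h2 _]] := h y Y hY; exists z.
by exists S.
Qed.

Lemma ex_rate1 (K C : R) : 0 <= C -> 0 <= K ->
  exists2 s : R, 1 < s & 4 * C * K * (s - 1) <= 1.
Proof.
move=> C0 K0; have [s s1 hs] := ex_rate (mulr_ge0 (mulr_ge0 (ler0n R 4) C0) K0).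
exists s => //; apply: le_trans hs; rewrite ler_wpM2l ?mulr_ge0// lerD2r.
by rewrite expr2 ler_peMl// ltW// (lt_trans _ s1).
Qed.

Lemma lb_lple (K C : R) : 0 < C -> 0 <= K -> exists2 K' : R, 0 <= K' &
  forall p J z X M, (1 <= p)%E -> bdd K J -> lb J C -> bnd z X -> 0 <= M ->
    lple p (op J z) M -> lple p z (K' * M).
Proof.
move=> C0 K0; have [s s1 hs] := ex_rate1 (ltW C0) K0.
have s0 : 0 < s by exact: lt_trans ltr01 s1.
exists (2 * (2 * C) * (2 * (1 - s^-1)^-1)).
  by rewrite !mulr_ge0 ?(ltW C0)// invr_ge0 subr_ge0 invf_le1// ltW.
move=> p J z X M p1 hJ hl hz M0 h.
apply: (localized_lple p1 _ s1 M0 _ h); first by rewrite mulr_gt0.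
exact: lb_localized hJ hl (ltW C0) (ltW s1) hs hz.
Qed.

Lemma op_lple p J K z M : (1 <= p)%E -> bdd K J -> 0 <= M ->
  lple p z M -> lple p (op J z) (3 * K * M).
Proof.
move=> p1 hJ M0 hz; have K0 := bdd_ge0 hJ.
have KM : 0 <= K * M by rewrite mulr_ge0.
have h1 k b : (forall i, nc (b i) <= K) -> lple p (fun i : int => b i * z (i + k)) (K * M).
  by move=> hb; apply: lpleZ (lple_shift k p1 M0 hz) => // i; rewrite ncM ler_wpM2r ?nc_ge0.
have h2 : lple p (fun i => di J i * z i) (K * M).
  by apply: lpleZ hz => // i; rewrite ncM ler_wpM2r ?nc_ge0//; have [] := hJ i.
have hlo := h1 (-1) (lo J) (fun i => let: And3 a _ _ := hJ i in a).
have hup := h1 1 (up J) (fun i => let: And3 _ _ a := hJ i in a).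
have := minkowski p1 (addr_ge0 KM KM) KM (minkowski p1 KM KM hlo h2) hup.
by rewrite (_ : K * M + K * M + K * M = 3 * K * M)//; ring.
Qed.

End Invertibility.

Section EmbeddedInverse.
Context {R : realType} {I : choiceType} (emb : I -> int) (inv : int -> option I).
Context (embK : forall i, inv (emb i) = Some i).
Context (invK : forall k i, inv k = Some i -> emb i = k).
Implicit Types (p : \bar R) (x y : I -> R[i]) (z : int -> R[i]) (J : jac R).
Implicit Types (A : I -> I -> R[i]).

Local Notation extI := (ext inv).
Local Notation resI := (res emb).
Local Notation domI := (@dom I inv).
Local Notation reprI := (repr emb).

Lemma ext_matop J A x k : reprI J A -> extI (matop A x) k = op (cut domI J) (extI x) k.
Proof.
move=> hA; rewrite op_cut_supp; last exact: ext_supp.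
case: ifPn => [/(domP invK)[i <-]|nk]; last exact: ext_supp.
by rewrite (ext_emb embK) (matop_op embK invK _ _ hA).
Qed.

Lemma matop_bound p J A K x M : (1 <= p)%E -> reprI J A -> bdd K J -> 0 <= M ->
  lple p x M -> lple p (matop A x) (3 * K * M).
Proof.
move=> p1 hA hJ M0 hx; have K0 := bdd_ge0 hJ.
have hz := (lple_ext embK invK x p1 M0).2 hx.
apply/(lple_ext embK invK) => //; first by rewrite !mulr_ge0.
apply: (lple_mono p1 _ (op_lple p1 hJ M0 hz)) => k.
rewrite (ext_matop _ _ hA) op_cut_supp; last exact: ext_supp.
by case: ifP => // _; rewrite nc0 nc_ge0.
Qed.

(** One operator [T] serves all [p]. The bound for the transpose provides bounded solutions, the
    bound for the operator makes them unique, hence linear in the right-hand side, and [lb_lple]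
    estimates them in every l^p with the same constant. *)
Lemma ex_inverse (K C : R) : 0 < C -> 0 <= K -> exists2 K' : R, 0 <= K' &
  forall J A, reprI J A -> bdd K J -> lb (cut domI J) C -> lb (tr (cut domI J)) C ->
  exists T, forall p, (1 <= p)%E -> inverse_on p A T /\ (opnorm p T <= K'%:E)%E.
Proof.
move=> C0 K0; have [K' K'0 hK'] := lb_lple C0 (addr_ge0 K0 ler01).
exists K' => // J A hA hJ hl hlt.
have hJ' := cut_bdd domI hJ.
have [S hS] := ex_solver C0 hJ' hlt.
exists (fun x => resI (S (extI x))) => p p1.
have Sb x : lp p x -> exists X, bnd (S (extI x)) X.
  by move=> /(lp_bnd embK invK p1)[X hX]; have [] := hS _ _ hX.
have Se x : lp p x -> forall k, op (cut domI J) (S (extI x)) k = extI x k.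
  by move=> /(lp_bnd embK invK p1)[X hX]; have [] := hS _ _ hX.
(* Outside the domain [cut] is the identity, so the solution vanishes there together with the
   right-hand side. *)
have Ss x : lp p x -> supp domI (S (extI x)).
  by move=> hx k nk; have := Se x hx k; rewrite op_cut (negbTE nk) ext_supp.
have eS x : lp p x -> extI (resI (S (extI x))) = S (extI x).
  by move=> hx; apply: (res_ext embK invK); exact: Ss.
have bT x M : 0 <= M -> lple p x M -> lple p (resI (S (extI x))) (K' * M).
  move=> M0 hx; have lx : lp p x by exact: lple_lp hx.
  apply/(lple_ext embK invK) => //; first by rewrite mulr_ge0.
  rewrite eS//; have [X hX] := Sb x lx.
  apply: (hK' p _ _ X M p1 hJ' hl hX M0).
  by rewrite (funext (Se x lx)); apply/(lple_ext embK invK).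
have nT : (opnorm p (fun x => resI (S (extI x))) <= K'%:E)%E.
  by apply: opnorm_leP => // x hx; have := bT x 1 ler01 hx; rewrite mulr1.
split => //; split; last first.
  move=> x hx; split.
    apply/funext => i; rewrite (matop_op embK invK _ _ hA) eS//.
    have := Se x hx (emb i); rewrite op_cut (dom_emb embK) mask_supp ?(ext_emb embK)//.
    exact: Ss.
  have [M M0 hM] := lpnorm_fin p1 hx.
  have lA : lp p (matop A x).
    apply: (@lple_lp _ _ _ _ (3 * K * M)) => //; first by rewrite !mulr_ge0.
    exact: matop_bound hM.
  rewrite -[RHS](ext_res embK); congr resI.
  have [X hX] := Sb _ lA; have [X' hX'] := lp_bnd embK invK p1 hx.
  apply: (lb_uniq hl hX hX') => k; rewrite Se// (ext_matop _ _ hA)//.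
split.
- move=> x /(lpnorm_fin p1)[M M0 hM].
  by apply: lple_lp (bT x M M0 hM) => //; rewrite mulr_ge0.
- move=> a x y hx hy.
  have hxy := lp_lin a p1 hx hy.
  have [X hX] := Sb _ hx; have [Y hY] := Sb _ hy; have [Z hZ] := Sb _ hxy.
  have -> : S (extI (fun i => a * x i + y i)) =
      (fun k => a * S (extI x) k + S (extI y) k).
    apply: (lb_uniq hl hZ (X' := nc a * X + Y)) => k.
      by rewrite (le_trans (ncD _ _))// lerD// ncM ler_wpM2l ?nc_ge0.
    rewrite op_lin !Se// /ext; case: (inv k) => //; by rewrite mulr0 addr0.
  by [].
- by apply: le_lt_trans nT _; rewrite ltry.
Qed.

Lemma inverse_lple p A T x M (N : R) : (1 <= p)%E -> inverse_on p A T ->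
  (opnorm p T <= N%:E)%E -> 0 <= N -> 0 <= M -> lp p x -> lple p (matop A x) M ->
  lple p x (N * M).
Proof.
move=> p1 [bT hT] hN N0 M0 hx hM.
have [_ <-] := hT x hx; exact: opnorm_lple hM.
Qed.

End EmbeddedInverse.

(** * Finite sections *)

Section Convergence.
Context {R : realType}.

Lemma cvge0 (u : nat -> \bar R) : (forall n, (0 <= u n)%E) ->
  (forall e : R, 0 < e -> exists N : nat, forall n, (N <= n)%N -> (u n <= e%:E)%E) ->
  u n @[n --> \oo] --> 0%E.
Proof.
move=> u0 h; apply/fine_cvgP; split.
  have [N hN] := h 1 ltr01; exists N => // n /= /hN hn.
  by rewrite ge0_fin_numE// (le_lt_trans hn)// ltry.
apply/cvgrPdist_le => e e0; have [N hN] := h e e0; exists N => // n /= /hN hn.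
rewrite sub0r normrN ger0_norm ?fine_ge0//.
by rewrite -lee_fin fineK// ge0_fin_numE// (le_lt_trans hn)// ltry.
Qed.

(** A finite set on which the partial sum almost reaches the supremum leaves less than [e ^ r] for
    every set disjoint from it. *)
Lemma lple_tail (r : R) (z : int -> R[i]) M : 1 <= r -> lple r%:E z M ->
  forall e : R, 0 < e -> exists N : nat, forall (D : pred int),
    (forall k, (`|k| < N)%N -> ~~ D k) -> lple r%:E (mask D z) e.
Proof.
move=> r1 hz e e0; have r0 : 0 < r by exact: lt_le_trans r1.
pose S s := \sum_(i <- s) nc (z i) `^ r.
pose A := [set a : R | exists2 s : seq int, uniq s & a = S s].
have hA : has_sup A.
  split; first by exists (S [::]), [::].
  by exists (M `^ r) => _ [s us ->]; exact: hz.
have er : 0 < e `^ r by rewrite powR_gt0.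
have [_ [s us ->] hs] := sup_adherent er hA.
exists (\max_(i <- s) absz i).+1 => D hD t ut.
rewrite (bigID D) /= [X in _ + X]big1 ?addr0 => [|k /negbTE Dk]; last first.
  by rewrite /mask Dk nc0 powR0// gt_eqF.
rewrite (eq_bigr (fun k => nc (z k) `^ r)) => [|k Dk]; last by rewrite /mask Dk.
rewrite -big_filter; set t' := [seq k <- t | D k].
have u' : uniq (s ++ t').
  rewrite cat_uniq us filter_uniq// andbT; apply/hasPn => k.
  rewrite mem_filter => /andP[Dk _]; apply/negP => ks.
  have := hD k; rewrite ltnS (leq_bigmax_seq k)// => /(_ isT).
  by rewrite Dk.
have : S (s ++ t') <= sup A by apply: ub_le_sup; [exact: hA.2|exists (s ++ t')].
by rewrite /S big_cat /= -/(S s) => h; move: hs h; lra.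
Qed.

End Convergence.

Section FiniteSectionMethod.
Context {R : realType} {I : choiceType} (emb : I -> int) (inv : int -> option I).
Context (embK : forall i, inv (emb i) = Some i).
Context (invK : forall k i, inv k = Some i -> emb i = k).
Implicit Types (p : \bar R) (x y b : I -> R[i]) (z : int -> R[i]) (J : jac R).
Implicit Types (A : I -> I -> R[i]).

Local Notation extI := (ext inv).
Local Notation domI := (@dom I inv).

Context (K C : R) (C0 : 0 < C) (J : jac R) (A : I -> I -> R[i]).
Context (hA : repr emb J A) (hJ : bdd K J).

Lemma truncatedP (D : set I) (E : pred int) b x : (forall i, D i <-> E (emb i)) ->
  (forall k, E k -> domI k) ->
  truncated_solution A D b x <->
  supp E (extI x) /\ forall k, op (cut E J) (extI x) k = mask E (extI b) k.
Proof.
move=> DE Ed.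
have sE : (forall i, ~ D i -> x i = 0) <-> supp E (extI x).
  split=> [h k nE|h i nD].
    have [/(domP invK)[i e]|nk] := boolP (domI k); last exact: ext_supp.
    rewrite -e (ext_emb embK); apply: h => /DE; rewrite e => Ek.
    by rewrite Ek in nE.
  rewrite -(ext_emb embK x) h//; apply/negP => /DE; exact: nD.
have hs i : (forall i, ~ D i -> x i = 0) -> \sum_(j \in D) A i j * x j = op J (extI x) (emb i).
  move=> h; rewrite -(matop_op embK invK _ _ hA) /matop.
  by apply: fsbig_widen => // j [_ nD] /=; rewrite h// mulr0.
split=> [[h1 h2]|[h1 h2]].
  have h1' := sE.1 h1; split => // k; rewrite op_cut_supp// /mask.
  case: ifPn => // Ek; have [i e] := domP invK (Ed k Ek).
  by rewrite -e -hs// (ext_emb embK); apply: h2; apply/DE; rewrite e.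
have h1' := sE.2 h1; split => // i Di; rewrite hs//.
have := h2 (emb i); rewrite op_cut_supp// /mask.
by have -> := (DE i).1 Di; rewrite (ext_emb embK).
Qed.

Context (Dn : nat -> set I) (En : nat -> pred int).
Context (hDE : forall n i, Dn n i <-> En n (emb i)).
Context (hEd : forall n k, En n k -> domI k).
Context (hEn : forall n k, domI k -> (`|k| < n)%N -> En n k).
Context (hEf : forall n k, En n k -> (`|k| <= n)%N).
Context (hl : lb (cut domI J) C) (hlt : lb (tr (cut domI J)) C).
Context (hln : forall n, lb (cut (En n) J) C).
Context (hlnt : forall n, lb (tr (cut (En n) J)) C).

Lemma truncated_exists p n b : (1 <= p)%E -> lp p b ->
  exists! x, truncated_solution A (Dn n) b x.
Proof.
move=> p1 hb; have [B hB] := lp_bnd embK invK p1 hb.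
have [S hS] := ex_solver C0 (cut_bdd (En n) hJ) (@hlnt n).
have [[X hX] hop] := hS _ _ (mask_bnd (En n) hB).
set z := S _ in hX hop.
have sz : supp (En n) z.
  by move=> k nE; have := hop k; rewrite op_cut (negbTE nE) /mask (negbTE nE).
have ez : extI (res emb z) = z.
  apply: (res_ext embK invK) => k nd; apply: sz; apply/negP => /hEd.
  by rewrite (negbTE nd).
exists (res emb z); split.
  by apply/(truncatedP _ _ (hDE n) (@hEd n)); rewrite ez.
move=> x' /(truncatedP _ _ (hDE n) (@hEd n))[s' h'].
have fx : fs n (extI x').
  by move=> k hk; apply: s'; apply/negP => /hEf; rewrite leqNgt hk.
have [X' hX'] := fs_bnd fx.
rewrite -(ext_res embK (R := R) x'); congr (res emb).
by apply: (lb_uniq (@hln n) hX hX') => k; rewrite hop h'.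
Qed.

(** The approximate solution is compared with the cut-off exact solution: their difference [e] lives
    on the window, where [hln] applies, and its residual there is the image of the tail [w]. *)
Lemma truncated_error p n b x x' M : (1 <= p)%E -> lp p x -> matop A x = b ->
  truncated_solution A (Dn n) b x' ->
  let e k := extI x' k - mask (En n) (extI x) k in
  let w := mask (fun k => ~~ En n k) (extI x) in
  [/\ bnd (extI x) M -> exists X, bnd e X, forall k, extI x' k - extI x k = e k - w k &
   forall k, op (cut (En n) J) e k = mask (En n) (op J w) k].
Proof.
move=> p1 hx hb /(truncatedP _ _ (hDE n) (@hEd n))[s' h'] e w.
have fx : fs n (extI x').
  by move=> k hk; apply: s'; apply/negP => /hEf; rewrite leqNgt hk.
split.
- move=> hM; have [X' hX'] := fs_bnd fx; exists (X' + M) => k.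
  by rewrite (le_trans (ncB _ _))// lerD//; exact: mask_bnd.
- by move=> k; rewrite /e /w /mask; case: (En n k) => /=; ring.
- have se : supp (En n) e.
    by move=> k nE; rewrite /e s'// /mask (negbTE nE) subrr.
  move=> k; rewrite op_cut_supp// /mask; case: ifPn => // Ek.
  have hk := h' k; rewrite op_cut_supp// /mask Ek in hk.
  rewrite /e opB hk -hb (ext_matop embK invK _ _ hA) op_cut_supp; last exact: ext_supp.
  rewrite (hEd Ek) -opB; congr (op J _ k); apply/funext => j.
  by rewrite /w /mask; case: (En n j) => /=; rewrite ?subrr ?subr0.
Qed.

(** For finite [p] the tail of the exact solution is small in norm. For [p = +oo] it is merely far
    away, and [lb_localized] turns distance into smallness at each fixed coordinate. *)
Lemma fsm_of_lb p : (1 <= p)%E -> fsm_applies p A Dn.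
Proof.
move=> p1; have K0 := bdd_ge0 hJ.
have [K' K'0 hinv] := ex_inverse embK invK C0 K0.
split.
- by have [T hT] := hinv J A hA hJ hl hlt; exists T; have [] := hT p p1.
- by exists 0%N => // n _ b hb; exact: truncated_exists hb.
move=> b x xs hb hx hAx [N0 _ hN0].
have [X hX] := lp_bnd embK invK p1 hx; have X0 := bnd_ge0 hX.
have K1 : 0 <= K + 1 by rewrite addr_ge0.
have [e|[r e r1]] := ge1_cases p1; rewrite /approximates e; last first.
  have [L L0 hL] := lb_lple C0 K1.
  apply: cvge0 => [n|eps eps0]; first exact: poweR_ge0.
  have [M M0 hM] := lpnorm_fin p1 hx.
  have hM' := (lple_ext embK invK x p1 M0).2 hM; rewrite e in hM'.
  (* The error is at most [L * (3 * K)] times the norm of the tail, from [er], plus the tail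
     itself. *)
  pose q := L * (3 * K) + 1.
  have q0 : 0 < q by rewrite ltr_wpDl// !mulr_ge0.
  have [N hN] := lple_tail r1 hM' (divr_gt0 eps0 q0).
  exists (maxn N N0) => n; rewrite geq_max => /andP[nN nN0].
  have ht := hN0 n nN0.
  pose er k := extI (xs n) k - mask (En n) (extI x) k.
  pose w := mask (fun k => ~~ En n k) (extI x).
  have [[Xe hXe] h2 h3] : [/\ exists X, bnd er X,
      forall k, extI (xs n) k - extI x k = er k - w k &
      forall k, op (cut (En n) J) er k = mask (En n) (op J w) k].
    by have [h1 h2 h3] := truncated_error X p1 hx hAx ht; split => //; exact: h1.
  have hw : lple p w (eps / q).
    have -> : w = mask (fun k => domI k && ~~ En n k) (extI x).
      apply/funext => k; rewrite /w /mask; case: (En n k) => /=; first by rewrite andbF.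
      by rewrite andbT; case: ifPn => // nd; exact: ext_supp.
    rewrite e; apply: hN => k hk; apply/negP => /andP[dk].
    by rewrite (hEn dk (leq_trans hk nN)).
  have eq0 : 0 <= eps / q by rewrite divr_ge0 ?ltW.
  have hop : lple p (op (cut (En n) J) er) (3 * K * (eps / q)).
    apply: lple_mono (op_lple p1 hJ eq0 hw) => // k; rewrite h3 /mask.
    by case: ifP => // _; rewrite nc0 nc_ge0.
  have ner : lple p er (L * (3 * K * (eps / q))).
    apply: (hL p _ _ _ _ p1 (cut_bdd (En n) hJ) (@hln n) hXe _ hop).
    by rewrite mulr_ge0// mulr_ge0.
  have nw' : lple p (fun k => - w k) (eps / q).
    by apply: lple_mono hw => // k; rewrite ncN.
  rewrite -e; apply/lpnorm_leP => //; first exact: ltW.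
  apply/(lple_ext embK invK) => //; first exact: ltW.
  have -> : eps = (L * (3 * K) + 1) * (eps / q).
    by rewrite -/q mulrC divfK// gt_eqF.
  rewrite mulrDl mul1r -(mulrA L).
  have Le : 0 <= L * (3 * K * (eps / q)) by rewrite mulr_ge0// mulr_ge0// mulr_ge0.
  apply: lple_mono (minkowski p1 Le eq0 ner nw') => // k.
  rewrite -h2 (_ : extI _ k = extI (xs n) k - extI x k)//.
  by rewrite /ext; case: (inv k) => // ; rewrite subrr.
have [B hB] := lp_bnd embK invK p1 hb.
have xsB n : (N0 <= n)%N -> bnd (extI (xs n)) (C * B).
  move=> /hN0/(truncatedP _ _ (hDE n) (@hEd n))[s' h'].
  have fx : fs n (extI (xs n)).
    by move=> k hk; apply: s'; apply/negP => /hEf; rewrite leqNgt hk.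
  have [X' hX'] := fs_bnd fx; apply: (@hln n _ _ _ hX') => k; rewrite h'.
  exact: (mask_bnd (En n) hB).
split.
  exists (C * B), N0 => // n /xsB h; have CB0 := bnd_ge0 h.
  apply: (@lpnorm_leP _ _ +oo%E (xs n) (C * B) (leey _) CB0).2.
  by apply/(lple_ext embK invK (p := +oo%E) (xs n) (leey _) CB0).
move=> j; set m := emb j.
have [s s1 hs] := ex_rate1 (ltW C0) K1; have s0 : 0 < s by exact: lt_trans s1.
(* The residual lives at |k| >= n - 1, hence at distance at least n - 1 - |m| from [m]; this
   explains the exponent [(absz m).+1]. *)
pose c := 2 * C * (3 * K * X) * s ^+ (absz m).+1.
have hc : (fun n => c * s^-1 ^+ n) n @[n --> \oo] --> (0 : R).
  rewrite -(mulr0 c); apply: cvgM; first exact: cvg_cst.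
  by apply: cvg_expr; rewrite ger0_norm ?invf_lt1// invr_ge0 ltW.
apply: (@squeeze_cvgr _ _ _ _ (fun=> 0) (fun n => c * s^-1 ^+ n)) => //; last exact: cvg_cst.
exists (maxn N0 (absz m).+1) => // n /=; rewrite geq_max => /andP[nN0 nm].
rewrite nc_ge0 /=.
pose er k := extI (xs n) k - mask (En n) (extI x) k.
pose w := mask (fun k => ~~ En n k) (extI x).
have [[Xe hXe] h2 h3] : [/\ exists X, bnd er X,
    forall k, extI (xs n) k - extI x k = er k - w k &
    forall k, op (cut (En n) J) er k = mask (En n) (op J w) k].
  by have [h1 h2 h3] := truncated_error X p1 hx hAx (hN0 n nN0); split => //; exact: h1.
have hw k : (`|k| < n)%N -> w k = 0.
  move=> hk; rewrite /w /mask; case: ifPn => // nE.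
  by apply: ext_supp; apply/negP => dk; rewrite (hEn dk hk) in nE.
have -> : xs n j - x j = er m by have := h2 m; rewrite !(ext_emb embK) hw// subr0.
apply: le_trans (lb_localized (cut_bdd (En n) hJ) (@hln n) (ltW C0) (ltW s1) hs hXe
  (d := 3 * K * X * s ^+ (absz m).+1 * s^-1 ^+ n) _) _; last first.
  by rewrite /c !mulrA.
move=> k; rewrite h3 /mask.
have rhs0 : 0 <= 3 * K * X * s ^+ `|m|.+1 / s ^+ n * s ^+ `|k - m|.
  by rewrite !mulr_ge0 ?invr_ge0 ?exprn_ge0 ?(ltW s0).
rewrite exprVn; case: ifP => _; last by rewrite nc0.
have [hk|hk] := ltnP `|k|.+1 n.
  by rewrite /op !hw ?mulr0 ?addr0 ?nc0//; ilia.
apply: le_trans (op_bnd hJ (mask_bnd (fun k => ~~ En n k) hX) k) _.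
set u := 3 * K * X; rewrite (_ : u * _ / _ * _ = u * (s ^+ `|m|.+1 * s ^+ `|k - m| / s ^+ n)); last by ring.
rewrite ler_peMr ?mulr_ge0// ler_pdivlMr ?exprn_gt0// mul1r -exprD.
by rewrite ler_weXn2l ?(ltW s1)//; ilia.
Qed.

End FiniteSectionMethod.

Section Instances.
Context {R : realType}.
Implicit Types (J : jac R) (p : \bar R) (U V W : set R[i]).

Definition inv_nat (k : int) : option nat := if k is Posz n then Some n else None.
Definition emb_ord n (i : 'I_n) : int := Posz i.
Definition inv_ord n (k : int) : option 'I_n := if k is Posz m then insub m else None.

Lemma inv_intK (k i : int) : Some k = Some i -> i = k. Proof. by case. Qed.

Lemma emb_natK n : inv_nat (Posz n) = Some n. Proof. by []. Qed.

Lemma inv_natK k n : inv_nat k = Some n -> Posz n = k.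
Proof. by case: k => // m [->]. Qed.

Lemma emb_ordK n (i : 'I_n) : inv_ord n (emb_ord i) = Some i.
Proof. by rewrite /inv_ord /emb_ord /= valK. Qed.

Lemma inv_ordK n k (i : 'I_n) : inv_ord n k = Some i -> emb_ord i = k.
Proof.
by case: k => // m /=; case: insubP => // j _ <- [->].
Qed.

Lemma cut_id J : cut (@dom int Some) J = J.
Proof. by apply/funext => k; rewrite /cut /dom /lo /di /up /=; case: (J k) => -[]. Qed.

Lemma dom_nat : dom inv_nat = NN.
Proof. by apply/funext => -[]. Qed.

Lemma dom_ord n : dom (inv_ord n) = FD n.
Proof.
apply/funext => -[m|m] //; rewrite /dom /inv_ord /FD.
case: insubP => [j h _|h]; rewrite [LHS]/=; apply/esym; [by apply/andP; split; ilia|by apply/negbTE; ilia].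
Qed.

Lemma matop_ord n (B : 'I_n -> 'I_n -> R[i]) (x : 'I_n -> R[i]) i :
  matop B x i = \sum_j B i j * x j.
Proof.
rewrite /matop [RHS](fsbig_seq _ _ (index_enum_uniq _)).
by apply: eq_fsbigl; apply/seteqP; split => j //= _; rewrite mem_index_enum.
Qed.

Lemma matop_invmx n (F : 'M[R[i]]_n) (y : 'I_n -> R[i]) : F \in unitmx ->
  matop F (matop (invmx F) y) = y.
Proof.
move=> uF; have h B (x : 'I_n -> R[i]) i :
    matop B x i = ((\matrix_(i, j) B i j) *m (\col_j x j)) i 0.
  by rewrite matop_ord mxE; apply: eq_bigr => j _; rewrite !mxE.
apply/funext => i; rewrite h.
have -> : \matrix_(i, j) F i j = F by apply/matrixP => a b; rewrite mxE.
have -> : \col_j matop (invmx F) y j = invmx F *m \col_j y j.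
  apply/colP => j; rewrite mxE h; congr ((_ *m _) j 0).
  by apply/matrixP => a b; rewrite mxE.
by rewrite mulKVmx// mxE.
Qed.

Lemma lp_ord p n (x : 'I_n -> R[i]) : (1 <= p)%E -> lp p x.
Proof.
move=> p1; have S0 : 0 <= \sum_j nc (x j) by rewrite sumr_ge0// => j _; exact: nc_ge0.
case: (ge1_cases p1) => [->|[r -> r1]].
  apply: (lple_lp (leey _) S0) => //= i.
  by rewrite (bigD1 i)//= lerDl sumr_ge0// => j _; exact: nc_ge0.
have r0 : 0 < r by apply: lt_le_trans r1.
apply: (@lple_lp _ _ _ _ ((\sum_j nc (x j) `^ r) `^ r^-1)) => //.
  exact: powR_ge0.
move=> s us; rewrite -powRrM mulVf ?gt_eqF// powRr1; last first.
  by rewrite sumr_ge0// => j _; exact: powR_ge0.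
apply: sum_uniq_le => // [j _|j]; first by rewrite mem_index_enum.
exact: powR_ge0.
Qed.

Lemma matop_bounded p n (B : 'I_n -> 'I_n -> R[i]) (k : R) : (1 <= p)%E ->
  (opnorm p (matop B) <= k%:E)%E -> bounded_operator p (matop B).
Proof.
move=> p1 h; split.
- by move=> x _; exact: lp_ord.
- move=> a x y _ _; apply/funext => i; rewrite !matop_ord mulr_sumr -big_split.
  by apply: eq_bigr => j _ /=; ring.
- by rewrite (le_lt_trans h)// ltry.
Qed.

Lemma cut_itv J (a : int) n : cut (fun k => a <= k < a + n%:Z) J =
  sh (- a) (cut (FD n) (sh a J)).
Proof.
rewrite sh_cut (_ : sh (- a) (sh a J) = J); last first.
  by apply/funext => k; rewrite /sh subrK.
congr cut; apply/funext => k; rewrite /FD; ilia.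
Qed.

Lemma interval_lb_itv U V W C J (a : int) n : interval_lb U V W C -> cls U V W J ->
  lb (cut (fun k => a <= k < a + n%:Z) J) C.
Proof. by move=> h cJ; rewrite cut_itv; apply/lb_sh/h/cls_sh. Qed.

Lemma interval_lb_itv_tr U V W C J (a : int) n : interval_lb U V W C -> cls U V W J ->
  lb (tr (cut (fun k => a <= k < a + n%:Z) J)) C.
Proof.
move=> h cJ; rewrite cut_itv tr_sh; apply: lb_sh; exact: (interval_lb_tr h (cls_sh a cJ)).
Qed.

End Instances.

Section Consequences.
Context {R : realType} (U V W : set R[i]) (U0 : U !=set0) (V0 : V !=set0) (W0 : W !=set0).
Context (K : R) (K0 : 0 <= K) (hK : forall J, cls U V W J -> bdd K J).
Context (hK' : forall J, cls W V U J -> bdd K J).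
Implicit Types (J : jac R) (p : \bar R).

Lemma interval_lb_tr_halfline_lb C J : 0 <= C -> interval_lb U V W C -> cls U V W J -> lb (tr (cut NN J)) C.
Proof.
move=> C0 h cJ; rewrite tr_cut.
by apply: (interval_lb_halfline_lb hK' C0 (interval_lb_flip h)); exact: cls_tr.
Qed.

Lemma interval_lb_tr_line_lb C J : 0 <= C -> interval_lb U V W C -> cls U V W J -> lb (tr J) C.
Proof.
by move=> C0 h cJ; apply: (interval_lb_line_lb hK' C0 (interval_lb_flip h)); exact: cls_tr.
Qed.

Lemma interval_lb_inverse_plus C : 0 < C -> interval_lb U V W C -> exists2 k : R, 0 <= k &
  forall A, Mplus U V W A -> exists T, forall p, (1 <= p)%E ->
    inverse_on p A T /\ (opnorm p T <= k%:E)%E.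
Proof.
move=> C0 h; have [k k0 hk] := ex_inverse emb_natK inv_natK C0 K0.
exists k => // A hA; have [J cJ rJ] := ex_repr emb_natK inv_natK U0 V0 W0 hA.
apply: (hk J) => //; first exact: hK.
  by rewrite dom_nat; exact: (interval_lb_halfline_lb hK (ltW C0) h).
by rewrite dom_nat; exact: (interval_lb_tr_halfline_lb (ltW C0) h).
Qed.

Lemma interval_lb_inverse_bi C : 0 < C -> interval_lb U V W C -> exists2 k : R, 0 <= k &
  forall A, Mbi U V W A -> exists T, forall p, (1 <= p)%E ->
    inverse_on p A T /\ (opnorm p T <= k%:E)%E.
Proof.
move=> C0 h; have [k k0 hk] := ex_inverse (fun i : int => erefl (Some i)) inv_intK C0 K0.
exists k => // A hA.
have [J cJ rJ] := ex_repr (fun i : int => erefl (Some i)) inv_intK U0 V0 W0 hA.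
apply: (hk J) => //; first exact: hK.
  by rewrite cut_id; exact: (interval_lb_line_lb hK (ltW C0) h).
by rewrite cut_id; exact: (interval_lb_tr_line_lb (ltW C0) h).
Qed.

Lemma interval_lb_fsm_plus C A p : 0 < C -> interval_lb U V W C -> Mplus U V W A -> (1 <= p)%E ->
  full_fsm_plus p A.
Proof.
move=> C0 h hA p1; have [J cJ rJ] := ex_repr emb_natK inv_natK U0 V0 W0 hA.
apply: (@fsm_of_lb _ _ _ _ emb_natK inv_natK K C C0 J A rJ (hK cJ) _
   (fun n => FD n)) => //.
- by move=> n k; rewrite dom_nat /FD /NN => /andP[].
- by move=> n k; rewrite dom_nat /NN /FD => h1 h2; ilia.
- by move=> n k; rewrite /FD; ilia.
- by rewrite dom_nat; exact: (interval_lb_halfline_lb hK (ltW C0) h).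
- by rewrite dom_nat; exact: (interval_lb_tr_halfline_lb (ltW C0) h).
- by move=> n; exact: h.
- by move=> n; exact: interval_lb_tr h _.
Qed.

Lemma interval_lb_fsm_bi C A p : 0 < C -> interval_lb U V W C -> Mbi U V W A -> (1 <= p)%E ->
  full_fsm p A.
Proof.
move=> C0 h hA p1.
have [J cJ rJ] := ex_repr (fun i : int => erefl (Some i)) inv_intK U0 V0 W0 hA.
pose E n : pred int := fun k => - n%:Z <= k < - n%:Z + (2 * n).+1%:Z.
have EE n k : E n k = (- n%:Z <= k <= n%:Z) by rewrite /E; ilia.
apply: (@fsm_of_lb _ _ _ _ (fun i : int => erefl (Some i)) inv_intK K C C0 J A rJ (hK cJ) _
   E) => //.
- by move=> n i /=; rewrite EE.
- by move=> n k _; rewrite EE; ilia.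
- by move=> n k; rewrite EE; ilia.
- by rewrite cut_id; exact: (interval_lb_line_lb hK (ltW C0) h).
- by rewrite cut_id; exact: (interval_lb_tr_line_lb (ltW C0) h).
- by move=> n; exact: interval_lb_itv h _.
- by move=> n; exact: interval_lb_itv_tr h _.
Qed.

Lemma interval_lb_unit C n (F : 'M[R[i]]_n) : 0 <= C -> interval_lb U V W C -> Mn U V W F -> F \in unitmx.
Proof.
move=> C0 h hF; have [J cJ rJ] := ex_repr (@emb_ordK n) (@inv_ordK n) U0 V0 W0 hF.
rewrite -unitmx_tr -row_free_unit; apply: inj_row_free => v hv.
pose x i := v 0 i.
have hx i : matop F x i = 0.
  rewrite matop_ord; transitivity ((v *m F^T) 0 i); last by rewrite hv mxE.
  by rewrite mxE; apply: eq_bigr => j _; rewrite mxE mulrC.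
have fx : fs n (ext (inv_ord n) x).
  move=> k hk; apply: ext_supp; rewrite dom_ord /FD; ilia.
have [X hX] := fs_bnd fx.
have e0 : bnd (op (cut (FD n) J) (ext (inv_ord n) x)) 0.
  move=> k; rewrite -dom_ord -(ext_matop (@emb_ordK n) (@inv_ordK n) _ _ rJ).
  by rewrite /ext; case: (inv_ord n k) => [i|]; rewrite ?hx nc0.
apply/rowP => i; rewrite mxE -/(x i) -(ext_emb (@emb_ordK n) x i); apply/nc_le0.
by have := h J n cJ _ _ _ hX e0 (emb_ord i); rewrite mulr0.
Qed.

Lemma interval_lb_finite C : 0 < C -> interval_lb U V W C -> exists2 k : R, 0 <= k &
  forall p n (F : 'M[R[i]]_n), (1 <= p)%E -> Mn U V W F ->
    F \in unitmx /\ (opnorm p (matop (invmx F)) <= k%:E)%E.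
Proof.
move=> C0 h; have [k k0 hk] := lb_lple C0 (addr_ge0 K0 ler01).
exists k => // p n F p1 hF.
have uF := interval_lb_unit (ltW C0) h hF; split => //.
have [J cJ rJ] := ex_repr (@emb_ordK n) (@inv_ordK n) U0 V0 W0 hF.
apply: opnorm_leP => // y hy; set x := matop _ y.
have hx : matop F x = y.
  exact: matop_invmx.
have fx : fs n (ext (inv_ord n) x).
  move=> l hl; apply: ext_supp; rewrite dom_ord /FD; ilia.
have [X hX] := fs_bnd fx.
apply/(lple_ext (@emb_ordK n) (@inv_ordK n)) => //.
rewrite -[k]mulr1; apply: (hk p (cut (FD n) J) _ X 1 p1 _ (h J n cJ) hX ler01).
  exact: (cut_bdd (FD n) (hK cJ)).
rewrite (_ : op _ _ = ext (inv_ord n) y); last first.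
  by apply/funext => l; rewrite -dom_ord -(ext_matop (@emb_ordK n) (@inv_ordK n) _ _ rJ) hx.
by apply/(lple_ext (@emb_ordK n) (@inv_ordK n)).
Qed.

(** Solving with the finite matrix of the transposed rows expresses [pr g y] by the residual of [g],
    which is a bound of the form [dual_lb p]. Then [dual_lb_lb] removes [p], so stability for one
    exponent gives it for all. *)
Lemma finite_interval_lb p : (1 <= p)%E -> finite_uniformly_invertible p U V W ->
  exists2 C : R, 0 < C & interval_lb U V W C.
Proof.
move=> p1 [hu [k0 hk0]]; pose k := `|k0|.
have hk n (F : 'M[R[i]]_n) : (0 < n)%N -> Mn U V W F -> (opnorm p (matop (invmx F)) <= k%:E)%E.
  by move=> n0 hF; apply: le_trans (hk0 n F n0 hF) _; rewrite lee_fin ler_norm.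
have k00 : 0 <= k by rewrite /k normr_ge0.
have [C C0 hC] := dual_lb_lb p1 k00 K0.
have C1 : 0 < Num.max 1 C by rewrite lt_max ltr01.
exists (Num.max 1 C) => //; apply: interval_lb_flip => J n cJ.
(* The hypothesis concerns [0 < n]; the compression to the empty interval is the identity, with
   constant 1. *)
have [->|n0] := posnP n.
  apply: (@lb_le _ _ 1); first by rewrite le_max lexx.
  move=> x X d hx hd i; rewrite mul1r; have := hd i.
  by rewrite op_cut ifF//; apply/negbTE; ilia.
apply: (@lb_le _ _ C); first by rewrite le_max lexx orbT.
apply: hC; first exact: hK'.
move=> N g M fg sg M0 hM y hy.
have [A hA rA] := ex_mat (@emb_ord n) (cls_tr cJ).
pose F : 'M[R[i]]_n := \matrix_(i, j) A i j.
have FA : fun_of_matrix F = A by apply/funext => i; apply/funext => j; rewrite mxE.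
have hF : Mn U V W F by rewrite /Mn /= FA.
have uF := hu n F n0 hF.
pose yI (i : 'I_n) := y (emb_ord i).
pose x := matop (invmx F) yI.
have hyI : lple p yI 1.
  have hm : lple p (mask (FD n) y) 1.
    by apply: lple_mono hy => // i; rewrite /mask; case: ifP => // _; rewrite nc0 nc_ge0.
  apply/(lple_ext (@emb_ordK n) (@inv_ordK n)) => //.
  apply: lple_mono hm => // l; rewrite /ext /mask /yI.
  case e : (inv_ord n l) => [i|]; last by rewrite nc0 nc_ge0.
  have el := inv_ordK e; rewrite el ifT//.
  by rewrite -dom_ord /dom e.
have hx : lple p x k.
  by rewrite -[k]mulr1; apply: opnorm_lple hyI => //;
    [exact: matop_bounded (hk n F n0 hF)|exact: hk].
have Fx i : matop F x i = yI i by rewrite /x matop_invmx.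
have hop l : FD n l -> op (tr J) (ext (inv_ord n) x) l = y l.
  rewrite -dom_ord => /(domP (@inv_ordK n))[i <-].
  by rewrite -(matop_op (@emb_ordK n) (@inv_ordK n) _ _ rA) -FA Fx.
have -> : pr g y = pr (mask (FD n) (op J g)) (ext (inv_ord n) x).
  transitivity (pr g (op (tr J) (ext (inv_ord n) x))).
    rewrite !(prE _ fg); apply: eq_bigr => a _.
    have [h|h] := boolP (FD n (pos N a)); first by rewrite hop.
    by rewrite sg// !mul0r.
  rewrite (pr_adj _ _ fg) trK /pr; congr isum; apply/funext => l.
  rewrite /mask; case: ifPn => // h; rewrite (_ : ext _ _ l = 0) ?mulr0 ?mul0r//.
  by apply: ext_supp; rewrite dom_ord.
rewrite mulrC.
apply: (dual_le_scale p1 (fs_mask _ (fs_op J fg)) hM k00).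
by apply/(lple_ext (@emb_ordK n) (@inv_ordK n)).
Qed.

End Consequences.

(** * Pseudoergodic operators *)

Section Ergodicity.
Context {R : realType}.
Implicit Types (J : jac R) (p : \bar R) (U V W : set R[i]).

(** Pseudoergodicity expressed by rows, with centred windows that lie in [D]. *)
Definition ergodic (D : pred int) J U V W := forall J' (L : nat) (e : R),
  cls U V W J' -> 0 < e -> exists k : int, forall i, (`|i| <= L)%N ->
    D (i + k) /\ close e (sh k J) J' i.

Section FromPseudoergodic.
Context {I : choiceType} (emb : I -> int) (inv : int -> option I).
Context (embK : forall i, inv (emb i) = Some i).
Context (invK : forall k i, inv k = Some i -> emb i = k).

Lemma entry_opnorm p n (B : 'I_n -> 'I_n -> R[i]) (e : R) i j : (1 <= p)%E ->
  (opnorm p (matop B) < e%:E)%E -> nc (B i j) <= e.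
Proof.
move=> p1 h; pose x (l : 'I_n) : R[i] := (l == j)%:R.
have hx : lple p x 1.
  apply/(lple_ext (@emb_ordK n) (@inv_ordK n)) => //.
  apply: lple_mono (lple_e (emb_ord j) p1) => // k; rewrite nc_e /ext.
  case e' : (inv_ord n k) => [l|]; last by rewrite nc0.
  rewrite -(inv_ordK e') /x; case: (eqVneq l j) => [->|]; rewrite ?eqxx ?nc1//= nc0.
  by case: (_ == _).
have e0 : 0 <= e.
  rewrite -lee_fin; apply: le_trans (ltW h).
  apply: le_trans (_ : (lpnorm p (matop B x) <= _)%E); last first.
    by apply: ereal_sup_ubound; exists x => //=; apply/lpnorm_leP.
  case: (ge1_cases p1) => [->|[r -> _]]; last exact: poweR_ge0.
  apply: le_trans (_ : ((nc (matop B x i))%:E <= _)%E); first by rewrite lee_fin nc_ge0.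
  by apply: ereal_sup_ubound; exists i.
have he : lple p (matop B x) e.
  apply/lpnorm_leP => //; apply: le_trans (ltW h).
  by apply: ereal_sup_ubound; exists x => //=; apply/lpnorm_leP.
have := lple_coord i p1 e0 he.
rewrite matop_ord (bigD1 j)//= /x eqxx mulr1 big1 ?addr0// => l lj.
by rewrite (negbTE lj) mulr0.
Qed.

Lemma pseudo_ergodic p U V W A J : (1 <= p)%E -> repr emb J A ->
  pseudoergodic emb p U V W A -> ergodic (@dom I inv) J U V W.
Proof.
move=> p1 hA hp J' L e cJ' e0.
(* The rows |i| <= L have entries in the columns |i| <= L + 1. *)
pose n := (2 * L).+3.
have [B0 hB rB] := ex_mat (@emb_ord n) (cls_sh (- L.+1%:Z) cJ').
pose B : 'M[R[i]]_n := \matrix_(i, j) B0 i j.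
have BB : fun_of_matrix B = B0 by apply/funext => i; apply/funext => j; rewrite mxE.
have hB' : Mn U V W B by rewrite /Mn /= BB.
have [k [f [hf hop]]] := hp n B e isT hB' e0.
(* The centre of the pattern has index [L.+1], and [pseudoergodic] counts its rows from [k + 1]. *)
exists (k + L.+2%:Z) => i hi.
have ha : (absz (i + L.+1%:Z)%R < n)%N by rewrite /n; ilia.
have hm : (absz (i + L%:Z)%R < n)%N by rewrite /n; ilia.
have hq : (absz (i + L.+2%:Z)%R < n)%N by rewrite /n; ilia.
pose a := Ordinal ha; pose am := Ordinal hm; pose ap := Ordinal hq.
have ea : emb_ord a = i + L.+1%:Z by rewrite /emb_ord /=; ilia.
have eam : emb_ord am = i + L%:Z by rewrite /emb_ord /=; ilia.
have eap : emb_ord ap = i + L.+2%:Z by rewrite /emb_ord /=; ilia.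
have efa : emb (f a) = i + (k + L.+2%:Z) by rewrite hf /=; ilia.
have efm : emb (f am) = i + (k + L.+2%:Z) - 1 by rewrite hf /=; ilia.
have efp : emb (f ap) = i + (k + L.+2%:Z) + 1 by rewrite hf /=; ilia.
have hent b : nc (B0 a b - A (f a) (f b)) <= e.
  by have := entry_opnorm a b p1 hop; rewrite mxE.
split; first by rewrite -efa dom_emb.
have shE (g : jac R -> int -> R[i]) (gE : forall J k l, g (sh k J) l = g J (l + k)) b :
    B0 a b = g (sh (- L.+1%:Z) J') (emb_ord a) -> A (f a) (f b) = g J (emb (f a)) ->
    nc (g (sh (k + L.+2%:Z) J) i - g J' i) <= e.
  move=> h1 h2; have := hent b; rewrite h1 h2 !gE ea addrK efa => h.
  by rewrite ncBC.
split.
- apply: (shE lo (fun _ _ _ => erefl) am); [have [h _ _ _] := rB a am|have [h _ _ _] := hA (f a) (f am)].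
    by apply: h; rewrite ea eam; ilia.
  by apply: h; rewrite efa efm subrK.
- apply: (shE di (fun _ _ _ => erefl) a); [have [_ h _ _] := rB a a|have [_ h _ _] := hA (f a) (f a)];
    exact: h.
- apply: (shE up (fun _ _ _ => erefl) ap); [have [_ _ h _] := rB a ap|have [_ _ h _] := hA (f a) (f ap)].
    by apply: h; rewrite ea eap; ilia.
  by apply: h; rewrite efa efp.
Qed.

End FromPseudoergodic.

Definition universal J U V W := forall J' (n : nat) (e : R), cls U V W J' -> 0 < e ->
  exists k : nat, forall i : nat, (i < n)%N -> close e (sh k%:Z J) J' i%:Z.

Lemma universal_pseudoergodic (I : choiceType) (emb : I -> int) (f : nat -> I) p U V W A J :
  (1 <= p)%E -> U !=set0 -> V !=set0 -> W !=set0 -> (forall m, emb (f m) = m%:Z) ->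
  repr emb J A -> universal J U V W -> pseudoergodic emb p U V W A.
Proof.
move=> p1 U0 V0 W0 hf hA hu n B eps n0 hB eps0.
have [J' cJ' rB] := ex_repr (@emb_ordK n) (@inv_ordK n) U0 V0 W0 hB.
(* Three diagonals with entries at most [eps / 4] have norm at most [3 * (eps / 4)], strictly below
   [eps]. *)
have e0 : 0 < eps / 4 by rewrite divr_gt0.
have [k hk] := hu J' n _ cJ' e0.
exists (k%:Z - 1), (fun i => f (k + i)%N); split.
  by move=> i; rewrite hf PoszD subrK.
pose Jd : jac R := fun l => if FD n l then
  (lo J' l - lo J (l + k%:Z), di J' l - di J (l + k%:Z), up J' l - up J (l + k%:Z))
  else (0, 0, 0).
have bJ : bdd (eps / 4) Jd.
  move=> l; rewrite /lo /di /up /Jd; case: ifPn => h; last first.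
    by rewrite /= nc0; split; exact: ltW.
  have [m hm em] : exists2 m : nat, (m < n)%N & l = m%:Z.
    by exists (absz l); move: h; rewrite /FD; ilia.
  have [h1 h2 h3] := hk m hm; rewrite /= em; split; rewrite ncBC; [exact: h1|exact: h2|exact: h3].
have rD : repr (@emb_ord n) Jd (fun i j => B i j - A (f (k + i)%N) (f (k + j)%N)).
  move=> i j; rewrite /lo /di /up /Jd /emb_ord.
  have -> : FD n (Posz i) by rewrite /FD; have := ltn_ord i; ilia.
  have [b1 b2 b3 b4] := rB i j; have [a1 a2 a3 a4] := hA (f (k + i)%N) (f (k + j)%N).
  rewrite !hf (_ : Posz (k + i) = Posz i + k%:Z) in a1 a2 a3 a4; last by rewrite PoszD addrC.
  rewrite (_ : Posz (k + j) = Posz j + k%:Z) in a1 a2 a3 a4; last by rewrite PoszD addrC.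
  split => /= e.
  - by rewrite b1// a1// e addrAC.
  - by rewrite b2// a2// e.
  - by rewrite b3// a3// e addrAC.
  - by rewrite b4// a4 ?subrr// opprD addrACA subrr addr0.
apply: (@le_lt_trans _ _ (3 * (eps / 4))%:E); last by rewrite lte_fin; lra.
apply: opnorm_leP => //; first by rewrite mulr_ge0// ltW.
move=> x hx; have := matop_bound (@emb_ordK n) (@inv_ordK n) p1 rD bJ ler01 hx.
by rewrite mulr1.
Qed.

(** Subsets of a separable space are separable: for each ball with rational centre and radius
    1/(m+1) that meets [S], a point of [S] in it is chosen. *)
Lemma dense_seq (S : set R[i]) : S !=set0 -> exists2 u : nat -> R[i],
  forall n, S (u n) & forall x (e : R), S x -> 0 < e -> exists n, nc (u n - x) <= e.
Proof.
move=> [s0 Ss0].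
pose q (c : rat * rat) : R[i] := Complex (ratr c.1) (ratr c.2).
have /choice[u hu] : forall n : nat, exists z, S z /\
    forall c m, unpickle n = Some (c, m) -> (exists2 x, S x & nc (x - q c) <= m.+1%:R^-1) ->
      nc (z - q c) <= m.+1%:R^-1.
  move=> n; case e : (unpickle n : option ((rat * rat) * nat)) => [[c m]|]; last first.
    by exists s0.
  have [[x Sx hx]|h] := pselect (exists2 x, S x & nc (x - q c) <= m.+1%:R^-1).
    by exists x; split => // c' m' [<- <-].
  by exists s0; split => // c' m' [<- <-].
exists u => [n|x e Sx e0]; first by have [] := hu n.
pose m := Num.truncn (2 / e).
have hm : m.+1%:R^-1 <= e / 2.
  rewrite -[e / 2]invrK lef_pV2 ?posrE ?invr_gt0 ?divr_gt0// invf_div ltW//.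
  exact: Num.Theory.truncnS_gt.
have m0 : 0 < m.+1%:R^-1 :> R by rewrite invr_gt0.
have hr (t : R) : exists a : rat, `|t - ratr a| <= m.+1%:R^-1 / 2.
  have [|a ha] := @rat_in_itvoo R t (t + m.+1%:R^-1 / 2).
    by rewrite ltrDl divr_gt0.
  exists a; move: ha; rewrite in_itv /= => /andP[h1 h2].
  by rewrite distrC ger0_norm ?subr_ge0 ?(ltW h1)// lerBlDl ltW.
have [a ha] := hr (complex.Re x); have [b hb] := hr (complex.Im x).
have hx : nc (x - q (a, b)) <= m.+1%:R^-1.
  rewrite (_ : x - q (a, b) = (complex.Re x - ratr a)%:C%C + 'i%C * (complex.Im x - ratr b)%:C%C).
    rewrite (le_trans (ncD _ _))// ncM !nc_real [leRHS]splitr.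
    have -> : nc ('i%C : R[i]) = 1.
      by rewrite /ComplexField.Normc.normc /= expr0n /= add0r expr1n sqrtr1.
    by rewrite mul1r lerD.
  case: (x) => c d; apply/eqP; rewrite eq_complex /=.
  by rewrite !(mul0r, mul1r, add0r, addr0, subr0, mulr0) !eqxx.
exists (pickle ((a, b), m)).
have [_ /(_ (a, b) m)] := hu (pickle ((a, b), m)); rewrite pickleK.
move=> /(_ erefl (ex_intro2 _ _ x Sx hx)) h.
rewrite (_ : _ - x = (u (pickle ((a, b), m)) - q (a, b)) - (x - q (a, b))); last by ring.
rewrite (le_trans (ncB _ _))// [e]splitr lerD//; exact: le_trans hm.
Qed.

(* Concatenating all finite words over a dense sequence of rows. *)
Lemma ex_universal U V W : U !=set0 -> V !=set0 -> W !=set0 ->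
  exists2 J, cls U V W J & universal J U V W.
Proof.
move=> /dense_seq[u Su du] /dense_seq[v Sv dv] /dense_seq[w Sw dw].
pose t (c : nat * nat * nat) : R[i] * R[i] * R[i] := (u c.1.1, v c.1.2, w c.2).
(* The extra letter makes every word nonempty. Hence [pre n] has length at least [n], and reading
   position [k] in [pre k.+1] never falls off the end. *)
pose word (n : nat) : seq (nat * nat * nat) :=
  rcons (odflt [::] (unpickle n : option (seq (nat * nat * nat)))) (0, 0, 0)%N.
pose pre n := flatten [seq word k | k <- iota 0 n].
have preS n : pre n.+1 = pre n ++ word n.
  by rewrite /pre -addn1 iotaD map_cat flatten_cat /= cats0.
have size_pre n : (n <= size (pre n))%N.
  elim: n => // n IH; rewrite preS size_cat size_rcons addnS ltnS.
  exact: leq_trans IH (leq_addr _ _).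
have preD n m : exists s, pre (n + m)%N = pre n ++ s.
  elim: m => [|m [s IH]]; first by exists [::]; rewrite addn0 cats0.
  by exists (s ++ word (n + m)%N); rewrite addnS preS IH catA.
pose x0 := (0, 0, 0)%N : nat * nat * nat.
have nthp n i : (i < size (pre n))%N -> nth x0 (pre i.+1) i = nth x0 (pre n) i.
  move=> hi; have [h|h] := leqP n i.+1.
    by have [s e] := preD n (i.+1 - n)%N; rewrite subnKC// in e; rewrite e nth_cat hi.
  have [s e] := preD i.+1 (n - i.+1)%N; rewrite subnKC ?(ltnW h)// in e.
  by rewrite e nth_cat size_pre.
pose J : jac R := fun k => t (nth x0 (pre (absz k).+1) (absz k)).
exists J => [k|J' n e cJ' e0].
  by rewrite /lo /di /up /J /t /=.
have /choice[c hc] : forall i : nat, exists c, [/\ nc ((t c).1.1 - lo J' i%:Z) <= e,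
    nc ((t c).1.2 - di J' i%:Z) <= e & nc ((t c).2 - up J' i%:Z) <= e].
  move=> i; have [h1 h2 h3] := cJ' i%:Z.
  have [a ha] := du _ e h1 e0; have [b hb] := dv _ e h2 e0; have [d hd] := dw _ e h3 e0.
  by exists (a, b, d).
pose s := mkseq c n; pose m := pickle s.
have hm : word m = rcons s x0 by rewrite /word /m pickleK.
exists (size (pre m)) => i hi.
have -> : close e (sh (size (pre m))%:Z J) J' i%:Z =
   [/\ nc ((t (c i)).1.1 - lo J' i%:Z) <= e,
    nc ((t (c i)).1.2 - di J' i%:Z) <= e & nc ((t (c i)).2 - up J' i%:Z) <= e]; last exact: hc.
rewrite /close /lo /di /up /sh /J.
have -> : absz (i%:Z + (size (pre m))%:Z)%R = (size (pre m) + i)%N by ilia.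
rewrite (@nthp m.+1); last first.
  by rewrite preS size_cat hm size_rcons size_mkseq ltn_add2l ltnS ltnW.
rewrite preS nth_cat ltnNge leq_addr /= addKn hm nth_rcons size_mkseq hi.
by rewrite nth_mkseq.
Qed.

End Ergodicity.

Section DualRange.
Context {R : realType} {I : choiceType} (emb : I -> int) (inv : int -> option I).
Context (embK : forall i, inv (emb i) = Some i).
Context (invK : forall k i, inv k = Some i -> emb i = k).
Implicit Types (p : \bar R) (x y : I -> R[i]) (z : int -> R[i]) (J : jac R).

Lemma lp_res p (y : int -> R[i]) : (1 <= p)%E -> lp p y -> lp p (res emb y).
Proof.
move=> p1 /(lpnorm_fin p1)[M M0 hM]; apply: (lple_lp p1 M0).
apply/(lple_ext embK invK) => //; apply: lple_mono hM => // k; rewrite /ext /res.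
case e : (inv k) => [i|]; last by rewrite nc0 nc_ge0.
by rewrite (invK e).
Qed.

(** Every [y] is a sum of some [A x] and a combination of the [f k], so the functionals whose
    transposed residual and whose values on the [f k] are at most 1 are pointwise bounded. Uniform
    boundedness provides [M]; no closed range argument is involved. *)
Lemma dual_range p J A b : (1 <= p)%E -> repr emb J A ->
  quotient_dim (lp p) (matop A @` lp p) b ->
  exists f : 'I_b -> int -> R[i], exists2 M : R, 0 <= M &
    forall N (g : int -> R[i]), fs N g -> supp (dom inv) g ->
      dual_le p (mask (dom inv) (op (tr J) g)) 1 -> (forall k, nc (pr g (f k)) <= 1) -> dual_le p g M.
Proof.
move=> p1 hA [e [he hq]]; pose f k := ext inv (e k); exists f.
pose F : set (int -> R[i]) := [set g | exists N, [/\ fs N g, supp (dom inv) g,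
  dual_le p (mask (dom inv) (op (tr J) g)) 1 & forall k, nc (pr g (f k)) <= 1]].
have [||M M0 hM] := @uniform_boundedness R p F p1.
- by move=> g [N [h _ _ _]]; exists N.
- move=> y /(lp_res p1) ly; have [c [[x lx hx] _]] := hq _ ly.
  have [X X0 hX] := lpnorm_fin p1 lx.
  exists (X + \sum_k nc (c k)) => g [N [fg sg dg kg]].
  have -> : pr g y = pr (mask (dom inv) (op (tr J) g)) (ext inv x) +
      \sum_k c k * pr g (f k).
    transitivity (pr g (op J (ext inv x)) + \sum_k c k * pr g (f k)); last first.
      congr (_ + _); rewrite (pr_adj _ _ fg) /pr; congr isum; apply/funext => i.
      by rewrite /mask; case: ifPn => // h; rewrite (ext_supp x h) !mulr0.
    rewrite !(prE _ fg) (eq_bigr (fun k => \sum_(a < (2 * N).+1) c k * (g (pos N a) * f k (pos N a)))).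
      rewrite exchange_big -big_split; apply: eq_bigr => a _ /=.
      have [/(domP invK)[i ei]|nk] := boolP (dom inv (pos N a)); last first.
        by rewrite sg// !mul0r big1 ?addr0// => k _; rewrite mul0r mulr0.
      have /(congr1 (fun u => u i)) := hx.
      rewrite (matop_op embK invK _ _ hA) -ei => ->.
      rewrite mulrBr mulr_sumr -addrA [X in _ + X](_ : _ = 0) ?addr0// addrC -sumrB big1// => k _.
      by rewrite /f (ext_emb embK); ring.
    by move=> k _; rewrite (prE _ fg) mulr_sumr.
  rewrite (le_trans (ncD _ _))// lerD//.
    have := dual_le_scale p1 (fs_mask (dom inv) (fs_op (tr J) fg)) dg X0.
    by rewrite mul1r; apply; apply/(lple_ext embK invK).
  rewrite (le_trans (nc_sum _ _ _))// ler_sum// => k _.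
  by rewrite ncM ler_piMr ?nc_ge0.
- by exists M => // N g fg sg dg kg; apply: hM; exists N.
Qed.

End DualRange.

Section LowerBound.
Context {R : realType}.
Implicit Types (p : \bar R) (g y : int -> R[i]) (J : jac R) (U V W : set R[i]).

(** Dividing a linear relation by its coefficient of largest modulus makes that coefficient 1 and
    all others at most 1. *)
Lemma normalized_relation n (B : 'I_n.+1 -> 'I_n -> R[i]) : exists c : 'I_n.+1 -> R[i],
  [/\ exists t, c t = 1, forall t, nc (c t) <= 1 & forall k, \sum_t c t * B t k = 0].
Proof.
pose M := \matrix_(t, k) B t k.
have : kermx M != 0.
  rewrite -mxrank_eq0 mxrank_ker subn_eq0 -ltnNge ltnS; exact: rank_leq_col.
move=> /rowV0Pn[v /sub_kermxP vM v0].
have [t0 _ ht] : exists2 t0, true & forall t, nc (v 0 t) <= nc (v 0 t0).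
  case: (@arg_maxP _ R 'I_n.+1 ord0 predT (fun t => nc (v 0 t))) => // t0 _ h.
  by exists t0 => // t; exact: h.
have vt : v 0 t0 != 0.
  apply: contra v0 => /eqP h; apply/eqP/rowP => t; rewrite mxE; apply/nc_le0.
  by have := ht t; rewrite h nc0.
exists (fun t => v 0 t / v 0 t0); split.
- by exists t0; rewrite divff.
- by move=> t; rewrite ncM ncV ler_pdivrMr ?mul1r// nc_gt0.
- move=> k; transitivity ((v 0 t0)^-1 * (v *m M) 0 k); last by rewrite vM mxE mulr0.
  by rewrite mxE mulr_sumr; apply: eq_bigr => t _; rewrite mxE; ring.
Qed.

Lemma pr_sum n N (c : 'I_n -> R[i]) (F : 'I_n -> int -> R[i]) y : (forall t, fs N (F t)) ->
  pr (fun i => \sum_t c t * F t i) y = \sum_t c t * pr (F t) y.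
Proof.
move=> h; rewrite (@prE _ N); last first.
  by move=> i hi; rewrite big1// => t _; rewrite h// mulr0.
rewrite (eq_bigr (fun t => \sum_(a < (2 * N).+1) c t * (F t (pos N a) * y (pos N a)))).
  rewrite exchange_big; apply: eq_bigr => a _; rewrite mulr_suml.
  by apply: eq_bigr => t _; rewrite mulrA.
by move=> t _; rewrite (prE _ (h t)) mulr_sumr.
Qed.

Lemma op_diff e J J' (x : int -> R[i]) X i : close e J J' i -> bnd x X ->
  nc (op J x i - op J' x i) <= 3 * e * X.
Proof.
move=> [h1 h2 h3] hx.
rewrite (_ : _ - _ = (lo J i - lo J' i) * x (i - 1) + (di J i - di J' i) * x i +
  (up J i - up J' i) * x (i + 1)); last by rewrite /op; ring.
rewrite (_ : 3 * e * X = e * X + e * X + e * X); last by ring.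
rewrite (le_trans (ncD _ _))// lerD//; last by rewrite ncM ler_pM ?nc_ge0.
by rewrite (le_trans (ncD _ _))// lerD// ncM ler_pM ?nc_ge0.
Qed.

(* Copies of g are put at b.+1 places where J is close to J'; some combination of
   them annihilates the b functionals f k. *)
Lemma ergodic_dual_lb p J D U V W b (f : 'I_b -> int -> R[i]) (M : R) : (1 <= p)%E -> 0 <= M ->
  ergodic D J U V W ->
  (forall N g, fs N g -> supp D g -> dual_le p (mask D (op (tr J) g)) 1 ->
    (forall k, nc (pr g (f k)) <= 1) -> dual_le p g M) ->
  forall J', cls U V W J' -> dual_lb p predT (tr J') (M * b.+1%:R).
Proof.
move=> p1 M0 hJ hM J' cJ' N g m fg _ m0 hg y hy.
have hM' N' h s : 0 < s -> fs N' h -> supp D h -> dual_le p (mask D (op (tr J) h)) s ->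
    (forall k, pr h (f k) = 0) -> dual_le p h (M * s).
  move=> s0 fh sh dh kh; pose h' i := (s^-1)%:C%C * h i.
  have si : 0 <= s^-1 by rewrite invr_ge0 ltW.
  have nch' i : nc (h' i) = s^-1 * nc (h i) by rewrite /h' ncM nc_real ger0_norm.
  have fh' : fs N' h' by move=> i hi; rewrite /h' fh// mulr0.
  have d' : dual_le p h' M.
    apply: (hM N') => //.
    - by move=> i hi; rewrite /h' sh// mulr0.
    - have ss : s != 0 by rewrite gt_eqF.
      rewrite -(mulVf ss); apply: dleZ dh => //; first exact: fs_mask (fs_op _ fh).
      move=> i; rewrite /mask; case: ifP => _; last by rewrite nc0 mulr0.
      rewrite (_ : op _ h' i = (s^-1)%:C%C * op (tr J) h i); last by rewrite /op /h'; ring.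
      by rewrite ncM nc_real ger0_norm.
    - move=> k; have -> : pr h' (f k) = (s^-1)%:C%C * pr h (f k).
        rewrite (prE _ fh) (prE _ fh') mulr_sumr; apply: eq_bigr => a _.
        by rewrite /h' mulrA.
      by rewrite kh mulr0 nc0.
  rewrite mulrC; apply: dleZ d' => //; [exact: fh'|exact: ltW|].
  by move=> i; rewrite nch' mulrA mulfV ?mul1r// gt_eqF.
have [G hG] := fs_bnd fg.
have G0 : 0 <= G by apply: le_trans (hG 0); exact: nc_ge0.
apply/ler_addgt0Pr => e e0.
(* The residual of a copy of [g] depends on the rows |i| <= N + 2, that is on 2 N + 5 rows.
   Repeating them with period [P] in [J''] lets a single window of [J] supply all [b.+1] copies. *)
pose P := (2 * N + 5)%N; pose L := (b.+1 * P + P)%N.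
pose J'' : jac R := fun i => J' (((i + N.+2%:Z) %% P%:Z)%Z - N.+2%:Z).
have cJ'' : cls U V W J'' by move=> i; exact: cJ'.
pose q : R := (2 * N.+1).+1%:R * (3 * G).
have q0 : 0 <= q by rewrite !mulr_ge0.
pose r : R := M * b.+1%:R.
have r0 : 0 <= r by rewrite mulr_ge0.
(* Chosen so that the final error [r * (q * d + d)] equals [r * (e / (r + 1))], which is at most
   [e]. *)
pose d := e / (r + 1) / (q + 1).
have d0 : 0 < d by rewrite !divr_gt0// ltr_wpDl.
have [k hk] := hJ J'' L d cJ'' d0.
pose s (t : 'I_b.+1) : int := k + (t * P)%:Z.
pose gt (t : 'I_b.+1) i := g (i - s t).
have JE (t : 'I_b.+1) j : (`|j| <= N.+2)%N -> D (j + s t) /\ close d (sh (s t) J) J' j.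
  move=> hj.
  have tP : (t * P <= b * P)%N by rewrite leq_mul2r -ltnS ltn_ord orbT.
  have [|h1 h2] := hk (j + (t * P)%:Z); first by rewrite /L mulSn; move: (t * P)%N (b * P)%N tP => u v; rewrite /P; ilia.
  rewrite (_ : j + s t = j + (t * P)%:Z + k); last by rewrite /s; ring.
  split => //.
  have eJ : J'' (j + (t * P)%:Z) = J' j.
    rewrite /J'' (_ : j + (t * P)%:Z + N.+2%:Z = t%:Z * P%:Z + (j + N.+2%:Z)); last by rewrite PoszM; ring.
    rewrite modzMDl modz_small ?addrK//; rewrite /P; ilia.
  move: h2; rewrite /close /lo /di /up /sh eJ.
  by rewrite (_ : j + s t = j + (t * P)%:Z + k)// /s; ring.
pose N' := (N + absz k + b * P)%N.
have fgt t : fs N' (gt t).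
  move=> i hi; apply: fg; rewrite /s.
  have tP : (t * P <= b * P)%N by rewrite leq_mul2r -ltnS ltn_ord orbT.
  by move: hi; rewrite /N'; move: (t * P)%N (b * P)%N tP => u v; ilia.
have [c [[t0 c1] cle cB]] := normalized_relation (fun t l => pr (gt t) (f l)).
pose h i := \sum_t c t * gt t i.
have fh : fs N' h by move=> i hi; rewrite /h big1// => t _; rewrite fgt// mulr0.
have sgt t i : gt t i != 0 -> D i.
  move=> ne; have [|h1 _] := JE t (i - s t); last by rewrite subrK in h1.
  by rewrite leqNgt; apply: contra ne => h1; apply/eqP; rewrite /gt fg//; ilia.
have sh' : supp D h.
  move=> i Di; rewrite /h big1// => t _.
  have [->|/sgt h1] := eqVneq (gt t i) 0; first by rewrite mulr0.
  by rewrite h1 in Di.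
have dgt t : dual_le p (op (tr J) (gt t)) (m + q * d).
  rewrite (_ : op (tr J) (gt t) = (fun i => op (sh (s t) (tr J)) g (i + - s t))); last first.
    apply/funext => i; rewrite /op /sh /gt /lo /di /up subrK.
    by congr (_ * g _ + _ + _ * g _); ring.
  apply: dual_le_shift => //.
  pose df j := op (sh (s t) (tr J)) g j - op (tr J') g j.
  have fdf : fs N.+1 df by move=> i hi; rewrite /df !(fs_op _ fg)// subrr.
  rewrite (_ : op _ g = (fun j => op (tr J') g j + df j)); last first.
    by apply/funext => j; rewrite /df addrC subrK.
  apply: (dleD (fs_op _ fg) fdf) => //.
  move=> z hz; apply: le_trans (dual_le_sum p1 fdf hz) _.
  apply: (@le_trans _ _ (\sum_(a < (2 * N.+1).+1) 3 * d * G)); last first.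
    by rewrite sumr_const card_ord -mulr_natl /q le_eqVlt; apply/orP; left; apply/eqP; ring.
  apply: ler_sum => a _; apply: op_diff => //; rewrite -tr_sh.
  have ha := pos_le a.
  have hc j : (`|j| <= N.+2)%N -> close d (sh (s t) J) J' j by move=> /(JE t)[].
  have [_ _ h1] := hc (pos N.+1 a - 1) ltac:(ilia).
  have [_ h2 _] := hc (pos N.+1 a) ltac:(ilia).
  by have [h3 _ _] := hc (pos N.+1 a + 1) ltac:(ilia).
have dh : dual_le p (op (tr J) h) (b.+1%:R * (m + q * d)).
  have -> : op (tr J) h = (fun i => \sum_t c t * op (tr J) (gt t) i).
    by apply/funext => i; rewrite op_sum.
  move=> z hz; rewrite (@pr_sum _ N'.+1); last by move=> t; exact: fs_op.
  rewrite (le_trans (nc_sum _ _ _))//.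
  apply: (@le_trans _ _ (\sum_(t < b.+1) (m + q * d))); last first.
    by rewrite sumr_const card_ord [leRHS]mulr_natl.
  apply: ler_sum => t _; rewrite ncM -[leRHS]mul1r ler_pM ?nc_ge0 ?cle//; exact: dgt.
(* The additional [d] makes the bound positive, as the rescaling in [hM'] requires; [m] may be 0. *)
have mq : 0 < m + q * d + d by rewrite ltr_wpDl// addr_ge0// mulr_ge0// ltW.
have : dual_le p h (M * (b.+1%:R * (m + q * d + d))).
  apply: (hM' N') => //; first by rewrite mulr_gt0.
    move=> {}y {}hy; apply: le_trans (_ : b.+1%:R * (m + q * d) <= _); last first.
      by rewrite ler_pM2l// lerDl ltW.
    rewrite -[leRHS]mul1r; apply: (dleZ (fs_op (tr J) fh)) dh y hy => // i.
    by rewrite mul1r /mask; case: ifP => // _; rewrite nc0 nc_ge0.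
  by move=> l; rewrite (@pr_sum _ N').
(* The copies have disjoint supports and the coefficient of [gt t0] is 1, so [gt t0] is dominated by
   [h] entry by entry. *)
move=> dhh; have dg : dual_le p (gt t0) (M * (b.+1%:R * (m + q * d + d))).
  rewrite -[_ * _]mul1r; apply: (dleZ fh) dhh => // i; rewrite mul1r.
  have [->|ne] := eqVneq (gt t0 i) 0; first by rewrite nc0 nc_ge0.
  rewrite /h (bigD1 t0)//= c1 mul1r big1 ?addr0// => t tt0.
  rewrite (_ : gt t i = 0) ?mulr0// /gt fg//.
  have h1 : (`|i - s t0| <= N)%N by rewrite leqNgt; apply: contra ne => h1; apply/eqP; exact: fg.
  have : (t + 1 <= t0)%N || (t0 + 1 <= t)%N.
    by rewrite !addn1 -neq_ltn; apply: contra tt0 => /eqP/val_inj ->.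
  move=> h2; have {h2} : (t * P + P <= t0 * P)%N || (t0 * P + P <= t * P)%N.
    by case/orP: h2 => h2; apply/orP; [left|right]; rewrite -mulSnr -addn1 leq_mul2r h2 orbT.
  move: h1; rewrite /s; move: (t * P)%N (t0 * P)%N => u v; rewrite /P => h1 /orP[h2|h2]; ilia.
have := dual_le_shift (s t0) p1 dg hy.
rewrite (_ : (fun i => gt t0 (i + s t0)) = g); last first.
  by apply/funext => i; rewrite /gt addrK.
move=> /le_trans; apply; rewrite mulrA -/r -addrA mulrDr lerD2l.
have qd : q * d + d = e / (r + 1) by rewrite /d; field; rewrite !gt_eqF// ltr_wpDl.
by rewrite qd mulrCA -[leRHS]mulr1 ler_wpM2l ?(ltW e0)// ler_pdivrMr ?mul1r ?ltr_wpDl// lerDl.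
Qed.

End LowerBound.

(** * Fredholm indices *)

Section Quotients.
Context {R : realType} {I : choiceType}.
Implicit Types (X Y : set (I -> R[i])).

Definition subspace X :=
  X (fun=> 0) /\ forall a x y, X x -> X y -> X (fun i => a * x i + y i).

Lemma subspace_sum X n (c : 'I_n -> R[i]) (F : 'I_n -> I -> R[i]) : subspace X ->
  (forall k, X (F k)) -> X (fun i => \sum_k c k * F k i).
Proof.
move=> [X0 Xl]; elim: n c F => [|n IH] c F hF.
  by rewrite (_ : (fun i => _) = fun=> 0)//; apply/funext => i; rewrite big_ord0.
rewrite (_ : (fun i => _) = fun i => c ord0 * F ord0 i +
    \sum_k c (lift ord0 k) * F (lift ord0 k) i); last first.
  by apply/funext => i; rewrite big_ord_recl.
by apply: Xl => //; apply: (IH (fun k => c (lift ord0 k)) (fun k => F (lift ord0 k))).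
Qed.

(** If [m] exceeded [n], a nontrivial combination of [n.+1] of the vectors [e' k] would lie in [Y].
    It would then have two coordinate vectors with respect to [e'], its coefficients and 0, against
    uniqueness. *)
Lemma quotient_dim_le X Y n m : subspace X -> subspace Y ->
  quotient_dim X Y n -> quotient_dim X Y m -> (m <= n)%N.
Proof.
move=> sX sY [e [he hq]] [e' [he' hq']]; rewrite leqNgt; apply/negP => nm.
have /choice[B hB] : forall k : 'I_m, exists c : 'I_n -> R[i],
    Y (fun i => e' k i - \sum_l c l * e l i).
  by move=> k; have [c [h _]] := hq _ (he' k); exists c.
pose w (t : 'I_n.+1) : 'I_m := widen_ord nm t.
have [c [[t0 ct0] _ hc]] := normalized_relation (fun t l => B (w t) l).
pose x i := \sum_t c t * e' (w t) i.
have Xx : X x by apply: subspace_sum => // k; exact: he'.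
have Yx : Y x.
  rewrite (_ : x = fun i => \sum_t c t * (e' (w t) i - \sum_l B (w t) l * e l i)).
    by apply: subspace_sum => // t; exact: hB.
  apply/funext => i; under [RHS]eq_bigr do rewrite mulrBr.
  rewrite sumrB [X in _ - X](_ : _ = 0) ?subr0//.
  under eq_bigr do rewrite mulr_sumr.
  rewrite exchange_big big1// => l _.
  under eq_bigr do rewrite mulrA.
  by rewrite -mulr_suml hc mul0r.
pose c' (k : 'I_m) := \sum_(t | w t == k) c t.
have xc' i : \sum_k c' k * e' k i = x i.
  rewrite /x (partition_big w predT)//=; apply: eq_bigr => k _.
  by rewrite mulr_suml; apply: eq_bigr => t /eqP ->.
have [d [_ du]] := hq' x Xx.
have d1 : d = c'.
  apply: du; rewrite (_ : (fun i => _) = fun=> 0); first by case: sY.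
  by apply/funext => i; rewrite xc' subrr.
have d2 : d = fun=> 0.
  apply: du; rewrite (_ : (fun i => _) = x)//.
  by apply/funext => i; rewrite big1 ?subr0// => k _; rewrite mul0r.
have : c' (w t0) = 1.
  rewrite /c' (bigD1 t0)//= big1 ?addr0// => t /andP[/eqP h /negP[]].
  by apply/eqP/val_inj; have := congr1 val h.
by rewrite -d1 d2 => /esym/eqP; rewrite oner_eq0.
Qed.

Lemma quotient_dim_unique X Y n m : subspace X -> subspace Y ->
  quotient_dim X Y n -> quotient_dim X Y m -> n = m.
Proof. by move=> sX sY h h'; apply/eqP; rewrite eqn_leq !(quotient_dim_le sX sY). Qed.

Lemma quotient_dim0 X Y : X `<=` Y -> quotient_dim X Y 0.
Proof.
move=> XY; exists (fun _ _ => 0); split=> [[]//|x Xx].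
exists (fun=> 0); split=> [|c _]; last by apply/funext => -[].
rewrite (_ : (fun i => x i - _) = x); first exact: XY.
by apply/funext => i; rewrite big_ord0 subr0.
Qed.

Lemma quotient_dim1 X Y e : X e ->
  (forall x, X x -> exists! t, Y (fun i => x i - t * e i)) -> quotient_dim X Y 1.
Proof.
move=> Xe h; exists (fun=> e); split => // x /h[t [ht tu]].
exists (fun=> t); split=> [|c hc].
  by rewrite (_ : (fun i => _) = fun i => x i - t * e i)//; apply/funext => i; rewrite big_ord1.
apply/funext => k; rewrite ord1; apply: tu.
by rewrite (_ : (fun i => _) = fun i => x i - \sum_(k < 1) c k * e i)//;
  apply/funext => i; rewrite big_ord1.
Qed.

Lemma matop0 (A : I -> I -> R[i]) : matop A (fun=> 0) = fun=> 0.
Proof. by apply/funext => i; rewrite /matop fsbig1// => j _; rewrite mulr0. Qed.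

Lemma invertible_fredholm p (A : I -> I -> R[i]) : (1 <= p)%E -> invertible_on p A ->
  fredholm_with_index p A 0.
Proof.
move=> p1 [T [bT hT]]; exists 0%N, 0%N; split => //; apply: quotient_dim0.
  move=> x [lx /= hx]; have [_ <-] := hT x lx.
  by have [_] := hT _ (lp0 p1); rewrite hx matop0.
by move=> y ly; exists (T y); [have [h _ _] := bT; exact: h|have [] := hT y ly].
Qed.

End Quotients.

Section FredholmIndex.
Context {R : realType} {I : choiceType} (emb : I -> int) (inv : int -> option I).
Context (embK : forall i, inv (emb i) = Some i).
Context (invK : forall k i, inv k = Some i -> emb i = k).
Implicit Types (p : \bar R) (x y : I -> R[i]) (z : int -> R[i]) (J : jac R).

Lemma matop_lin J A (a : R[i]) x y : repr emb J A ->
  matop A (fun i => a * x i + y i) = fun i => a * matop A x i + matop A y i.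
Proof.
move=> hA; apply/funext => i; rewrite !(matop_op embK invK _ _ hA) -op_lin.
congr op; apply/funext => k; rewrite /ext; case: (inv k) => //; by rewrite mulr0 addr0.
Qed.

Lemma lp_subspace p : (1 <= p)%E -> subspace (lp p : set (I -> R[i])).
Proof. by move=> p1; split=> [|a x y]; [exact: lp0|exact: lp_lin]. Qed.

Lemma fredholm_unique p J A k k' : (1 <= p)%E -> repr emb J A ->
  fredholm_with_index p A k -> fredholm_with_index p A k' -> k = k'.
Proof.
move=> p1 hA [a [b [h1 h2 ->]]] [a' [b' [h1' h2' ->]]].
have sl := lp_subspace p1.
have e1 : a = a'.
  apply: quotient_dim_unique h1 h1'.
    split=> [|c x y [lx /= hx] [ly /= hy]]; first by split; [case: sl|exact: matop0].
    split; first by case: sl => _; exact.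
    by rewrite /= (matop_lin _ _ _ hA) hx hy; apply/funext => i; rewrite mulr0 addr0.
  by split=> // c x y -> ->; apply/funext => i; rewrite mulr0 addr0.
rewrite e1; congr (_ - Posz _).
apply: (quotient_dim_unique sl _ h2 h2').
split=> [|c _ _ [x lx <-] [y ly <-]].
  by exists (fun=> 0); [case: sl|exact: matop0].
by exists (fun i => c * x i + y i); [case: sl => _; exact|rewrite (matop_lin _ _ _ hA)].
Qed.

(** The bounded solution provided by [solve] is localized relative to [y], and therefore lies in the
    same l^p. *)
Lemma tr_lb_surjective K C J A p y : 0 < C -> bdd K J -> repr emb J A ->
  lb (tr (cut (dom inv) J)) C -> (1 <= p)%E -> lp p y -> exists2 x, lp p x & matop A x = y.
Proof.
move=> C0 hJ hA hl p1 ly; have hJ' := cut_bdd (dom inv) hJ.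
have [C' [t [C'0 t1 h]]] := solve C0 hJ' hl.
have [Y hY] := lp_bnd embK invK p1 ly.
have [z [_ hz cz]] := h _ _ hY.
have sz : supp (dom inv) z.
  by move=> k nk; have := hz k; rewrite op_cut (negbTE nk) ext_supp.
have [M M0 hM] := lpnorm_fin p1 ly.
(* [localized_lple] requires a positive constant, while [C'] may be 0. *)
have cz' : localized (C' + 1) t (ext inv y) z.
  move=> m d hd; rewrite (le_trans (cz m d hd))// ler_wpM2r ?lerDl//.
  have := hd m; rewrite subrr absz0 expr0 mulr1; exact: le_trans (nc_ge0 _).
have C1 : 0 < C' + 1 by rewrite ltr_wpDl.
exists (res emb z).
  apply: (lp_res embK invK p1); apply: (lple_lp p1 _ (localized_lple p1 C1 t1 M0 cz' _)).
    by rewrite !mulr_ge0 ?(ltW C1)// invr_ge0 subr_ge0 invf_le1 ?(lt_trans ltr01 t1)// ltW.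
  by apply/(lple_ext embK invK).
apply/funext => i; rewrite -(ext_emb embK (matop _ _)) (ext_matop embK invK _ _ hA).
by rewrite (res_ext embK invK)// hz (ext_emb embK).
Qed.

(** Finite codimension bounds the transposes, that is the class with [U] and [W] exchanged;
    reflection leads back to the class itself. *)
Lemma quotient_line_lb U V W K p J A b : (1 <= p)%E -> 0 <= K ->
  (forall J', cls U V W J' -> bdd K J') -> repr emb J A -> ergodic (dom inv) J U V W ->
  quotient_dim (lp p) (matop A @` lp p) b -> exists2 C : R, 0 < C & line_lb U V W C.
Proof.
move=> p1 K0 hK hA hJ hq; have [f [M M0 hM]] := dual_range embK invK p1 hA hq.
have h := ergodic_dual_lb p1 M0 hJ hM.
have [C C0 hC] := dual_lb_lb p1 (mulr_ge0 M0 (ler0n R b.+1)) K0.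
have : line_lb W V U C.
  move=> J' /cls_tr cJ; have := hC predT _ (tr_bdd (hK _ cJ)) (h _ cJ); rewrite trK.
  by rewrite (_ : cut predT J' = J')//; apply/funext => k; rewrite /cut /= /lo /di /up; case: (J' k) => -[].
move=> /line_lb_flip hI; exists (C + 1); first by rewrite ltr_wpDl.
by move=> J' cJ; apply: lb_le (hI J' cJ); rewrite lerDl.
Qed.

End FredholmIndex.

Section Index.
Context {R : realType} (U V W : set R[i]) (U0 : U !=set0) (V0 : V !=set0) (W0 : W !=set0).
Context (cU : compact (U : set (R[i])^o)) (cV : compact (V : set (R[i])^o)).
Context (cW : compact (W : set (R[i])^o)).
Context (K : R) (K0 : 0 <= K) (hK : forall J, cls U V W J -> bdd K J).
Context (hK' : forall J, cls W V U J -> bdd K J).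
Context (C : R) (C0 : 0 < C) (hI : line_lb U V W C).
Implicit Types (J : jac R) (p : \bar R).

(** Extended by zero, a kernel vector with first entry 1 has its only residual at row -1, of size at
    most [K]. By [lb_localized] it decays with the distance from there, uniformly over the class. *)
Lemma kernel_decay : halfline_ker U V W -> exists k s : R, [/\ 0 <= k, 1 < s & forall J, cls U V W J ->
  exists g, [/\ supp NN g, g 0 = 1, forall i, 0 <= i -> op J g i = 0 &
    forall m : int, nc (g m) <= k / s ^+ `|m|]].
Proof.
move=> hP; have [s s1 hs] := ex_rate1 (ltW C0) K0.
have s0 : 0 < s by exact: lt_trans ltr01 s1.
exists (2 * C * K), s; split => // [|J cJ]; first by rewrite !mulr_ge0// ltW.
have [x [X [hx sx xn xe]]] := ker_all hK hK' cU cV cW (ltW C0) hI hP cJ.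
have x0 := ker0_neq0 hK hI cJ hx sx xn xe.
pose g i := (x 0)^-1 * x i.
have hg : bnd g (nc (x 0)^-1 * X) by move=> i; rewrite ncM ler_wpM2l ?nc_ge0.
have sg : supp NN g by move=> i hi; rewrite /g (sx i hi) mulr0.
have g0 : g 0 = 1 by rewrite /g mulVf.
have eg i : op J g i = (x 0)^-1 * op J x i by rewrite /op /g; ring.
exists g; split => // [i i0|m]; first by rewrite eg xe// mulr0.
have [m0|m0] := boolP (NN m); last first.
  by rewrite sg// nc0 !mulr_ge0 ?invr_ge0 ?exprn_ge0// ltW.
rewrite -mulrA; apply: (lb_localized (hK cJ) (hI cJ) (ltW C0) (ltW s1) hs hg) => i.
have sm : 0 < s ^+ absz m by rewrite exprn_gt0.
have [i0|i0] := boolP (NN i).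
  by rewrite eg xe// mulr0 nc0 !mulr_ge0 ?invr_ge0 ?exprn_ge0// ltW.
have [i1|i1] := eqVneq i (-1); last first.
  have h1 : ~~ NN (i - 1) by move: i0; rewrite /NN; clear; lia.
  have h2 : ~~ NN (i + 1) by move: i0 i1; rewrite /NN; clear; lia.
  rewrite /op (sg _ h1) (sg _ h2) (sg _ i0) !mulr0 !addr0 nc0.
  by rewrite !mulr_ge0 ?invr_ge0 ?exprn_ge0// ltW.
rewrite i1 {1}/op addNr g0 mulr1 (sg (-1 - 1) isT) (sg (-1) isT) !mulr0 !add0r.
have [_ _ h3] := hK cJ (-1); rewrite (le_trans h3)// -mulrA ler_peMr//.
rewrite mulrC ler_pdivlMr// mul1r ler_weXn2l ?ltW//; move: m0; rewrite /NN => m0; ilia.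
Qed.

Lemma lple_decay p (g : int -> R[i]) (k s : R) : (1 <= p)%E -> 0 <= k -> 1 < s ->
  (forall m : int, nc (g m) <= k / s ^+ `|m|) -> lp p g.
Proof.
move=> p1 k0 s1 hg; have s0 : 0 < s by exact: lt_trans ltr01 s1.
have k1 : 0 < k + 1 by rewrite ltr_wpDl.
have hc : localized (k + 1) s (e_ 0) g.
  move=> m d hd; have := hd 0; rewrite nc_e eqxx sub0r abszN => h1.
  have sm : 0 < s ^+ absz m by rewrite exprn_gt0.
  by rewrite (le_trans (hg m))// ler_pM ?invr_ge0 ?(ltW sm) ?lerDl// -[_^-1]mul1r ler_pdivrMr.
apply: (lple_lp p1 _ (localized_lple p1 k1 s1 ler01 hc (lple_e 0 p1))).
by rewrite mulr1 !mulr_ge0 ?(ltW k1)// invr_ge0 subr_ge0 invf_le1// ltW.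
Qed.

(** The kernel is spanned by the decaying vector [g]: a kernel vector with first entry 0 vanishes by
    [ker0]. The operator is onto because, by [coburn], no transpose has a kernel, which yields the
    transposed bound. *)
Lemma halfline_ker_index p A : halfline_ker U V W -> (1 <= p)%E -> Mplus U V W A -> fredholm_with_index p A 1.
Proof.
move=> hP p1 hA; have [J cJ rJ] := ex_repr emb_natK inv_natK U0 V0 W0 hA.
have [k [s [k0 s1 /(_ J cJ)[g [sg g0 ge gd]]]]] := kernel_decay hP.
have lg := lple_decay p1 k0 s1 gd.
pose x0 := res Posz g.
have ex0 : ext inv_nat x0 = g by apply: (res_ext emb_natK inv_natK); rewrite dom_nat.
have Ax0 : matop A x0 = fun=> 0.
  by apply/funext => i; rewrite (matop_op emb_natK inv_natK _ _ rJ) ex0 ge.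
exists 1%N, 0%N; split => //.
  apply: (@quotient_dim1 _ _ _ _ x0); first by split => //; exact: lp_res emb_natK inv_natK _ _ p1 lg.
  move=> x [lx /= hx]; exists (x 0%N); split; last first.
    move=> t /(congr1 (fun f => f 0%N)) /=; rewrite /x0 /res g0 mulr1 => /eqP.
    by rewrite subr_eq0 => /eqP.
  pose y i := - x 0%N * x0 i + x i.
  have ly : lp p y by apply: lp_lin => //; exact: lp_res emb_natK inv_natK _ _ p1 lg.
  have [Y hY] := lp_bnd emb_natK inv_natK p1 ly.
  have h : bnd (ext inv_nat y) (C * (K * nc (ext inv_nat y 0))).
    apply: (ker0 hK hI cJ hY); first by rewrite -dom_nat; exact: ext_supp.
    move=> i i0; rewrite (_ : i = Posz (absz i)); last by ilia.
    rewrite -(matop_op emb_natK inv_natK _ _ rJ) (matop_lin emb_natK inv_natK _ _ _ rJ).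
    by rewrite Ax0 hx mulr0 addr0.
  apply/funext => i; have := h (Posz i).
  rewrite /ext /= {2}/y /x0 /res g0 mulr1 addNr nc0 !mulr0 => /nc_le0 <-.
  by rewrite /y mulNr addrC.
apply: quotient_dim0 => y ly.
have [[C2 h2]|hP'] := halfline_lb_or_halfline_ker hK' cW cV cU (ltW C0) (line_lb_flip hI); last first.
  by case: (coburn hK hK' hI (ltW C0) hP hP').
have C21 : 0 < Num.max 1 C2 by rewrite lt_max ltr01.
have [|x lx hx] := tr_lb_surjective emb_natK inv_natK C21 (hK cJ) rJ _ p1 ly; last by exists x.
rewrite dom_nat tr_cut; apply: (@lb_le _ _ C2); first by rewrite le_max lexx orbT.
by apply: h2; exact: cls_tr.
Qed.

End Index.

(** * Norms of inverses *)

Section Duality.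
Context {R : realType}.
Implicit Types (p q : \bar R) (g y : int -> R[i]).

Lemma conj_cases p q : (1 <= p)%E -> (1 <= q)%E -> (p^-1 + q^-1 = 1)%E ->
  [\/ p = +oo%E /\ q = 1%E, p = 1%E /\ q = +oo%E | exists r s : R,
    [/\ p = r%:E, q = s%:E, 1 < r, 1 < s & r^-1 + s^-1 = 1]].
Proof.
move=> p1 q1; case: (ge1_cases p1) => [->|[r -> r1]]; case: (ge1_cases q1) => [->|[s -> s1]].
- by rewrite invey adde0 => /eqP; rewrite lt_eqF.
- have s0 : s != 0 by rewrite gt_eqF// (lt_le_trans ltr01).
  rewrite invey add0e inver (negbTE s0) => -[/(congr1 GRing.inv)].
  by rewrite invrK invr1 => ->; apply: Or31.
- have r0 : r != 0 by rewrite gt_eqF// (lt_le_trans ltr01).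
  rewrite invey adde0 inver (negbTE r0) => -[/(congr1 GRing.inv)].
  by rewrite invrK invr1 => ->; apply: Or32.
have r0 : 0 < r by apply: lt_le_trans r1.
have s0 : 0 < s by apply: lt_le_trans s1.
rewrite !inver (gt_eqF r0) (gt_eqF s0) -EFinD => -[h]; apply: Or33.
have r' : 0 < r^-1 by rewrite invr_gt0.
have s' : 0 < s^-1 by rewrite invr_gt0.
exists r, s; split => //.
  by rewrite -[r]invrK -[ltLHS]invr1 ltf_pV2 ?posrE//; lra.
by rewrite -[s]invrK -[ltLHS]invr1 ltf_pV2 ?posrE//; lra.
Qed.

Lemma lple_sum_pos (r : R) (x : int -> R[i]) M N : lple r%:E x M ->
  \sum_(a < (2 * N).+1) nc (x (pos N a)) `^ r <= M `^ r.
Proof.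
move=> /(_ (map (@pos N (2 * N).+1) (index_enum _))).
by rewrite big_map; apply; rewrite map_inj_uniq ?index_enum_uniq//; exact: pos_inj.
Qed.

Lemma holder p q N g G : (1 <= p)%E -> (1 <= q)%E -> (p^-1 + q^-1 = 1)%E ->
  fs N g -> 0 <= G -> lple p g G -> dual_le q g G.
Proof.
move=> p1 q1 pq fg G0 hg y hy.
have h0 : nc (pr g y) <= \sum_(a < (2 * N).+1) nc (g (pos N a)) * nc (y (pos N a)).
  rewrite (prE _ fg) (le_trans (nc_sum _ _ _))//; apply: ler_sum => a _; by rewrite ncM.
apply: le_trans h0 _.
case: (conj_cases p1 q1 pq) => [[pe qe]|[pe qe]|[r [s [pe qe r1 s1 rs]]]]; subst p q.
- apply: (@le_trans _ _ (\sum_(a < (2 * N).+1) G * nc (y (pos N a)) `^ 1)).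
    by apply: ler_sum => a _; rewrite powRr1 ?nc_ge0// ler_wpM2r ?nc_ge0// hg.
  by rewrite -mulr_sumr ler_piMr// (le_trans (lple_sum_pos N hy))// powR1.
- apply: (@le_trans _ _ (\sum_(a < (2 * N).+1) nc (g (pos N a)) `^ 1)).
    by apply: ler_sum => a _; rewrite powRr1 ?nc_ge0// ler_piMr ?nc_ge0// hy.
  by rewrite (le_trans (lple_sum_pos N hg))// powRr1.
have [Ge|Gn] := eqVneq G 0.
  rewrite big1 ?Ge// => a _; rewrite (_ : g _ = 0) ?nc0 ?mul0r//.
  by apply/nc_le0; rewrite -Ge; exact: lple_coord hg.
have Gp : 0 < G by rewrite lt_def Gn.
have r0 : 0 < r by apply: lt_trans r1.
have s0 : 0 < s by apply: lt_trans s1.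
apply: (@le_trans _ _ (\sum_(a < (2 * N).+1) G * ((nc (g (pos N a)) / G) `^ r / r +
    nc (y (pos N a)) `^ s / s))).
  apply: ler_sum => a _; rewrite -ler_pdivrMl// mulrA [_^-1 * _]mulrC.
  by apply: conjugate_powR => //; rewrite ?divr_ge0 ?nc_ge0.
rewrite -mulr_sumr ler_piMr// big_split /= -!mulr_suml.
rewrite -rs lerD//.
  rewrite ler_piMl ?invr_ge0 ?(ltW r0)//.
  under eq_bigr do rewrite powRM ?nc_ge0 ?invr_ge0//.
  rewrite -mulr_suml (le_trans (ler_wpM2r (powR_ge0 _ _) (lple_sum_pos N hg)))//.
  by rewrite -powRM ?invr_ge0// mulfV// powR1.
by rewrite ler_piMl ?invr_ge0 ?(ltW s0)// (le_trans (lple_sum_pos N hy))// powR1.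
Qed.

Lemma ex_phase (z : R[i]) : exists2 u : R[i], nc u <= 1 & z * u = (nc z)%:C%C.
Proof.
have [->|z0] := eqVneq z 0; first by exists 0; rewrite ?nc0// mul0r.
exists ((nc z)%:C%C / z); last by rewrite mulrC divfK.
by rewrite ncM ncV nc_real ger0_norm ?nc_ge0// mulfV// gt_eqF// nc_gt0.
Qed.

(** The converse of [holder], obtained by testing on a vector for which Hoelder's inequality is an
    equality. *)
Lemma dual_le_lple p q N g G : (1 <= p)%E -> (1 <= q)%E -> (p^-1 + q^-1 = 1)%E ->
  fs N g -> dual_le q g G -> lple p g G.
Proof.
move=> p1 q1 pq fg hg; have G0 := dual_le_ge0 q1 hg.
have /choice[u hu] : forall i, exists u : R[i], nc u <= 1 /\ g i * u = (nc (g i))%:C%C.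
  by move=> i; have [u u1 u2] := ex_phase (g i); exists u.
have fsum (r : R) (s : seq int) : 0 < r -> uniq s -> \sum_(i <- s) nc (g i) `^ r <=
    \sum_(a < (2 * N).+1) nc (g (pos N a)) `^ r.
  move=> r0 us; rewrite -(big_map (@pos N (2 * N).+1) predT (fun i => nc (g i) `^ r)).
  rewrite (bigID (fun i => g i != 0)) /= [X in _ + X]big1 ?addr0; last first.
    by move=> i /negPn/eqP ->; rewrite nc0 powR0// gt_eqF.
  rewrite -big_filter; apply: sum_uniq_le; first exact: filter_uniq.
    move=> i; rewrite mem_filter => /andP[gi _]; apply/mapP.
    have [|hN] := leqP `|i| N; last by rewrite fg ?eqxx in gi.
    by move=> /ex_pos[a <-]; exists a; rewrite ?mem_index_enum.
  by move=> i; exact: powR_ge0.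
case: (conj_cases p1 q1 pq) => [[pe qe]|[pe qe]|[r [s [pe qe r1 s1 rs]]]]; subst p q.
- by move=> i; exact: dual_le_coord q1 fg hg.
- move=> s us; rewrite powRr1//; apply: le_trans (fsum 1 s ltr01 us) _.
  have := hg u (fun i => (hu i).1); rewrite (prE _ fg).
  under eq_bigr do rewrite (hu _).2.
  rewrite -rmorph_sum nc_real ger0_norm ?sumr_ge0// => [|a _]; last exact: nc_ge0.
  by move=> h; apply: le_trans h; apply: ler_sum => a _; rewrite powRr1 ?nc_ge0.
have r0 : 0 < r by apply: lt_trans r1.
have s0 : 0 < s by apply: lt_trans s1.
have rs1 : (r - 1) * s = r.
  apply/eqP; rewrite -subr_eq0; apply/eqP.
  rewrite (_ : _ - r = r * s * (1 - (r^-1 + s^-1))); last by field; rewrite !gt_eqF.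
  by rewrite rs subrr mulr0.
pose T : R := \sum_(a < (2 * N).+1) nc (g (pos N a)) `^ r.
have T0 : 0 <= T by rewrite sumr_ge0// => a _; exact: powR_ge0.
(* The extremal vector: the phases of [g] are removed, its l^s norm is at most T^(1/s) because (r -
   1) s = r, and its pairing with [g] is [T]. *)
pose y i := (nc (g i) `^ (r - 1))%:C%C * u i.
have hy : lple s%:E y (T `^ s^-1).
  move=> t ut; rewrite -powRrM mulVf ?gt_eqF// powRr1//; apply: le_trans (fsum r t r0 ut).
  apply: ler_sum => i _; rewrite ncM nc_real ger0_norm ?powR_ge0//.
  rewrite powRM ?powR_ge0 ?nc_ge0// -powRrM rs1 ler_piMr ?powR_ge0//.
  rewrite [leRHS](_ : 1 = 1 `^ s); last by rewrite powR1.
  apply: ge0_ler_powR; rewrite ?nnegrE ?nc_ge0 ?(ltW s0)//.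
  by have [] := hu i.
have := dual_le_scale q1 fg hg (powR_ge0 _ _) hy.
rewrite (prE _ fg).
have -> : \sum_(a < (2 * N).+1) g (pos N a) * y (pos N a) = T%:C%C.
  rewrite /T rmorph_sum; apply: eq_bigr => a _.
  rewrite /y mulrCA (hu _).2 -rmorphM /= -{2}(powRr1 (nc_ge0 (g (pos N a)))).
  rewrite -powRD; first by rewrite subrK.
  by rewrite subrK gt_eqF.
rewrite nc_real ger0_norm// => hT t ut; apply: le_trans (fsum r t r0 ut) _.
rewrite -/T; have [Te|Tn] := eqVneq T 0; first by rewrite Te powR_ge0.
have Tp : 0 < T by rewrite lt_def Tn.
have hT' : T `^ r^-1 <= G.
  rewrite -(ler_pM2r (powR_gt0 s^-1 Tp)) -powRD; last by rewrite Tn implybT.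
  by rewrite rs powRr1.
have rn : r != 0 by rewrite gt_eqF.
rewrite -[leLHS](powRr1 T0) -(mulVf rn).
by rewrite powRrM ge0_ler_powR ?nnegrE ?powR_ge0 ?(ltW r0).
Qed.

End Duality.

Section Tensor.
Context {R : realType} {I K : choiceType}.
Implicit Types (p : \bar R) (x : I -> R[i]) (a : K -> R[i]).

(** A chain of multiples of one block is the tensor product of the block with the sequence of
    factors. The p-norm is multiplicative on such products, so the norm of the sequence cancels from
    a lower bound. *)
Definition tens x a (k : I * K) : R[i] := x k.1 * a k.2.

Lemma tens_lple p x a X A : (1 <= p)%E -> 0 <= X -> 0 <= A -> lple p x X -> lple p a A ->
  lple p (tens x a) (X * A).
Proof.
case/ge1_cases => [->|[r -> r1]] X0 A0 hx ha /=.
  by move=> k; rewrite ncM ler_pM ?nc_ge0 ?hx ?ha.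
move=> s us; rewrite powRM//.
(* A finite set of pairs is enlarged to the product of its projections, over which the sum
   factors. *)
pose s1 := undup (map fst s); pose s2 := undup (map snd s).
apply: (@le_trans _ _ (\sum_(k <- [seq (i, j) | i <- s1, j <- s2]) nc (tens x a k) `^ r)).
  apply: sum_uniq_le => // [k ks|k]; last exact: powR_ge0.
  apply/allpairsP; exists k; case: k ks => i j ks; split => //=.
    by rewrite mem_undup; apply/mapP; exists (i, j).
  by rewrite mem_undup; apply/mapP; exists (i, j).
rewrite big_allpairs /=.
under eq_bigr do under eq_bigr do rewrite ncM powRM ?nc_ge0//=.
under eq_bigr do rewrite -mulr_sumr.
rewrite -mulr_suml ler_pM ?sumr_ge0 ?hx ?ha ?undup_uniq// => i _; exact: powR_ge0.
Qed.

(* B is the norm of a. *)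
Lemma lple_tens p x a M B : (1 <= p)%E -> 0 <= M -> 0 < B ->
  (forall B', 0 <= B' -> lple p a B' -> B <= B') -> lple p (tens x a) M -> lple p x (M / B).
Proof.
case/ge1_cases => [->|[r -> r1]] M0 B0 hB h /=.
  move=> i; have [->|xi] := eqVneq (x i) 0; first by rewrite nc0 divr_ge0// ltW.
  have ni : 0 < nc (x i) by rewrite nc_gt0.
  rewrite ler_pdivlMr// mulrC -ler_pdivlMr//; apply: hB; first by rewrite divr_ge0// ltW.
  by move=> k; rewrite ler_pdivlMr// mulrC -ncM; exact: (h (i, k)).
have r0 : 0 < r by apply: lt_le_trans r1.
move=> s us; set S := \sum_(i <- s) _.
have S0 : 0 <= S by rewrite sumr_ge0// => i _; exact: powR_ge0.
have [->|Sn] := eqVneq S 0; first exact: powR_ge0.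
have Sp : 0 < S by rewrite lt_def Sn.
have Sr : S = (S `^ r^-1) `^ r by rewrite -powRrM mulVf ?gt_eqF// powRr1.
have Sr0 : 0 < S `^ r^-1 by exact: powR_gt0.
rewrite Sr; apply: ge0_ler_powR; rewrite ?nnegrE ?powR_ge0 ?divr_ge0 ?(ltW r0) ?(ltW B0)//.
rewrite ler_pdivlMr// mulrC -ler_pdivlMr//; apply: hB; first by rewrite divr_ge0// ltW.
move=> t ut; apply: (@le_trans _ _ (M `^ r / S)); last first.
  have e : S * ((S `^ r^-1)^-1) `^ r = 1.
    by rewrite {1}Sr -powRM ?invr_ge0 ?(ltW Sr0)// mulfV ?gt_eqF// powR1.
  by rewrite powRM ?invr_ge0 ?(ltW Sr0)// ler_wpM2l ?powR_ge0// -[S^-1]mulr1 -e mulKf.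
rewrite ler_pdivlMr//.
have up : uniq [seq (i, j) | i <- s, j <- t].
  by apply: allpairs_uniq => // -[i j] [i' j'] _ _ /= [-> ->].
have := h _ up; rewrite big_allpairs /=.
under eq_bigr do under eq_bigr do rewrite ncM powRM ?nc_ge0//=.
under eq_bigr do rewrite -mulr_sumr.
by rewrite -mulr_suml mulrC.
Qed.

End Tensor.

(** * Lower bounds with exact constants and their duality *)

Section LowerNorms.
Context {R : realType}.
Implicit Types (p q : \bar R) (D : pred int) (J : jac R) (z y : int -> R[i]).

(* Lower bounds with the p-norm of the inverse as their constant; norm_lb_fs only tests
   finitely supported vectors. *)
Definition norm_lb p D J (M : R) := forall z Y, lp p z -> supp D z -> 0 <= Y ->
  lple p (mask D (op J z)) Y -> lple p z (M * Y).

Definition norm_lb_fs p D J (M : R) := forall N z Y, fs N z -> supp D z -> 0 <= Y ->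
  lple p (mask D (op J z)) Y -> lple p z (M * Y).

Definition norm_solvable q D J (M : R) := forall N y, fs N y -> supp D y -> lple q y 1 ->
  exists x, [/\ supp D x, lple q x M & forall i, D i -> op J x i = y i].

(** Tents reduce a vector to finite support at the cost of a residual O(1/n). In the limit this cost
    disappears, and the constant [M] is preserved exactly. *)
Lemma norm_lb_fs_norm_lb p D J K M : (1 <= p)%E -> bdd K J -> 0 <= M -> norm_lb_fs p D J M -> norm_lb p D J M.
Proof.
move=> p1 hJ M0 h z Y lz sz Y0 hY; have K0 := bdd_ge0 hJ.
have [Z Z0 hZ] := lpnorm_fin p1 lz.
pose d n : R := K * n.+1%:R^-1 * Z.
have d0 n : 0 <= d n by rewrite !mulr_ge0// invr_ge0.
pose w n i : R[i] := (tent n i)%:C%C * z i.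
have ncw n i : nc (w n i) <= nc (z i).
  have /andP[t0 t1] := @tent_itv R n i.
  by rewrite /w ncM nc_real ger0_norm// ler_piMl ?nc_ge0.
have fw n : fs n (w n).
  by move=> i hi; rewrite /w tent0 ?mul0r.
have hw n : lple p (w n) (M * (Y + (d n + d n))).
  apply: h (fw n) _ _ _; rewrite ?addr_ge0//.
    by move=> i /sz e; rewrite /w e mulr0.
  pose e1 i := lo J i * ((tent n (i - 1) - tent n i)%:C%C * z (i - 1)).
  pose e2 i := up J i * ((tent n (i + 1) - tent n i)%:C%C * z (i + 1)).
  have he (b : int -> R[i]) (k : int) : (forall i, nc (b i) <= K) -> (`|k| <= 1)%N ->
      lple p (fun i => b i * ((tent n (i + k) - tent n i)%:C%C * z (i + k))) (d n).
    move=> hb k1; apply: (lpleZ p1 Z0 _ _ (lple_shift k p1 Z0 hZ)) => [|i].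
      by rewrite mulr_ge0 ?invr_ge0.
    rewrite ncM -mulrA ler_pM ?nc_ge0// ncM nc_real ler_wpM2r ?nc_ge0//.
    by apply: tent_diff; rewrite addrC addKr.
  have hlo := he (lo J) (-1) (fun i => let: And3 a _ _ := hJ i in a) isT.
  have hup := he (up J) 1 (fun i => let: And3 _ _ a := hJ i in a) isT.
  have hwY : lple p (fun i => (tent n i)%:C%C * mask D (op J z) i) Y.
    apply: lple_mono hY => // i; have /andP[t0 t1] := @tent_itv R n i.
    by rewrite ncM nc_real ger0_norm// ler_piMl ?nc_ge0.
  have := minkowski p1 Y0 (addr_ge0 (d0 n) (d0 n)) hwY (minkowski p1 (d0 n) (d0 n) hlo hup).
  apply: lple_mono => // i; rewrite /mask; case: ifP => _; last by rewrite nc0 nc_ge0.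
  rewrite le_eqVlt; apply/orP; left; apply/eqP; congr nc.
  by rewrite /op /w !rmorphB /=; ring.
apply: lple_closed => // [|e e0]; first by rewrite mulr_ge0.
pose m := Num.truncn (M * (2 * K * Z) / e).
have hm n : M * (Y + (d (n + m)%N + d (n + m)%N)) <= M * Y + e.
  rewrite mulrDr lerD2l (_ : _ * _ = M * (2 * K * Z) / (n + m).+1%:R); last first.
    by rewrite /d; field; rewrite gt_eqF.
  rewrite ler_pdivrMr// [leRHS]mulrC -ler_pdivrMr// ltW//.
  apply: (lt_le_trans (Num.Theory.truncnS_gt _)).
  by rewrite -/m ler_nat ltnS leq_addl.
apply: (@lple_fatou _ _ p (fun n => w (n + m)%N)) => //.
- by rewrite addr_ge0 ?mulr_ge0// ltW.
- move=> n; apply: lple_le (hm n) (hw _) => //.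
  by rewrite mulr_ge0// addr_ge0// addr_ge0.
- move=> i e' e'0 /=.
  apply: filterS (uF_ge (absz i + (Num.truncn ((absz i)%:R * nc (z i) / e')).+1)%N) => n /= hn.
  rewrite /w -{2}(mul1r (z i)) -mulrBl ncM.
  rewrite (_ : (tent (n + m) i)%:C%C - 1 = (tent (n + m) i - 1)%:C%C); last first.
    by apply/eqP; rewrite eq_complex /= subr0 !eqxx.
  rewrite nc_real /tent (_ : minn _ _ = absz i); last by ilia.
  rewrite addrAC subrr sub0r normrN ger0_norm ?divr_ge0// mulrAC ltr_pdivrMr//.
  rewrite [ltRHS]mulrC -ltr_pdivrMr//; apply: lt_le_trans (Num.Theory.truncnS_gt _) _.
  rewrite ler_nat ltnS (leq_trans _ (leq_addr m n))// (leq_trans _ hn)//.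
  by rewrite (leq_trans (leqnSn _))// leq_addl.
Qed.

(** Pairing [g] with [y = op (tr J) x] moves the operator onto [g]. The l^q norm of [x] is at most
    [M], so the dual norm of [g], which is its l^p norm, is at most [M] times the norm of its
    residual. *)
Lemma norm_solvable_norm_lb_fs p q D J M : (1 <= p)%E -> (1 <= q)%E -> (p^-1 + q^-1 = 1)%E -> 0 <= M ->
  norm_solvable q D (tr J) M -> norm_lb_fs p D J M.
Proof.
move=> p1 q1 pq M0 hs N g Y fg sg Y0 hg.
have fo := fs_mask D (fs_op J fg).
have dg := holder p1 q1 pq fo Y0 hg.
apply: (dual_le_lple p1 q1 pq fg) => y hy.
pose y' := mask (fun i => D i && (`|i| <= N)%N) y.
have [|||x [sx hx ex]] := hs N y'.
- by move=> i hi; rewrite /y' /mask (leqNgt _ N) hi andbF.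
- by move=> i hi; rewrite /y' /mask (negbTE hi).
- by apply: lple_mono hy => // i; rewrite /y' /mask; case: ifP => // _; rewrite nc0 nc_ge0.
have -> : pr g y = pr (mask D (op J g)) x.
  transitivity (pr g (op (tr J) x)).
    rewrite !(prE _ fg); apply: eq_bigr => a _.
    have [h|h] := boolP (D (pos N a)); last by rewrite sg// !mul0r.
    by rewrite ex// /y' /mask h pos_le.
  rewrite (pr_adj _ _ fg) trK /pr; congr isum; apply/funext => i.
  by rewrite /mask; case: ifPn => // h; rewrite (sx _ h) !mulr0.
by rewrite mulrC; exact: (dual_le_scale q1 fo dg M0 hx).
Qed.

Lemma norm_solvable_flip q D J M : (1 <= q)%E -> 0 <= M ->
  norm_solvable q D (flip J) M -> norm_solvable q (fun i => D (- i)) J M.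
Proof.
move=> q1 M0 h N y fy sy hy.
have oppL (u : int -> R[i]) B : 0 <= B -> lple q u B -> lple q (fun i => u (- i)) B.
  move=> B0 hu; have hs j : u j != 0 -> exists i : int, j = - i.
    by move=> _; exists (- j); rewrite opprK.
  exact/(lpnorm_inj q1 (@oppr_inj int) hs B0).
have [|||x [sx hx ex]] := h N (fun i => y (- i)).
- by move=> i hi; apply: fy; rewrite abszN.
- by move=> i hi; apply: sy; rewrite opprK.
- exact: oppL.
exists (fun i => x (- i)); split => [i hi||i Di]; [exact: sx|exact: oppL|].
have ee : x = (fun j => x (- - j)) by apply/funext => j; rewrite opprK.
by have := ex (- i) Di; rewrite {1}ee (op_flip J (fun i => x (- i))) !opprK.
Qed.

Lemma norm_solvable_sh q D J M k : (1 <= q)%E -> 0 <= M ->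
  norm_solvable q D (sh k J) M -> norm_solvable q (fun i => D (i - k)) J M.
Proof.
move=> q1 M0 h N y fy sy hy.
have [|||x [sx hx ex]] := h (N + absz k)%N (fun i => y (i + k)).
- by move=> i hi; apply: fy; ilia.
- by move=> i hi; apply: sy; rewrite addrK.
- exact: lple_shift.
exists (fun i => x (i - k)); split => [i hi||i Di]; [exact: sx|exact: lple_shift|].
have ee : x = (fun j => x (j + k - k)) by apply/funext => j; rewrite addrK.
by have := ex (i - k) Di; rewrite {1}ee (op_sh k J (fun i => x (i - k))) !subrK.
Qed.

End LowerNorms.

Section InverseNorm.
Context {R : realType} {I : choiceType} (emb : I -> int) (inv : int -> option I).
Context (embK : forall i, inv (emb i) = Some i).
Context (invK : forall k i, inv k = Some i -> emb i = k).
Implicit Types (p : \bar R) (x y : I -> R[i]) (z : int -> R[i]) (J : jac R).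

Lemma invnormE p (A : I -> I -> R[i]) T : (1 <= p)%E -> inverse_on p A T ->
  invnorm p A = opnorm p T.
Proof.
move=> p1 hT.
have h T' : inverse_on p A T' -> opnorm p T' = opnorm p T.
  move=> hT'; rewrite /opnorm; congr ereal_sup.
  have e x : (lpnorm p x <= 1)%E -> T' x = T x.
    move=> /(lpnorm_leP x p1 ler01)/(lple_lp p1 ler01) lx.
    have [[bT _ _] eT] := hT'; have [e1 _] := eT x lx.
    by have [_ /(_ _ (bT x lx))[_ <-]] := hT; rewrite e1.
  by apply/seteqP; split => _ [x hx <-]; exists x => //; rewrite e.
apply/eqP; rewrite eq_le; apply/andP; split.
  by apply: ereal_inf_lbound; exists T.
by apply: le_ereal_inf_tmp => _ [T' /h -> <-].
Qed.

Lemma inverse_norm_lb p J A T M : (1 <= p)%E -> repr emb J A -> inverse_on p A T -> 0 <= M ->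
  (opnorm p T <= M%:E)%E -> norm_lb p (dom inv) J M.
Proof.
move=> p1 rJ hT M0 hM z Y lz sz Y0 hY.
have ez := res_ext embK invK sz.
rewrite -ez; apply/(lple_ext embK invK); rewrite ?mulr_ge0//.
apply: (inverse_lple p1 hT hM M0 Y0); first exact: lp_res embK invK _ _ p1 lz.
apply/(lple_ext embK invK) => //; apply: lple_mono hY => // k.
rewrite (ext_matop embK invK _ _ rJ) ez op_cut_supp// /mask.
Qed.

Lemma inverse_norm_solvable p J A T M : (1 <= p)%E -> repr emb J A -> inverse_on p A T -> 0 <= M ->
  (opnorm p T <= M%:E)%E -> norm_solvable p (dom inv) J M.
Proof.
move=> p1 rJ [bT hT] M0 hM N y fy sy hy.
have ey := res_ext embK invK sy.
have hI : lple p (res emb y) 1 by apply/(lple_ext embK invK) => //; rewrite ey.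
exists (ext inv (T (res emb y))); split; first exact: ext_supp.
  apply/(lple_ext embK invK) => //; rewrite -[M]mulr1.
  exact: (opnorm_lple p1 bT hM M0 ler01 hI).
move=> k /(domP invK)[i <-]; rewrite -(matop_op embK invK _ _ rJ).
by have [-> _] := hT _ (lple_lp p1 ler01 hI).
Qed.

Lemma norm_lb_opnorm p J A T M : (1 <= p)%E -> repr emb J A -> inverse_on p A T -> 0 <= M ->
  norm_lb p (dom inv) J M -> (opnorm p T <= M%:E)%E.
Proof.
move=> p1 rJ [[bT _ _] hT] M0 h; apply: opnorm_leP => // y hy.
have ly := lple_lp p1 ler01 hy.
apply/(lple_ext embK invK) => //; rewrite -[M]mulr1; apply: h => //.
- have [X X0 hX] := lpnorm_fin p1 (bT y ly); apply: (lple_lp p1 X0).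
  exact/(lple_ext embK invK).
- exact: ext_supp.
apply: lple_mono ((lple_ext embK invK y p1 ler01).2 hy) => // k.
have [e _] := hT y ly; rewrite -[in leRHS]e.
rewrite (ext_matop embK invK _ _ rJ) op_cut_supp; last exact: ext_supp.
by rewrite /mask; case: ifP.
Qed.

End InverseNorm.

Section ChainNorm.
Context {R : realType}.
Implicit Types (p : \bar R) (x z : int -> R[i]) (J : jac R) (U V W : set R[i]).

Lemma lple0 {I : choiceType} p M : (1 <= p)%E -> 0 <= M -> lple p (fun _ : I => 0 : R[i]) M.
Proof.
case/ge1_cases => [->|[r -> r1]] M0 /=; first by move=> i; rewrite nc0.
by move=> s _; rewrite big1 ?powR_ge0// => i _; rewrite nc0 powR0// gt_eqF// (lt_le_trans ltr01).
Qed.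

Lemma lple_ord p n x M : (1 <= p)%E -> 0 <= M -> supp (FD n) x ->
  lple p (fun j : 'I_n => x (emb_ord j)) M <-> lple p x M.
Proof.
move=> p1 M0 sx; have hs k : x k != 0 -> exists j : 'I_n, k = emb_ord j.
  move=> xk; have : FD n k by apply: contraNT xk => /sx ->.
  by rewrite -dom_ord => /(domP (@inv_ordK n))[j <-]; exists j.
exact: lpnorm_inj p1 (emb_inj (@emb_ordK n)) hs _ M0.
Qed.

Lemma lp_norm p {I : choiceType} (a : I -> R[i]) i : (1 <= p)%E -> lp p a -> a i != 0 ->
  exists B : R, [/\ 0 < B, lple p a B & forall B', 0 <= B' -> lple p a B' -> B <= B'].
Proof.
move=> p1 la ai; have [M M0 /(lpnorm_leP _ p1 M0) hM] := lpnorm_fin p1 la.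
have a0 : (0 <= lpnorm p a)%E by case: (lpnorm_ge0 a p1) => // h; case: (h i).
have [B eB] : exists B : R, lpnorm p a = B%:E.
  by move: a0 hM; case: (lpnorm p a) => // B _ _; exists B.
have B0 : 0 <= B by rewrite -lee_fin -eB.
have hB : lple p a B by apply/(lpnorm_leP _ p1 B0); rewrite eB.
exists B; split => //; last first.
  by move=> B' B'0 /(lpnorm_leP _ p1 B'0); rewrite eB lee_fin.
rewrite lt_def B0 andbT; apply: contra ai => /eqP e; apply/eqP/nc_le0.
by rewrite -e; exact: (lple_coord i p1 B0 hB).
Qed.

Lemma lp_geometric p (c : R[i]) (s : R) : (1 <= p)%E -> 0 < s < 1 -> nc c <= s ->
  lp p (fun k : nat => c ^+ k).
Proof.
move=> p1 /andP[s0 s1] hc.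
pose g (k : int) : R[i] := if 0 <= k then c ^+ absz k else 0.
have := lp_res emb_natK inv_natK p1 (@lple_decay _ p g 1 s^-1 p1 ler01 _ _).
apply; first by rewrite invf_gt1.
move=> k; rewrite mul1r -exprVn invrK /g; case: ifP => _; last by rewrite nc0 exprn_ge0// ltW.
by rewrite ncX lerXn2r ?nnegrE ?nc_ge0// ltW.
Qed.

(* A factor 1 - d keeps the infinite chain summable even if |l| = |r|; the residual
   at the spare rows is then d * l times the preceding factor. *)
Lemma chain_norm_lb U V W p M J n t x Y : (1 <= p)%E -> 0 <= M ->
  (forall J', cls U V W J' -> norm_lb p NN J' M) -> cls U V W J ->
  [/\ U t.1.1, V t.1.2 & W t.2] -> (0 < n)%N -> supp (FD n) x -> 0 <= Y ->
  lple p (mask (FD n) (op J x)) Y ->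
  nc (t.1.1 * x (n%:Z - 1)) <= nc (t.2 * x 0) -> lple p x (M * Y).
Proof.
move=> p1 M0 hH cJ ct n0 sx Y0 hY hlr.
set l := t.1.1 * _ in hlr; set r := t.2 * _ in hlr.
apply: lple_closed => // [|e e0]; first by rewrite mulr_ge0.
(* At most 1/2, so that [s = 1 - d] lies strictly between 0 and 1, and so small that the residual at
   the spare rows costs at most [e]. *)
pose d := Num.min 2^-1 (e / (M * nc l + 1)).
have ml : 0 < M * nc l + 1 by rewrite ltr_wpDl// mulr_ge0// nc_ge0.
have d0 : 0 < d by rewrite lt_min invr_gt0 divr_gt0// andbT.
have d1 : d <= 2^-1 by rewrite ge_min lexx.
have dl : M * (d * nc l) <= e.
  rewrite mulrCA (@le_trans _ _ (d * (M * nc l + 1)))//.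
    by rewrite ler_wpM2l ?(ltW d0)// lerDl.
  by rewrite -ler_pdivlMr// ge_min lexx orbT.
pose s := 1 - d.
have s01 : 0 < s < 1 by rewrite /s; apply/andP; split; lra.
have [s0 s1] := andP s01.
(* If [r = 0], then also [l = 0] by [hlr]; the quotient is 0 by convention, so [c = 0], and the
   spare rows have no residual. *)
pose c := - (s%:C%C * (l / r)).
have hc : l + c * r = d%:C%C * l.
  have [r0|r0] := eqVneq r 0.
    by rewrite r0 nc0 in hlr; rewrite (nc_le0 hlr) r0 !mulr0 addr0.
  have -> : c = - ((1 - d%:C%C) * (l / r)).
    congr (- (_ * _)); apply/eqP; by rewrite eq_complex /= subr0 !eqxx.
  by field.
have cs : nc c <= s.
  rewrite /c ncN ncM [nc (l / r)]ncM ncV nc_real ger0_norm ?(ltW s0)// ler_piMr ?(ltW s0)//.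
  have [r0|r0] := eqVneq r 0; first by rewrite r0 nc0 invr0 mulr0.
  by rewrite ler_pdivrMr ?nc_gt0// mul1r.
pose a (k : nat) := c ^+ k.
have la : lp p a := lp_geometric p1 s01 cs.
have [B [B0 hB minB]] := lp_norm (i := 0%N) p1 la (oner_neq0 _).
(* Numbering the nonnegative integers by position in the block and block number, the chain becomes
   [tens x' a] and its residual [tens (y' + w) a]. *)
pose f (k : 'I_n.+1 * nat) : int := (k.2 * n.+1 + k.1)%N%:Z.
have fi : injective f.
  move=> [j k] [j' k'] /= [e1].
  have jj : j = j' :> nat.
    by have := congr1 (modn^~ n.+1) e1; rewrite !modnMDl !modn_small.
  move: e1; rewrite jj => /addIn/eqP; rewrite eqn_mul2r /= => /eqP ->.
  by congr pair; exact/val_inj.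
have fs' (z : int -> R[i]) : supp NN z -> forall i, z i != 0 -> exists k, i = f k.
  move=> sz i zi; have /(ex_divn n)[q [u [hu ->]]] : 0 <= i.
    by have : NN i by apply: contraNT zi => /sz ->.
  by exists (Ordinal hu, q).
pose X := chain n c x.
have sX : supp NN X by move=> i hi; apply: chain_neg; move: hi; rewrite /NN -ltNge.
pose x' (j : 'I_n.+1) := x (emb_ord j).
have eX : X \o f = tens x' a.
  by apply/funext => -[j k]; rewrite /= /X /f chainE//= /tens mulrC.
have FDS : supp (FD n.+1) x.
  by move=> i hi; apply: sx; move: hi; rewrite /FD; ilia.
have [X0 X00 hX0] := lpnorm_fin p1 (lp_ord x' p1).
have lX : lp p X.
  apply: (@lple_lp _ _ p _ (X0 * B)) => //; first by rewrite mulr_ge0// ltW.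
  apply/(lpnorm_inj p1 fi (fs' _ sX)); rewrite ?mulr_ge0// ?ltW//.
  by rewrite eX; apply: tens_lple => //; exact: ltW.
pose J' := perj J n t.
pose G := mask NN (op J' X).
have sG : supp NN G by exact: supp_mask.
pose y' (j : 'I_n.+1) := mask (FD n) (op J x) (emb_ord j).
pose w (j : 'I_n.+1) := d%:C%C * l * e_ n%:Z (emb_ord j).
have eG : G \o f = tens (fun j => y' j + w j) a.
  apply/funext => -[j k]; rewrite /= /G /mask /f /= op_chain//.
  rewrite /tens /y' /w /mask /emb_ord /e_ /= [Posz j == _](_ : _ = (j == n :> nat)); last by [].
  rewrite (_ : FD n j = (j != n :> nat)); last first.
    by rewrite /FD; have := ltn_ord j; ilia.
  by case: eqP => _ /=; rewrite -?/l -?/r ?hc /a; ring.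
have hy' : lple p y' Y.
  apply/(@lple_ord p n.+1) => // i hi; rewrite /mask ifF//; apply/negbTE.
  by move: hi; rewrite /FD; ilia.
have hw : lple p w (d * nc l * 1).
  apply: (lpleZ p1 ler01 (x := fun j : 'I_n.+1 => e_ n%:Z (emb_ord j))).
  - by rewrite mulr_ge0 ?nc_ge0// ltW.
  - by move=> j; rewrite /w !ncM nc_real ger0_norm// ltW.
  - apply/(@lple_ord p n.+1) => //; last exact: lple_e.
    by move=> i hi; rewrite /e_; case: eqP hi => // ->; rewrite /FD; ilia.
rewrite mulr1 in hw.
have dl0 : 0 <= d * nc l by rewrite mulr_ge0 ?nc_ge0// ltW.
have Yd : 0 <= Y + d * nc l by rewrite addr_ge0.
have hG : lple p G ((Y + d * nc l) * B).
  apply/(lpnorm_inj p1 fi (fs' _ sG)); first by rewrite mulr_ge0// ltW.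
  by rewrite eG; apply: tens_lple => //; [exact: ltW|exact: minkowski].
have := hH J' (cls_perj n cJ ct) X _ lX sX _ hG.
move=> /(_ (mulr_ge0 Yd (ltW B0))).
have MB : 0 <= M * ((Y + d * nc l) * B) by rewrite !mulr_ge0// ltW.
move=> /(lpnorm_inj p1 fi (fs' _ sX) MB); rewrite eX.
(* The norm [B] of the geometric sequence cancels, which is why the constant is [M] itself, up to
   the error [e] removed at the start. *)
move=> /(lple_tens p1 MB B0 minB); rewrite mulrA mulfK ?gt_eqF//.
have MY : 0 <= M * (Y + d * nc l) by rewrite mulr_ge0.
move=> /(lple_ord p1 MY FDS); apply: lple_le => //.
by rewrite mulrDr lerD2l.
Qed.

Lemma lple_rev p n x M : (1 <= p)%E -> 0 <= M -> lple p x M -> lple p (rev n x) M.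
Proof.
move=> p1 M0 hx; have fi : injective (fun i : int => n%:Z - 1 - i).
  by move=> i j /= h; clear -h; lia.
have hs k : x k != 0 -> exists i : int, k = n%:Z - 1 - i.
  by move=> _; exists (n%:Z - 1 - k); clear; lia.
exact/(lpnorm_inj p1 fi hs M0).
Qed.

(** Row 0 of [J], as some row of the class, serves as the spare row. If its comparison of end values
    goes the wrong way, reflecting the block and reversing the row exchanges the two sides. *)
Lemma finite_norm_lb U V W p M J n : (1 <= p)%E -> 0 <= M ->
  (forall J', cls U V W J' -> norm_lb p NN J' M) ->
  (forall J', cls W V U J' -> norm_lb p NN J' M) ->
  cls U V W J -> (0 < n)%N -> norm_lb p (FD n) J M.
Proof.
move=> p1 M0 h1 h2 cJ n0 z Y lz sz Y0 hY.
have ct := cJ 0.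
have [le|/ltW le] := leP (nc ((J 0).1.1 * z (n%:Z - 1))) (nc ((J 0).2 * z 0)).
  exact: (chain_norm_lb p1 M0 h1 cJ ct n0 sz Y0 hY le).
have rr : z = rev n (rev n z).
  by apply/funext => i; rewrite /rev; congr z; clear; lia.
rewrite rr; apply: lple_rev => //; first by rewrite mulr_ge0.
apply: (@chain_norm_lb W V U p M (revj n J) n ((J 0).2, (J 0).1.2, (J 0).1.1)) => //.
- exact: cls_revj.
- by have [] := ct.
- exact: supp_rev.
- apply: lple_mono (lple_rev n p1 Y0 hY) => // i.
  rewrite /mask op_rev /rev (_ : FD n (n%:Z - 1 - i) = FD n i)//.
  by rewrite /FD; clear; lia.
- rewrite /rev /= (_ : n%:Z - 1 - (n%:Z - 1) = 0); last by clear; lia.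
  by rewrite subr0.
Qed.

Lemma norm_solvable_revj q n J M : (1 <= q)%E -> 0 <= M -> norm_solvable q (FD n) (revj n J) M -> norm_solvable q (FD n) J M.
Proof.
move=> q1 M0 /(norm_solvable_sh q1 M0)/(norm_solvable_flip q1 M0).
rewrite (_ : (fun i => _) = FD n)//; apply/funext => i; rewrite /FD; clear; lia.
Qed.

(** The chain argument at [p = +oo], where [norm_lb] is a bound in the sup norm; [M >= 1] covers the
    identity rows. *)
Lemma halfline_lb_interval_lb U V W C C' : halfline_lb U V W C -> halfline_lb W V U C' ->
  exists2 C'', 0 < C'' & interval_lb U V W C''.
Proof.
pose M := Num.max 1 (Num.max C C'); have M1 : 1 <= M by rewrite le_max lexx.
have M0 : 0 <= M by exact: le_trans M1.
have nH U' V' W' c : c <= M -> halfline_lb U' V' W' c -> forall J, cls U' V' W' J -> norm_lb +oo%E NN J M.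
  move=> cM h J cJ z Y /(lpnorm_fin (leey 1))[X X0 hX] sz Y0 hY i.
  have bz : bnd (op (cut NN J) z) Y by move=> k; rewrite op_cut_supp//; exact: hY.
  by apply: (le_trans (h J cJ z X Y hX bz i)); rewrite ler_wpM2r.
have CM : C <= M by rewrite !le_max lexx orbT.
have CM' : C' <= M by rewrite !le_max lexx !orbT.
move=> /(nH _ _ _ _ CM) h1 /(nH _ _ _ _ CM') h2; exists M; first exact: lt_le_trans M1.
move=> J n cJ x X d hx hd i; have d0 := bnd_ge0 hd.
have [hi|hi] := boolP (FD n i); last first.
  have := hd i; rewrite op_cut (negbTE (hi : ~~ (0 <= i < n%:Z))) => h.
  by rewrite (le_trans h)// ler_peMl.
have n0 : (0 < n)%N by move: hi; rewrite /FD; clear; lia.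
have lx : lp +oo%E (mask (FD n) x).
  exact: (lple_lp (leey 1) (bnd_ge0 hx) (mask_bnd (FD n) hx)).
have hm : lple +oo%E (mask (FD n) (op J (mask (FD n) x))) d.
  move=> k; rewrite /mask; case: ifP => hk; last by rewrite nc0.
  by have := hd k; rewrite op_cut (hk : 0 <= k < n%:Z).
have sm : supp (FD n) (mask (FD n) x) by exact: supp_mask.
have := finite_norm_lb (leey 1) M0 h1 h2 cJ n0 lx sm d0 hm i.
by rewrite /mask hi.
Qed.

End ChainNorm.

(** * Index and stability in the presence of a kernel *)

Section TruncatedKernel.
Context {R : realType}.
Implicit Types (J : jac R) (g x : int -> R[i]).

(** Cutting a kernel vector after index [n] affects two rows: row [n], which loses [g (n + 1)], and
    row [n + 1], which sees only [g n]. Both residuals are exponentially small. *)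
Lemma op_mask_kernel J g (n : nat) (K k s : R) : bdd K J -> 1 < s -> 0 <= k ->
  supp NN g -> (forall i, 0 <= i -> op J g i = 0) -> (forall m : int, nc (g m) <= k / s ^+ `|m|) ->
  forall i, 0 <= i -> nc (op J (mask (fun i => i <= n%:Z) g) i) <=
    if (i == n%:Z) || (i == n.+1%:Z) then K * (k / s ^+ n) else 0.
Proof.
move=> hJ s1 k0 sg eg dg i i0; have s0 : 0 < s by exact: lt_trans ltr01 s1.
have K0 := bdd_ge0 hJ; have [hl hd hu] := hJ i.
have m1 j : (j <= n%:Z) -> mask (fun i => i <= n%:Z) g j = g j by rewrite /mask => ->.
have m0 j : ~~ (j <= n%:Z) -> mask (fun i => i <= n%:Z) g j = 0 by rewrite /mask => /negbTE ->.
have [h|h] := leP (i + 1) n%:Z.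
  rewrite (_ : op _ _ i = 0).
    by rewrite nc0; case: ifP => // _; rewrite mulr_ge0// divr_ge0// exprn_ge0// ltW.
  rewrite -(eg i i0) /op !m1//; clear -h; lia.
have [e|ne] := eqVneq i n%:Z.
  have -> : op J (mask (fun i => i <= n%:Z) g) i = - (up J i * g (i + 1)).
    have := eg i i0; rewrite /op (m0 (i + 1)); last by clear -h; lia.
    rewrite !m1 ?e//; last by clear; lia.
    by rewrite mulr0 addr0 => h2; apply/eqP; rewrite -addr_eq0 h2.
  rewrite ncN ncM ler_pM ?nc_ge0// (le_trans (dg _))// ler_wpM2l//.
  by rewrite lef_pV2 ?posrE ?exprn_gt0// ler_weXn2l ?ltW// e; clear; lia.
have [e1|ne1] := eqVneq i n.+1%:Z.
  rewrite orbT /op (m0 i) ?(m0 (i + 1)) ?mulr0 ?addr0; [|by clear -e1; lia..].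
  rewrite m1; last by clear -e1; lia.
  rewrite ncM ler_pM ?nc_ge0// (_ : i - 1 = n%:Z) ?dg//; last by clear -e1; lia.
rewrite /= /op !m0 ?mulr0 ?addr0 ?nc0//; clear -h ne ne1; lia.
Qed.

Lemma fs_mask_le g (n : nat) : supp NN g -> fs n (mask (fun i => i <= n%:Z) g).
Proof.
move=> sg i hi; rewrite /mask; case: ifP => // h; apply: sg; rewrite /NN; clear -h hi; lia.
Qed.

Lemma geometric_ge (s : R) n : 1 <= s -> n%:R * (s - 1) <= s ^+ n.
Proof.
move=> s1; elim: n => [|n IH]; first by rewrite mul0r expr0.
have h : (s - 1) * 1 <= (s - 1) * s ^+ n by rewrite ler_wpM2l ?subr_ge0// exprn_ege1.
by rewrite exprS -natr1; lra.
Qed.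

Lemma ler_geometric0 (a B s : R) : 1 < s -> 0 <= B -> (forall n : nat, a <= B / s ^+ n) -> a <= 0.
Proof.
move=> s1 B0 h; rewrite leNgt; apply/negP => a0.
have s0 : 0 < s - 1 by rewrite subr_gt0.
pose n := Num.truncn (B / (a * (s - 1))).
have hn : B / (a * (s - 1)) < n.+1%:R by exact: Num.Theory.truncnS_gt.
have b : n.+1%:R * (s - 1) <= s ^+ n.+1.
  by apply: geometric_ge; exact: ltW.
have := h n.+1; rewrite ler_pdivlMr ?exprn_gt0 ?(lt_trans _ s1)//; apply/negP; rewrite -ltNge.
apply: lt_le_trans (_ : a * (n.+1%:R * (s - 1)) <= _); last by rewrite ler_pM2l.
by rewrite mulrCA -ltr_pdivrMr// mulr_gt0.
Qed.

End TruncatedKernel.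

(** * Index -1, and instability of finite sections *)

Section NegativeIndex.
Context {R : realType} (U V W : set R[i]) (U0 : U !=set0) (V0 : V !=set0) (W0 : W !=set0).
Context (cU : compact (U : set (R[i])^o)) (cV : compact (V : set (R[i])^o)).
Context (cW : compact (W : set (R[i])^o)).
Context (K : R) (K0 : 0 <= K) (hK : forall J, cls U V W J -> bdd K J).
Context (hK' : forall J, cls W V U J -> bdd K J).
Context (C : R) (C0 : 0 < C) (hI : line_lb U V W C).
Implicit Types (J : jac R) (p : \bar R).

(** A kernel vector [g] of the transpose annihilates the range, while its first entry is 1. It is
    cut off at [n] in order to be paired with [z], and the error tends to 0. *)
Lemma e0_notin_range J z X (c : R[i]) : halfline_ker W V U -> cls U V W J -> bnd z X -> supp NN z ->
  (forall i, 0 <= i -> op J z i = c * e_ 0 i) -> c = 0.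
Proof.
move=> hP cJ hz sz ez.
have [k [s [k0 s1 /(_ (tr J) (cls_tr cJ))[g [sg g0 ge gd]]]]] :=
  kernel_decay cW cV cU K0 hK' hK C0 (line_lb_flip hI) hP.
have s0 : 0 < s by exact: lt_trans ltr01 s1.
have X0 : 0 <= X by apply: le_trans (hz 0); exact: nc_ge0.
apply/nc_le0; apply: (@ler_geometric0 _ _ (2 * (K * k * X)) s) => // [|n].
  by rewrite !mulr_ge0.
pose gn := mask (fun i => i <= n%:Z) g.
have fg : fs n gn := fs_mask_le sg.
have : pr gn (op J z) = c.
  transitivity (pr gn (fun i => c * e_ 0 i + 0)).
    rewrite !(prE _ fg); apply: eq_bigr => a _.
    have [h|h] := boolP (NN (pos n a)); first by rewrite ez// addr0.
    by rewrite /gn /mask sg//; case: ifP; rewrite !mul0r.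
  have := prDr (e_ 0) (fun=> 0) c fg; rewrite (pr_e _ fg) /gn /mask /= g0 mulr1 => ->.
  by rewrite (prE _ fg) big1 ?addr0// => a _; rewrite mulr0.
rewrite (pr_adj _ _ fg) => <-.
have hb i : 0 <= i -> _ := op_mask_kernel n (tr_bdd (hK cJ)) s1 k0 sg ge gd (i := i).
pose f i := op (tr J) gn i * z i.
have f0 i : i != n%:Z -> i != n.+1%:Z -> f i = 0.
  move=> h1 h2; rewrite /f; have [h|h] := boolP (NN i); last by rewrite (sz _ h) mulr0.
  by have := hb i h; rewrite (negbTE h1) (negbTE h2) /= => /nc_le0 ->; rewrite mul0r.
rewrite /pr -/f (@isum3 _ f n%:Z) => [|i hi]; last by apply: f0; clear -hi; lia.
rewrite f0 ?add0r; [|by clear; lia..].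
have fb i : (i == n%:Z) || (i == n.+1%:Z) -> nc (f i) <= K * k * X / s ^+ n.
  move=> h; have i0 : 0 <= i by clear -h; lia.
  have := hb i i0; rewrite h => h1; rewrite ncM.
  rewrite (_ : K * k * X / s ^+ n = K * (k / s ^+ n) * X); last by ring.
  by rewrite ler_pM ?nc_ge0.
rewrite (le_trans (ncD _ _))// [leRHS](_ : _ = K * k * X / s ^+ n + K * k * X / s ^+ n); last by ring.
by rewrite lerD// fb ?eqxx// -PoszD addn1 eqxx orbT.
Qed.

(** The kernel is trivial by [coburn]. Cutting a solution on the whole line down to the half-line
    changes the residual in row 0 alone, so [e_ 0] spans the cokernel; [e0_notin_range] makes the
    coefficient unique. *)
Lemma dual_halfline_ker_index p A : halfline_ker W V U -> (1 <= p)%E -> Mplus U V W A -> fredholm_with_index p A (-1).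
Proof.
move=> hP p1 hA; have [J cJ rJ] := ex_repr emb_natK inv_natK U0 V0 W0 hA.
have [[C2 h2]|hP'] := halfline_lb_or_halfline_ker hK cU cV cW (ltW C0) hI; last first.
  by case: (coburn hK hK' hI (ltW C0) hP' hP).
have le0 : lp p (res Posz (e_ 0) : nat -> R[i]).
  by apply: (lp_res emb_natK inv_natK p1); exact: lple_lp (lple_e 0 p1).
exists 0%N, 1%N; split => //.
  apply: quotient_dim0 => x [lx /= hx]; have [X hX] := lp_bnd emb_natK inv_natK p1 lx.
  apply/funext => i; apply/nc_le0; rewrite -(ext_emb emb_natK x) -(mulr0 C2).
  apply: (h2 J cJ _ _ _ hX) => k; rewrite -dom_nat -(ext_matop emb_natK inv_natK _ _ rJ) hx.
  by rewrite /ext; case: (inv_nat k) => *; rewrite nc0.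
apply: (@quotient_dim1 _ _ _ _ (res Posz (e_ 0)) le0) => y ly.
have [A' _ rA'] := ex_mat id cJ.
have ley : lp p (ext inv_nat y).
  have [M M0 hM] := lpnorm_fin p1 ly; apply: (lple_lp p1 M0).
  exact/(lple_ext emb_natK inv_natK).
have [|z lz hz] := tr_lb_surjective (fun i : int => erefl (Some i)) inv_intK C0 (hK cJ) rA' _ p1 ley.
  by rewrite cut_id; exact: (line_lb_flip hI (cls_tr cJ)).
have hz' i : op J z i = ext inv_nat y i.
  by rewrite -hz (matop_op (fun i : int => erefl (Some i)) inv_intK _ _ rA').
pose x := res Posz z; pose t := lo J 0 * z (-1).
have lx : lp p x := lp_res emb_natK inv_natK p1 lz.
have ex : ext inv_nat x = mask NN z by apply/funext => -[].
have Ax : matop A x = fun i => y i - t * res Posz (e_ 0) i.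
  apply/funext => i; rewrite (matop_op emb_natK inv_natK _ _ rJ) ex.
  have := hz' i; rewrite (_ : ext _ y i = y i)// => <-.
  rewrite /res /e_ /op; case: i => [|i].
    by rewrite /mask sub0r add0r /= mulr1 mulr0 /t; ring.
  have h1 : NN (i.+1%:Z - 1) by rewrite /NN; clear; lia.
  by rewrite /mask h1 /= mulr0 subr0.
exists t; split; first by exists x.
move=> t' [x' lx' hx']; apply/eqP; rewrite -subr_eq0 -oppr_eq0; apply/eqP.
have lw : lp p (fun i => -1 * x' i + x i) by exact: lp_lin.
have [X hX] := lp_bnd emb_natK inv_natK p1 lw.
apply: (@e0_notin_range J (ext inv_nat (fun i => -1 * x' i + x i)) X) => //.
  by rewrite -dom_nat; exact: ext_supp.
move=> i i0; have -> : i = Posz (absz i) by clear -i0; lia.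
rewrite -(matop_op emb_natK inv_natK _ _ rJ) (matop_lin emb_natK inv_natK _ _ _ rJ).
by rewrite hx' Ax /res; ring.
Qed.

Lemma trichotomy : [\/ exists2 C' : R, 0 < C' & interval_lb U V W C', halfline_ker U V W | halfline_ker W V U].
Proof.
have [[C1 h1]|hP] := halfline_lb_or_halfline_ker hK cU cV cW (ltW C0) hI; last by apply: Or32.
have [[C2 h2]|hP] := halfline_lb_or_halfline_ker hK' cW cV cU (ltW C0) (line_lb_flip hI); last by apply: Or33.
have [C3 C30 h3] := halfline_lb_interval_lb h1 h2; by apply: Or31; exists C3.
Qed.

(** What the full method on l^p provides whatever [p] is: solutions of the finite sections that are
    bounded in the sup norm. *)
Definition stable_sections p J := forall b, lp p b -> exists (X : R) (n0 : nat),
  forall n, (n0 <= n)%N -> exists x : int -> R[i], [/\ fs n x, bnd x X &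
    forall i, (`|i| <= n)%N -> op J x i = b i].

(* Kernel vectors of tr J on the half-lines from - n, cut off at n, are almost
   annihilated by the transposed finite sections. *)
Lemma stable_sections_no_dual_ker p J : (1 <= p)%E -> cls U V W J -> halfline_ker W V U ->
  stable_sections p J -> False.
Proof.
move=> p1 cJ hP hS.
have [k [s [k0 s1 hg]]] := kernel_decay cW cV cU K0 hK' hK C0 (line_lb_flip hI) hP.
have s0 : 0 < s by exact: lt_trans ltr01 s1.
have /choice[g {}hg] := fun n : nat => hg _ (cls_sh (- n%:Z) (cls_tr cJ)).
pose h n i : R[i] := mask (fun i => i <= (2 * n)%:Z) (g n) (i + n%:Z).
have fh n : fs n (h n).
  have [sg _ _ _] := hg n; move=> i hi; rewrite /h /mask; case: ifP => // h1.
  by apply: sg; rewrite /NN; clear -h1 hi; lia.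
have oph n i : op (tr J) (h n) i =
    op (sh (- n%:Z) (tr J)) (mask (fun i => i <= (2 * n)%:Z) (g n)) (i + n%:Z).
  rewrite -op_sh (_ : sh n%:Z _ = tr J)//; apply/funext => j; by rewrite /sh addrK.
pose B := K * k.
have B0 : 0 <= B by rewrite mulr_ge0.
have prh n x X : fs n x -> bnd x X -> nc (pr (op (tr J) (h n)) x) <= B * X / s ^+ (2 * n).
  move=> fx hx; have [sg g0 ge gd] := hg n.
  have hb i : 0 <= i -> _ := op_mask_kernel (2 * n) (hK' (cls_sh (- n%:Z) (cls_tr cJ))) s1 k0 sg ge gd (i := i).
  (* Of the two residual rows left by the cut, only row [n] lies in the window; the other is at
     [n + 1], where [x] vanishes. *)
  pose f i := op (tr J) (h n) i * x i.
  have f0 i : i != n%:Z -> f i = 0.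
    move=> h1; have [h2|h2] := leqP `|i| n; last by rewrite /f (fx _ h2) mulr0.
    have i0 : 0 <= i + n%:Z by clear -h2; lia.
    have := hb _ i0; rewrite ifF => [/nc_le0|]; last by clear -h1 h2; lia.
    by rewrite /f oph => ->; rewrite mul0r.
  rewrite /pr -/f (@isum3 _ f n%:Z) => [|i hi]; last by apply: f0; clear -hi; lia.
  rewrite (f0 (n%:Z - 1)) ?(f0 (n%:Z + 1)) ?add0r ?addr0; [|by clear; lia..].
  rewrite /f ncM oph (_ : B * X / s ^+ (2 * n) = K * (k / s ^+ (2 * n)) * X); last by rewrite /B; ring.
  have i0 : 0 <= n%:Z + n%:Z by clear; lia.
  have := hb _ i0; rewrite ifT => [h1|]; last by clear; lia.
  by rewrite ler_pM ?nc_ge0.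
(* Stability bounds [pr (h n) b] by a multiple of [s ^- (2 * n)], which outweighs the factor [n], so
   these functionals are pointwise bounded. Their entry at [-n] is [n], which contradicts uniform
   boundedness. *)
pose F : set (int -> R[i]) := [set f | exists n : nat, f = fun i => n%:R * h n i].
have fF n : fs n (fun i => n%:R * h n i) by move=> i hi; rewrite fh// mulr0.
have prF n b : pr (fun i => n%:R * h n i) b = n%:R * pr (h n) b.
  rewrite (prE _ (fF n)) (prE _ (fh n)) mulr_sumr; apply: eq_bigr => a _; by rewrite mulrA.
have ncn (n : nat) : nc (n%:R : R[i]) = n%:R.
  by rewrite (_ : n%:R = (n%:R : R)%:C%C) ?nc_real ?ger0_norm// rmorph_nat.
have bern (n : nat) : n%:R * (s - 1) <= s ^+ n.
  by apply: geometric_ge; exact: ltW.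
have [||M M0 hM] := @uniform_boundedness R p F p1.
- by move=> f [n ->]; exists n.
- move=> b lb'; have [X [n0 hX]] := hS b lb'.
  exists (B * `|X| / (s - 1) + \sum_(n < n0) nc (n%:R * pr (h n) b)) => f [n ->].
  rewrite prF; have [hn|hn] := ltnP n n0.
    rewrite (bigD1 (Ordinal hn))//= addrCA lerDl addr_ge0//.
      by rewrite !mulr_ge0 ?invr_ge0// subr_ge0 ltW.
    by rewrite sumr_ge0// => j _; exact: nc_ge0.
  have [x [fx hx ex]] := hX n hn.
  have X0 : 0 <= X by apply: le_trans (hx 0); exact: nc_ge0.
  have -> : pr (h n) b = pr (op (tr J) (h n)) x.
    rewrite -(pr_adj _ _ (fh n)) !(prE _ (fh n)); apply: eq_bigr => a _.
    by rewrite ex// pos_le.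
  rewrite ncM ncn ger0_norm// -[leLHS]addr0 lerD//; last first.
    by rewrite sumr_ge0// => j _; exact: nc_ge0.
  apply: le_trans (_ : n%:R * (B * X / s ^+ (2 * n)) <= _).
    by rewrite ler_wpM2l// prh.
  rewrite mulrCA ler_wpM2l ?mulr_ge0// ler_pdivrMr ?exprn_gt0// mulrC.
  rewrite ler_pdivlMr ?subr_gt0// (le_trans (bern n))// ler_weXn2l ?ltW//.
  by clear; lia.
pose n := (Num.truncn M).+1.
have := dual_le_coord (- n%:Z) p1 (fF n) (hM _ (ex_intro _ n erefl)).
have [_ g0 _ _] := hg n.
rewrite /h /mask addNr (_ : 0 <= (2 * n)%:Z)// g0 mulr1 ncn leNgt.
by rewrite Num.Theory.truncnS_gt.
Qed.

End NegativeIndex.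

Section StableSections.
Context {R : realType}.
Implicit Types (J : jac R) (p : \bar R).

Let int_embK (i : int) : Some i = Some i := erefl.

Lemma stable_flip p J : (1 <= p)%E -> stable_sections p J -> stable_sections p (flip J).
Proof.
move=> p1 h b /(lpnorm_fin p1)[M M0 hM].
have lb' : lp p (fun i : int => b (- i)).
  apply: (lple_lp p1 M0).
  have hs : forall j : int, b j != 0 -> exists i : int, j = - i.
    by move=> j _; exists (- j); rewrite opprK.
  exact/(lpnorm_inj p1 (@oppr_inj int) hs M0).
have [X [n0 hX]] := h _ lb'; exists X, n0 => n /hX[x [fx hx ex]].
exists (fun i => x (- i)); split => [i hi|i|i hi]; first by apply: fx; rewrite abszN.
  exact: hx.
by rewrite op_flip ex ?abszN// opprK.
Qed.

Lemma approximates_bnd p (xs : nat -> int -> R[i]) x : (1 <= p)%E -> lp p x ->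
  approximates p xs x -> exists X : R, \forall n \near \oo, bnd (xs n) X.
Proof.
move=> p1 lx; case: (ge1_cases p1) => [pE|[r pE r1]].
  rewrite pE => -[[M hM] _]; exists `|M|; near=> n => i.
  have h : (lpnorm +oo%E (xs n) <= `|M|%:E)%E.
    by apply: (@le_trans _ _ M%:E); [near: n; exact: hM|rewrite lee_fin ler_norm].
  by move/(lpnorm_leP _ (leey _) (normr_ge0 M)): h; exact.
rewrite pE => h.
have [X X0 hX] := lpnorm_fin p1 lx; exists (1 + X).
have /fine_cvgP[hf h1] : lpnorm p (fun j => xs n j - x j) @[n --> \oo] --> (0 : R)%:E.
  by rewrite pE.
have h2 := cvgr0_norm_le _ h1 1 ltr01.
near=> n => i.
have hn : lple p (fun j => xs n j - x j) 1.
  apply/lpnorm_leP => //; rewrite -(@fineK _ (lpnorm p _)).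
    rewrite lee_fin (le_trans (ler_norm _))//; near: n; exact: h2.
  by near: n; exact: hf.
rewrite -[xs n i](subrK (x i)) (le_trans (ncD _ _))// lerD//.
  exact: (lple_coord i p1 ler01 hn).
exact: lple_coord hX.
Unshelve. all: by end_near. Qed.

Lemma fsm_stable p A J : (1 <= p)%E -> repr id J A -> full_fsm p A -> stable_sections p J.
Proof.
move=> p1 rJ [[T [[bT _ _] hT]] [n1 _ hu] hap] b lb'.
pose D n : set int := [set i : int | - n%:Z <= i <= n%:Z].
have /choice[xs hxs] : forall n, exists x, (n1 <= n)%N -> truncated_solution A (D n) b x.
  move=> n; have [h|h] := leqP n1 n; last by exists (fun=> 0).
  by have [x [hx _]] := hu n h b lb'; exists x.
have [e1 e2] := hT b lb'.
have [X [n2 _ hX]] := approximates_bnd p1 (bT b lb') (hap b (T b) xs lb' (bT b lb') e1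
  (ex_intro2 _ _ n1 I (fun n => hxs n))).
exists X, (maxn n1 n2) => n; rewrite geq_max => /andP[h1 h2].
pose E (n : nat) : pred int := fun i => - n%:Z <= i <= n%:Z.
have DE i : D n i <-> E n i by [].
have := hxs n h1.
move=> /(truncatedP int_embK inv_intK rJ (E := E n) _ _ DE (fun _ _ => isT))[sx ex].
have ex' : ext Some (xs n) = xs n by [].
exists (xs n); split => [i hi||i hi].
- by apply: sx; rewrite /E; clear -hi; lia.
- exact: hX.
have Ei : E n i by rewrite /E; clear -hi; lia.
by have := ex i; rewrite op_cut_supp// Ei /mask Ei.
Qed.

End StableSections.

Section Core.
Context {R : realType} (U V W : set R[i]) (U0 : U !=set0) (V0 : V !=set0) (W0 : W !=set0).
Context (cU : compact (U : set (R[i])^o)) (cV : compact (V : set (R[i])^o)).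
Context (cW : compact (W : set (R[i])^o)).
Implicit Types (J : jac R) (p : \bar R).

Let int_embK (i : int) : Some i = Some i := erefl.

Lemma ex_bound : exists K : R, [/\ 0 <= K, forall J, cls U V W J -> bdd K J &
  forall J, cls W V U J -> bdd K J].
Proof.
have [K K0 hK] := cls_bound cU cV cW.
exists K; split => // J /cls_tr cJ; rewrite -(trK J); exact: tr_bdd (hK _ cJ).
Qed.

Lemma ex_PsiE p : (1 <= p)%E -> exists A, PsiE p U V W A.
Proof.
move=> p1; have [J cJ uJ] := ex_universal U0 V0 W0.
have [A hA rA] := ex_mat id cJ; exists A; split => //.
exact: (@universal_pseudoergodic R int id Posz p U V W A J).
Qed.

Lemma ex_PsiEplus p : (1 <= p)%E -> exists A, PsiEplus p U V W A.
Proof.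
move=> p1; have [J cJ uJ] := ex_universal U0 V0 W0.
have [A hA rA] := ex_mat Posz cJ; exists A; split => //.
exact: (@universal_pseudoergodic R nat Posz id p U V W A J).
Qed.

Lemma PsiE_line_lb p A : (1 <= p)%E -> PsiE p U V W A -> invertible_on p A ->
  exists2 C : R, 0 < C & line_lb U V W C.
Proof.
move=> p1 [hA eA] iA; have [K [K0 hK _]] := ex_bound.
have [J cJ rJ] := ex_repr int_embK inv_intK U0 V0 W0 hA.
have [a [b [_ h _]]] := invertible_fredholm p1 iA.
exact: (quotient_line_lb int_embK inv_intK p1 K0 hK rJ (pseudo_ergodic int_embK p1 rJ eA) h).
Qed.

Lemma index0_interval_lb p A : (1 <= p)%E -> PsiEplus p U V W A -> fredholm_with_index p A 0 ->
  exists2 C : R, 0 < C & interval_lb U V W C.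
Proof.
move=> p1 [hA eA] fA; have [K [K0 hK hK']] := ex_bound.
have [J cJ rJ] := ex_repr emb_natK inv_natK U0 V0 W0 hA.
have [a [b [_ h _]]] := fA.
have [C C0 hC] := quotient_line_lb emb_natK inv_natK p1 K0 hK rJ (pseudo_ergodic emb_natK p1 rJ eA) h.
have [//|hP|hP] := trichotomy cU cV cW hK hK' C0 hC.
  have h1 := halfline_ker_index U0 V0 W0 cU cV cW K0 hK hK' C0 hC hP p1 hA.
  by have := fredholm_unique emb_natK inv_natK p1 rJ fA h1.
have h1 := dual_halfline_ker_index U0 V0 W0 cU cV cW K0 hK hK' C0 hC hP p1 hA.
by have := fredholm_unique emb_natK inv_natK p1 rJ fA h1.
Qed.

(** The class is not empty and the index of an operator is unique, so [xget] has no choice. *)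
Lemma kappaE p k : (1 <= p)%E -> (forall A, Mplus U V W A -> fredholm_with_index p A k) ->
  kappa p U V W = k.
Proof.
move=> p1 h; have [A [hA _]] := ex_PsiEplus p1.
have [J cJ rJ] := ex_repr emb_natK inv_natK U0 V0 W0 hA.
apply: (fredholm_unique emb_natK inv_natK p1 rJ) (h A hA).
by rewrite /kappa; case: xgetP => [k' _ hk'|/(_ k)//]; exact: hk'.
Qed.

Lemma kappa0_interval_lb p : (1 <= p)%E -> compatible p U V W -> kappa p U V W = 0 ->
  exists2 C : R, 0 < C & interval_lb U V W C.
Proof.
move=> p1 hc hk; have [K [K0 hK hK']] := ex_bound.
have [A hA] := ex_PsiE p1; have [C C0 hC] := PsiE_line_lb p1 hA (hc A hA.1).
have [//|hP|hP] := trichotomy cU cV cW hK hK' C0 hC.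
  have := kappaE p1 (fun A0 => @halfline_ker_index _ _ _ _ U0 V0 W0 cU cV cW _ K0 hK hK' _ C0 hC p A0 hP p1); by rewrite hk.
have := kappaE p1 (fun A0 => @dual_halfline_ker_index _ _ _ _ U0 V0 W0 cU cV cW _ K0 hK hK' _ C0 hC p A0 hP p1); by rewrite hk.
Qed.

(** [stable_sections_no_dual_ker] excludes kernels of the transposed class. The windows from [-n] to
    [n] are symmetric, so reflecting [J] excludes the other case as well. *)
Lemma fsm_interval_lb p A : (1 <= p)%E -> PsiE p U V W A -> full_fsm p A ->
  exists2 C : R, 0 < C & interval_lb U V W C.
Proof.
move=> p1 hA fA; have [K [K0 hK hK']] := ex_bound.
have [C C0 hC] : exists2 C : R, 0 < C & line_lb U V W C.
  by apply: PsiE_line_lb p1 hA _; case: fA.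
have [J cJ rJ] := ex_repr int_embK inv_intK U0 V0 W0 hA.1.
have sJ := fsm_stable p1 rJ fA.
have [//|hP|hP] := trichotomy cU cV cW hK hK' C0 hC; exfalso.
  exact: (stable_sections_no_dual_ker cW cV cU K0 hK' hK C0 (line_lb_flip hC) p1 (cls_flip cJ) hP
    (stable_flip p1 sJ)).
exact: (stable_sections_no_dual_ker cU cV cW K0 hK hK' C0 hC p1 cJ hP sJ).
Qed.

Lemma interval_lb_kappa C p : 0 < C -> interval_lb U V W C -> (1 <= p)%E ->
  compatible p U V W /\ kappa p U V W = 0.
Proof.
move=> C0 h p1; have [K [K0 hK hK']] := ex_bound; split.
  move=> A hA; have [k _ hk] := interval_lb_inverse_bi U0 V0 W0 K0 hK hK' C0 h.
  by have [T /(_ p p1)[hT _]] := hk A hA; exists T.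
apply: kappaE => // A hA; apply: invertible_fredholm => //.
have [k _ hk] := interval_lb_inverse_plus U0 V0 W0 K0 hK hK' C0 h.
by have [T /(_ p p1)[hT _]] := hk A hA; exists T.
Qed.

Lemma interval_lb_finitely_invertible C p : 0 < C -> interval_lb U V W C -> (1 <= p)%E ->
  finite_uniformly_invertible p U V W.
Proof.
move=> C0 h p1; have [K [K0 hK hK']] := ex_bound.
have [k _ hk] := interval_lb_finite U0 V0 W0 K0 hK C0 h.
split=> [n F _ hF|]; first by have [] := hk p n F p1 hF.
by exists k => n F _ hF; have [] := hk p n F p1 hF.
Qed.

End Core.

(** * Comparison of the norm quantities *)

Section NormComparison.
Context {R : realType} (U V W : set R[i]) (U0 : U !=set0) (V0 : V !=set0) (W0 : W !=set0).
Context (K : R) (K0 : 0 <= K) (hK : forall J, cls U V W J -> bdd K J).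
Context (hK' : forall J, cls W V U J -> bdd K J).
Context (C : R) (C0 : 0 < C) (hF : interval_lb U V W C).
Implicit Types (J : jac R) (p q : \bar R).

Let int_embK (i : int) : Some i = Some i := erefl.

Lemma Nplus_le p (M : R) : (1 <= p)%E -> (Nplus p U V W <= M%:E)%E <->
  (forall A T, Mplus U V W A -> inverse_on p A T -> (opnorm p T <= M%:E)%E).
Proof.
move=> p1; split=> [h A T hA hT|h].
  by rewrite -(invnormE p1 hT); apply: le_trans h; apply: ereal_sup_ubound; exists A.
have [k _ hk] := interval_lb_inverse_plus U0 V0 W0 K0 hK hK' C0 hF.
apply: ge_ereal_sup => _ [A hA <-]; have [T /(_ p p1)[hT _]] := hk A hA.
by rewrite (invnormE p1 hT); exact: h hT.
Qed.

Lemma Nbi_le p (M : R) : (1 <= p)%E -> (Nbi p U V W <= M%:E)%E <->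
  (forall A T, Mbi U V W A -> inverse_on p A T -> (opnorm p T <= M%:E)%E).
Proof.
move=> p1; split=> [h A T hA hT|h].
  by rewrite -(invnormE p1 hT); apply: le_trans h; apply: ereal_sup_ubound; exists A.
have [k _ hk] := interval_lb_inverse_bi U0 V0 W0 K0 hK hK' C0 hF.
apply: ge_ereal_sup => _ [A hA <-]; have [T /(_ p p1)[hT _]] := hk A hA.
by rewrite (invnormE p1 hT); exact: h hT.
Qed.

Lemma finite_inverse p n (F : 'M[R[i]]_n) : (1 <= p)%E -> Mn U V W F ->
  inverse_on p F (matop (invmx F)).
Proof.
move=> p1 hM; have [k _ /(_ p n F p1 hM)[uF hk]] := interval_lb_finite U0 V0 W0 K0 hK C0 hF.
split; first exact: matop_bounded hk.
move=> x _; split; first exact: matop_invmx.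
have := matop_invmx x (_ : invmx F \in unitmx); rewrite unitmx_inv => /(_ uF).
by rewrite invmxK.
Qed.

Lemma Nfin_le p (M : R) : (1 <= p)%E -> (Nfin p U V W <= M%:E)%E <->
  (forall n (F : 'M[R[i]]_n), (0 < n)%N -> Mn U V W F ->
    (opnorm p (matop (invmx F)) <= M%:E)%E).
Proof.
move=> p1; split=> [h n F n0 hM|h].
  have uF := interval_lb_unit U0 V0 W0 (ltW C0) hF hM.
  apply: le_trans h; apply: ereal_sup_ubound; exists n => //; exists F => //.
  by rewrite /invnorm_fin uF.
apply: ge_ereal_sup => _ [n n0 [F hM <-]].
by rewrite /invnorm_fin (interval_lb_unit U0 V0 W0 (ltW C0) hF hM); exact: h.
Qed.

Lemma Nplus_norm_lb p M J : (1 <= p)%E -> 0 <= M -> (Nplus p U V W <= M%:E)%E ->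
  cls U V W J -> norm_lb p NN J M /\ norm_solvable p NN J M.
Proof.
move=> p1 M0 /(Nplus_le _ p1) h cJ; have [A hA rA] := ex_mat Posz cJ.
have [k _ hk] := interval_lb_inverse_plus U0 V0 W0 K0 hK hK' C0 hF.
have [T /(_ p p1)[hT _]] := hk A hA; have hM := h A T hA hT.
rewrite -dom_nat; split; first exact: inverse_norm_lb emb_natK inv_natK _ _ _ _ _ p1 rA hT M0 hM.
exact: inverse_norm_solvable emb_natK inv_natK _ _ _ _ _ p1 rA hT M0 hM.
Qed.

Lemma Nfin_norm_lb p M J n : (1 <= p)%E -> 0 <= M -> (Nfin p U V W <= M%:E)%E -> (0 < n)%N ->
  cls U V W J -> norm_lb p (FD n) J M /\ norm_solvable p (FD n) J M.
Proof.
move=> p1 M0 /(Nfin_le _ p1) h n0 cJ; have [A hA rA] := ex_mat (@emb_ord n) cJ.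
pose F : 'M[R[i]]_n := \matrix_(i, j) A i j.
have FA : fun_of_matrix F = A by apply/funext => i; apply/funext => j; rewrite mxE.
have hM : Mn U V W F by rewrite /Mn /= FA.
have hT := finite_inverse p1 hM; have hN := h n F n0 hM.
rewrite -FA in rA; rewrite -dom_ord.
split; first exact: inverse_norm_lb (@emb_ordK n) (@inv_ordK n) _ _ _ _ _ p1 rA hT M0 hN.
exact: inverse_norm_solvable (@emb_ordK n) (@inv_ordK n) _ _ _ _ _ p1 rA hT M0 hN.
Qed.

Lemma Nfin_of_norm_lb p M : (1 <= p)%E -> 0 <= M ->
  (forall n J, (0 < n)%N -> cls U V W J -> norm_lb p (FD n) J M) -> (Nfin p U V W <= M%:E)%E.
Proof.
move=> p1 M0 h; apply/(Nfin_le _ p1) => n F n0 hM.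
have [J cJ rJ] := ex_repr (@emb_ordK n) (@inv_ordK n) U0 V0 W0 hM.
apply: (norm_lb_opnorm (@emb_ordK n) (@inv_ordK n) p1 rJ (finite_inverse p1 hM) M0).
by rewrite dom_ord; exact: h.
Qed.

Lemma Nfin_le_Nplus p q M : (1 <= p)%E -> (1 <= q)%E -> (p^-1 + q^-1 = 1)%E -> 0 <= M ->
  (Nplus p U V W <= M%:E)%E -> (Nplus q U V W <= M%:E)%E -> (Nfin p U V W <= M%:E)%E.
Proof.
move=> p1 q1 pq M0 hp hq; apply: Nfin_of_norm_lb => // n J n0 cJ.
apply: (finite_norm_lb p1 M0 _ _ cJ n0) => J' cJ'.
  by have [] := Nplus_norm_lb p1 M0 hp cJ'.
apply: (norm_lb_fs_norm_lb p1 (hK' cJ') M0); apply: (norm_solvable_norm_lb_fs p1 q1 pq M0).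
by have [] := Nplus_norm_lb q1 M0 hq (cls_tr cJ').
Qed.

Lemma Nfin_le_conj p q M : (1 <= p)%E -> (1 <= q)%E -> (p^-1 + q^-1 = 1)%E -> 0 <= M ->
  (Nfin q U V W <= M%:E)%E -> (Nfin p U V W <= M%:E)%E.
Proof.
move=> p1 q1 pq M0 hq; apply: Nfin_of_norm_lb => // n J n0 cJ.
apply: (norm_lb_fs_norm_lb p1 (hK cJ) M0); apply: (norm_solvable_norm_lb_fs p1 q1 pq M0); apply: (norm_solvable_revj q1 M0).
by have [] := Nfin_norm_lb q1 M0 hq n0 (cls_revj n (cls_tr cJ)).
Qed.

Lemma Nbi_le_conj p q M : (1 <= p)%E -> (1 <= q)%E -> (p^-1 + q^-1 = 1)%E -> 0 <= M ->
  (Nbi q U V W <= M%:E)%E -> (Nbi p U V W <= M%:E)%E.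
Proof.
move=> p1 q1 pq M0 /(Nbi_le _ q1) hq; apply/(Nbi_le _ p1) => A T hA hT.
have [J cJ rJ] := ex_repr int_embK inv_intK U0 V0 W0 hA.
apply: (norm_lb_opnorm int_embK inv_intK p1 rJ hT M0).
apply: (norm_lb_fs_norm_lb p1 (hK cJ) M0); apply: (norm_solvable_norm_lb_fs p1 q1 pq M0).
have [B hB rB] := ex_mat id (cls_flip (cls_tr cJ)).
have [k _ hk] := interval_lb_inverse_bi U0 V0 W0 K0 hK hK' C0 hF.
have [T' /(_ q q1)[hT' _]] := hk B hB.
have := inverse_norm_solvable int_embK inv_intK q1 rB hT' M0 (hq B T' hB hT').
exact: norm_solvable_flip.
Qed.

Lemma approximates_ucv {I : choiceType} p (xs : nat -> I -> R[i]) x : (1 <= p)%E ->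
  approximates p xs x -> forall j, ucv (xs ^~ j) (x j).
Proof.
move=> p1; case: (ge1_cases p1) => [->|[r pE r1]] h j e e0.
  case: h => _ /(_ j) h.
  have /cvgr0_norm_lt/(_ _ e0) h1 := h; apply: uF_oo; move: h1; apply: filterS => n /=.
  by rewrite ger0_norm// nc_ge0.
move: h; rewrite pE => h.
have /fine_cvgP[hf h1] : lpnorm p (fun j => xs n j - x j) @[n --> \oo] --> (0 : R)%:E.
  by rewrite pE.
have e2 : 0 < e / 2 by rewrite divr_gt0.
have h2 := cvgr0_norm_le _ h1 _ e2.
apply: uF_oo; near=> n => /=.
have hn : lple p (fun j => xs n j - x j) (e / 2).
  apply/lpnorm_leP => //; first exact: ltW.
  rewrite -(@fineK _ (lpnorm p _)).
    rewrite lee_fin (le_trans (ler_norm _))//; near: n; exact: h2.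
  by near: n; exact: hf.
apply: (le_lt_trans (lple_coord j p1 (ltW e2) hn)); lra.
Unshelve. all: by end_near. Qed.

(** The finite section solutions have p-norm at most [M], and they converge coordinatewise to the
    exact solution, also for [p = +oo]; Fatou transfers the bound. *)
Lemma Nplus_le_Nfin p M : (1 <= p)%E -> 0 <= M ->
  (Nfin p U V W <= M%:E)%E -> (Nplus p U V W <= M%:E)%E.
Proof.
move=> p1 M0 hM; apply/(Nplus_le _ p1) => A T hA [bT hT]; apply: opnorm_leP => // b hb.
have lb' := lple_lp p1 ler01 hb.
have [_ [n1 _ hu] hap] := interval_lb_fsm_plus U0 V0 W0 hK hK' C0 hF hA p1.
have [J cJ rJ] := ex_repr emb_natK inv_natK U0 V0 W0 hA.
pose D n : set nat := [set i : nat | (i < n)%N].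
have /choice[xs hxs] : forall n, exists x, lple p x M /\
    ((maxn 1 n1 <= n)%N -> truncated_solution A (D n) b x).
  (* Below the threshold the zero vector stands in, so that the bound [M] holds for all [n]. *)
  move=> n; have [h|h] := leqP (maxn 1 n1) n; last by exists (fun=> 0); split => //; exact: lple0.
  move: h; rewrite geq_max => /andP[n0 h]; have [x [hx _]] := hu n h b lb'.
  exists x; split => //.
  have DE i : D n i <-> FD n (Posz i) by rewrite /D /FD /=; split; ilia.
  have Ed k : FD n k -> dom inv_nat k by rewrite dom_nat /FD /NN => /andP[].
  have [sx ex] := (truncatedP emb_natK inv_natK rJ b x DE Ed).1 hx.
  apply/(lple_ext emb_natK inv_natK) => //; rewrite -[M]mulr1.
  have [h1 _] := Nfin_norm_lb p1 M0 hM n0 cJ.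
  have [X X0 hX] : exists2 X : R, 0 <= X & lple p (fun j : 'I_n => ext inv_nat x (emb_ord j)) X.
    exact: lpnorm_fin p1 (lp_ord _ p1).
  apply: h1 => //.
    by apply: (lple_lp p1 X0); exact/(lple_ord p1 X0 sx).
  have hb' := (lple_ext emb_natK inv_natK b p1 ler01).2 hb.
  apply: lple_mono hb' => // k; have := ex k; rewrite op_cut_supp// /mask.
  by case: ifP => _; [move=> ->|rewrite nc0 nc_ge0].
have [e1 _] := hT b lb'; have [h1 _ _] := bT.
have h2 : \forall n \near \oo, truncated_solution A (D n) b (xs n).
  by exists (maxn 1 n1) => // n /= hn; have [_] := hxs n; exact.
have happ := hap b (T b) xs lb' (h1 b lb') e1 h2.
exact: (lple_fatou p1 M0 (fun n => (hxs n).1) (approximates_ucv p1 happ)).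
Qed.

Lemma opnorm_ge0 {I : choiceType} p (T : (I -> R[i]) -> I -> R[i]) (i : I) : (1 <= p)%E ->
  (0 <= opnorm p T)%E.
Proof.
move=> p1; apply: (@le_trans _ _ (lpnorm p (T (fun=> 0)))).
  by case: (lpnorm_ge0 (T (fun=> 0)) p1) => // h; case: (h i).
by apply: ereal_sup_ubound; exists (fun=> 0) => //=; apply/lpnorm_leP => //; exact: lple0.
Qed.

(** Inequalities between the norm quantities can thus be checked on real upper bounds, without first
    showing that the quantities are finite. *)
Lemma ereal_le_real (a b : \bar R) : (0 <= b)%E ->
  (forall M : R, 0 <= M -> (b <= M%:E)%E -> (a <= M%:E)%E) -> (a <= b)%E.
Proof.
case: b => [b| |]//; last by move=> _ _; rewrite leey.
by rewrite lee_fin => b0; apply.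
Qed.

Lemma Nplus_ge0 p : (1 <= p)%E -> (0 <= Nplus p U V W)%E.
Proof.
move=> p1; have [u Uu] := U0; have [v Vv] := V0; have [w Ww] := W0.
have [//|A hA _] := @ex_mat R nat Posz U V W (fun=> (u, v, w)).
have [k _ hk] := interval_lb_inverse_plus U0 V0 W0 K0 hK hK' C0 hF.
have [T /(_ p p1)[hT _]] := hk A hA.
apply: (le_trans (opnorm_ge0 T 0%N p1)); rewrite -(invnormE p1 hT).
by apply: ereal_sup_ubound; exists A.
Qed.

Lemma Nbi_ge0 p : (1 <= p)%E -> (0 <= Nbi p U V W)%E.
Proof.
move=> p1; have [u Uu] := U0; have [v Vv] := V0; have [w Ww] := W0.
have [//|A hA _] := @ex_mat R int id U V W (fun=> (u, v, w)).
have [k _ hk] := interval_lb_inverse_bi U0 V0 W0 K0 hK hK' C0 hF.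
have [T /(_ p p1)[hT _]] := hk A hA.
apply: (le_trans (opnorm_ge0 T 0 p1)); rewrite -(invnormE p1 hT).
by apply: ereal_sup_ubound; exists A.
Qed.

Lemma Nfin_ge0 p : (1 <= p)%E -> (0 <= Nfin p U V W)%E.
Proof.
move=> p1; have [u Uu] := U0; have [v Vv] := V0; have [w Ww] := W0.
have [//|A hA _] := @ex_mat R 'I_1 (@emb_ord 1) U V W (fun=> (u, v, w)).
pose F : 'M[R[i]]_1 := \matrix_(i, j) A i j.
have FA : fun_of_matrix F = A by apply/funext => i; apply/funext => j; rewrite mxE.
have hM : Mn U V W F by rewrite /Mn /= FA.
apply: (le_trans (opnorm_ge0 (matop (invmx F)) ord0 p1)).
apply: ereal_sup_ubound; exists 1%N => //; exists F => //.
by rewrite /invnorm_fin (interval_lb_unit U0 V0 W0 (ltW C0) hF hM).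
Qed.

Lemma NbiC p q : (1 <= p)%E -> (1 <= q)%E -> (p^-1 + q^-1 = 1)%E ->
  (Nbi p U V W <= Nbi q U V W)%E.
Proof.
move=> p1 q1 pq; apply: ereal_le_real (Nbi_ge0 q1) _ => M M0; exact: Nbi_le_conj.
Qed.

Lemma NfinC p q : (1 <= p)%E -> (1 <= q)%E -> (p^-1 + q^-1 = 1)%E ->
  (Nfin p U V W <= Nfin q U V W)%E.
Proof.
move=> p1 q1 pq; apply: ereal_le_real (Nfin_ge0 q1) _ => M M0; exact: Nfin_le_conj.
Qed.

Lemma Nfin_max p q : (1 <= p)%E -> (1 <= q)%E -> (p^-1 + q^-1 = 1)%E ->
  Nfin p U V W = maxe (Nplus p U V W) (Nplus q U V W).
Proof.
move=> p1 q1 pq; have qp : (q^-1 + p^-1 = 1)%E by rewrite addeC.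
have h r : (1 <= r)%E -> (Nplus r U V W <= Nfin r U V W)%E.
  by move=> r1; apply: ereal_le_real (Nfin_ge0 r1) _ => M M0; exact: Nplus_le_Nfin.
apply/eqP; rewrite eq_le; apply/andP; split; last first.
  by rewrite ge_max h//= (le_trans (h q q1))// NfinC.
apply: ereal_le_real => [|M M0]; first by rewrite le_max Nplus_ge0.
by rewrite ge_max => /andP[]; exact: Nfin_le_Nplus.
Qed.

End NormComparison.

Theorem proposition4p10 (R : realType) (U V W : set R[i])
  (U0 : U !=set0) (V0 : V !=set0) (W0 : W !=set0)
  (cU : compact (U : set (R[i])^o)) (cV : compact (V : set (R[i])^o))
  (cW : compact (W : set (R[i])^o))
  (p0 : \bar R) (hp0 : (1 <= p0)%E) :
  [<-> (* a *) exists2 A, PsiE p0 U V W A & full_fsm p0 A;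
       (* b *) exists2 A, PsiEplus p0 U V W A & full_fsm_plus p0 A;
       (* c *) forall A, Mplus U V W A -> invertible_on p0 A;
       (* d *) (forall A, Mplus U V W A -> invertible_on p0 A) /\
               (exists K : R, forall A, Mplus U V W A ->
                  (invnorm p0 A <= K%:E)%E);
       (* e *) exists2 A, PsiEplus p0 U V W A & invertible_on p0 A;
       (* f *) ~ Sigma_plus p0 U V W 0;
       (* g *) exists2 A, PsiEplus p0 U V W A & fredholm_with_index p0 A 0;
       (* h *) forall A, Mplus U V W A -> fredholm_with_index p0 A 0;
       (* i *) compatible p0 U V W /\ kappa p0 U V W = 0;
       (* j *) forall A, Mbi U V W A -> full_fsm p0 A;
       (* k *) forall A, Mplus U V W A -> full_fsm_plus p0 A;
       (* l *) finite_uniformly_invertible p0 U V W]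
  /\
  (finite_uniformly_invertible p0 U V W ->
   forall p q : \bar R, (1 <= p)%E -> (1 <= q)%E -> (p^-1 + q^-1 = 1)%E ->
     Nfin p U V W = maxe (Nplus p U V W) (Nplus q U V W) /\
     (favourable p U V W -> favourable q U V W ->
      [/\ Nfin p U V W = Nfin q U V W,
          Nfin q U V W = Nplus p U V W,
          Nplus p U V W = Nplus q U V W,
          Nplus q U V W = Nbi p U V W
        & Nbi p U V W = Nbi q U V W])).
Proof.
have [K [K0 hK hK']] := ex_bound cU cV cW.
have [A eA] := ex_PsiE U0 V0 W0 hp0.
have [B eB] := ex_PsiEplus U0 V0 W0 hp0.
(* The hub of the cycle: it does not mention [p0], and from it invertibility, stability and index 0
   all follow. *)
pose interval_lbs := exists2 C : R, 0 < C & interval_lb U V W C.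
have inv_interval_lb B' : PsiEplus p0 U V W B' -> invertible_on p0 B' -> interval_lbs.
  by move=> eB' iB'; apply: (index0_interval_lb U0 V0 W0 cU cV cW hp0 eB'); exact: invertible_fredholm.
have interval_lb_inv : interval_lbs -> forall A', Mplus U V W A' -> invertible_on p0 A'.
  move=> [C C0 hC] A' hA'; have [k _ hk] := interval_lb_inverse_plus U0 V0 W0 K0 hK hK' C0 hC.
  by have [T /(_ p0 hp0)[hT _]] := hk A' hA'; exists T.
have interval_lb_fredholm : interval_lbs -> forall A', Mplus U V W A' -> fredholm_with_index p0 A' 0.
  by move=> h A' hA'; apply: invertible_fredholm => //; exact: interval_lb_inv.
have spec0 (A' : nat -> nat -> R[i]) : spec p0 A' 0 = ~ invertible_on p0 A'.
  rewrite /spec /=; congr (~ invertible_on p0 _).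
  by apply/funext => i; apply/funext => j; rewrite mul0rn subr0.
split.
  tfae.
  - move=> [A' eA' fA']; have [C C0 hC] := fsm_interval_lb U0 V0 W0 cU cV cW hp0 eA' fA'.
    exists B => //; exact: (interval_lb_fsm_plus U0 V0 W0 hK hK' C0 hC eB.1 hp0).
  - by move=> [B' eB' [iB' _ _]]; exact: (interval_lb_inv (inv_interval_lb B' eB' iB')).
  - move=> h; split => //; have [C C0 hC] := inv_interval_lb B eB (h B eB.1).
    have [k _ hk] := interval_lb_inverse_plus U0 V0 W0 K0 hK hK' C0 hC.
    exists k => A' hA'; have [T /(_ p0 hp0)[hT nT]] := hk A' hA'.
    by rewrite (invnormE hp0 hT).
  - by move=> [h _]; exists B => //; exact: h eB.1.
  - move=> [B' eB' iB'] [A' hA']; rewrite spec0; apply.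
    exact: (interval_lb_inv (inv_interval_lb B' eB' iB') A' hA').
  - move=> h; exists B => //; apply: invertible_fredholm => //; apply: contrapT => nB.
    by apply: h; exists B; [exact: eB.1|rewrite spec0].
  - by move=> [B' eB' fB']; apply: interval_lb_fredholm; exact: (index0_interval_lb U0 V0 W0 cU cV cW hp0 eB' fB').
  - move=> h; have [C C0 hC] := index0_interval_lb U0 V0 W0 cU cV cW hp0 eB (h B eB.1).
    exact: (interval_lb_kappa U0 V0 W0 cU cV cW C0 hC hp0).
  - move=> [hc hk] A' hA'; have [C C0 hC] := kappa0_interval_lb U0 V0 W0 cU cV cW hp0 hc hk.
    exact: (interval_lb_fsm_bi U0 V0 W0 hK hK' C0 hC hA' hp0).
  - move=> h A' hA'; have [C C0 hC] := fsm_interval_lb U0 V0 W0 cU cV cW hp0 eA (h A eA.1).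
    exact: (interval_lb_fsm_plus U0 V0 W0 hK hK' C0 hC hA' hp0).
  - move=> h; have [iB _ _] := h B eB.1; have [C C0 hC] := inv_interval_lb B eB iB.
    exact: (interval_lb_finitely_invertible U0 V0 W0 cU cV cW C0 hC hp0).
  - move=> /(finite_interval_lb K0 hK' hp0)[C C0 hC].
    exists A => //; exact: (interval_lb_fsm_bi U0 V0 W0 hK hK' C0 hC eA.1 hp0).
move=> /(finite_interval_lb K0 hK' hp0)[C C0 hC] p q p1 q1 pq.
have qp : (q^-1 + p^-1 = 1)%E by rewrite addeC.
have fin r s r1 s1 := @Nfin_max R U V W U0 V0 W0 K K0 hK hK' C C0 hC r s r1 s1.
split; first exact: fin.
move=> [_ _ fp] [_ _ fq].
(* [favourable] quantifies over pseudoergodic operators, so one has to be exhibited before the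
   equality of [Nplus] and [Nbi] can be extracted. *)
have [Bp /fp[_ _ hp]] := ex_PsiEplus U0 V0 W0 p1.
have [Bq /fq[_ _ hq]] := ex_PsiEplus U0 V0 W0 q1.
have bi : Nbi p U V W = Nbi q U V W.
  by apply/eqP; rewrite eq_le !(NbiC U0 V0 W0 K0 hK hK' C0 hC).
by rewrite (fin p q)// (fin q p)// hp hq bi maxxx.
Qed.
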